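(* Let $S\in\mathcal M_3^s(\mathbb R)$. The variational formulations $$\text{find } w_S\in LP_0\ \text{ such that }\ \frac1{|Y|}\int_Y C\,\nabla_s w_S\,dy=S\ \text{ and }\ \int_Y\langle C\,\nabla_s w_S,\nabla_s v\rangle\,dy=0\quad\forall v\in H^1_{\#0} \tag{a}$$ and $$\text{find }\sigma_S\in\mathbb T(S)\ \text{ such that }\ \int_Y\langle D\sigma_S,\mu\rangle\,dy=0\quad\forall\mu\in\mathbb T(0) \tag{b}$$ are equivalent, under the correspondence $\sigma_S=C\,\nabla_s w_S$: if $w_S$ solves (a) then $\sigma_S=C\,\nabla_s w_S$ solves (b); conversely, if $\sigma_S$ solves (b) then there exists $w_S\in LP_0$ with $\sigma_S=C\,\nabla_s w_S$, and $w_S$ solves (a).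
   Context: Let $\mathcal G\subset\mathbb R^3$ be the lattice (additive group) generated by three linearly independent vectors $g_1,g_2,g_3$, and let $Y=\{s_1g_1+s_2g_2+s_3g_3: s_1,s_2,s_3\in[0,1]\}$. A function on $\mathbb R^3$ is $\mathcal G$-periodic if it is invariant under translations by vectors of $\mathcal G$. $\mathcal M_3^s(\mathbb R)$ is the space of real symmetric $3\times3$ matrices, $\langle\cdot,\cdot\rangle$ is the Frobenius inner product of matrices, $\nabla_s v$ is the symmetric part of the gradient of $v$, and $(\operatorname{div}\mu)_i=\sum_j\partial_j\mu_{ij}$ in the sense of distributions on $\mathbb R^3$. $H^1_\#$ is the space of $\mathcal G$-periodic vector fields in $H^1_{\rm loc}(\mathbb R^3,\mathbb R^3)$, with the $H^1(Y)$ norm; $H^1_{\#0}=\{v\in H^1_\#\mid\int_Y v\,dy=0\}$. $LP=\{u \mid u(y)=Ay+\varphi(y),\ A\in\mathcal M_3^s(\mathbb R),\ \varphi\in H^1_\#\}$ and $LP_0=\{v\in LP\mid\int_Y v\,dy=0\}$. $\mathbb L^2_{\#s}$ is the space of $\mathcal G$-periodic symmetric $3\times 3$ matrix fields in $L^2_{\rm loc}(\mathbb R^3)$, with the $L^2(Y)$ norm. For $S\in\mathcal M_3^s(\mathbb R)$, $\mathbb T(S)=\{\mu\in\mathbb L^2_{\#s}\mid\operatorname{div}\mu=0,\ \frac1{|Y|}\int_Y\mu\,dy=S\}$. The rigidity tensor $C$ is a $\mathcal G$-periodic, measurable, essentially bounded field of fourth-order tensors on $\mathbb R^3$, with the usual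 symmetries of elasticity (for a.e. $y$, $C(y)$ is a self-adjoint linear map of $\mathcal M_3^s(\mathbb R)$ into itself), and uniformly positive definite: there is $\alpha>0$ with $\langle C(y)\xi,\xi\rangle\ge\alpha|\xi|^2$ for all $\xi\in\mathcal M_3^s(\mathbb R)$ and a.e. $y$. The compliance tensor is $D(y)=C(y)^{-1}$ (inverse on $\mathcal M_3^s(\mathbb R)$). *)

(* Defs.v *)
From HB Require Import structures.
From mathcomp Require Import all_boot all_order all_algebra.
From mathcomp Require Import all_classical all_reals all_analysis.

Set Implicit Arguments.
Unset Strict Implicit.
Unset Printing Implicit Defensive.

Import Order.TTheory GRing.Theory Num.Theory.
Import numFieldNormedType.Exports.

Local Open Scope classical_set_scope.
Local Open Scope ring_scope.

(* Fields on R^3 are represented by Borel measurable functions; periodicity,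
   symmetry, etc. are required almost everywhere, so that they only depend on
   the class of the function modulo almost-everywhere equality. *)

Section Fields.
Variable R : realType.

Local Notation E := (R * R * R)%type.

(* [E] as a measurable type, with the Borel sigma-algebra carried by the
   library's Lebesgue measure. *)
Local Notation EB :=
  (measurableTypeR R * measurableTypeR R * measurableTypeR R)%type.

Definition leb3 : {measure set EB -> \bar R} :=
  (((@lebesgue_measure R) \x (@lebesgue_measure R)) \x (@lebesgue_measure R))%E.

Definition colv (y : E) : 'cV[R]_3 :=
  \col_(i < 3) [:: y.1.1; y.1.2; y.2]`_i.

Definition dirv (j : 'I_3) : E :=
  ((j == 0%N :> nat)%:R, (j == 1%N :> nat)%:R, (j == 2%N :> nat)%:R).

Definition lattice (g : 'I_3 -> E) : set E :=
  [set \sum_(i < 3) g i *~ k i | k in [set: 'I_3 -> int]].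

Definition cell (g : 'I_3 -> E) : set E :=
  [set \sum_(i < 3) s i *: g i | s in [set s | forall i, 0 <= s i <= 1]].

Definition periodic (T : Type) (g : 'I_3 -> E) (f : E -> T) : Prop :=
  forall t : E, lattice g t -> {ae leb3, forall y : E, f (y + t) = f y}.

Definition intM (m n : nat) (A : set E) (F : E -> 'M[R]_(m, n)) : 'M[R]_(m, n) :=
  \matrix_(i, j) \int[leb3]_(y in A) F y i j.

Definition L2loc (f : E -> R) : Prop :=
  measurable_fun [set: EB] f /\
  forall K : set E, compact K -> (\int[leb3]_(y in K) ((f y) ^+ 2)%:E < +oo)%E.

Definition L2locM (m n : nat) (F : E -> 'M[R]_(m, n)) : Prop :=
  forall i j, L2loc (fun y => F y i j).

Definition iter_partial (s : seq 'I_3) (f : E -> R) : E -> R :=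
  foldr (fun j h => 'D_(dirv j) h) f s.

Definition smooth (f : E -> R) : Prop :=
  forall s : seq 'I_3, continuous (iter_partial s f) /\
    forall j y, derivable (iter_partial s f) y (dirv j).

Definition test_fun (psi : E -> R) : Prop :=
  smooth psi /\ compact (closure [set y | psi y != 0]).

(* [dpartial j f] is the distributional derivative of [f] in the direction [j],
   as a linear form on test functions. *)
Definition dpartial (j : 'I_3) (f : E -> R) (psi : E -> R) : R :=
  - \int[leb3]_y (f y * 'D_(dirv j) psi y).

(* [G y i j] is the weak derivative of the component [v_i] in the direction
   [j]. *)
Definition is_weak_grad (v : E -> 'cV[R]_3) (G : E -> 'M[R]_3) : Prop :=
  L2locM G /\ forall psi, test_fun psi -> forall i j,
    dpartial j (fun y => v y i 0) psi = \int[leb3]_y (G y i j * psi y).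

Definition H1loc (v : E -> 'cV[R]_3) : Prop :=
  L2locM v /\ exists G, is_weak_grad v G.

(* A weak gradient is unique up to almost-everywhere equality; [grad v] is a
   chosen representative, meaningful when [H1loc v] holds. *)
Definition grad (v : E -> 'cV[R]_3) : E -> 'M[R]_3 :=
  xget (fun=> 0) [set G | is_weak_grad v G].

Definition grads (v : E -> 'cV[R]_3) (y : E) : 'M[R]_3 :=
  2^-1 *: (grad v y + (grad v y)^T).

Definition div_free (mu : E -> 'M[R]_3) : Prop :=
  forall psi, test_fun psi -> forall i,
    \sum_(j < 3) dpartial j (fun y => mu y i j) psi = 0.

Definition symM : set 'M[R]_3 := [set A | A^T = A].

Definition frob (A B : 'M[R]_3) : R := \sum_(i < 3) \sum_(j < 3) A i j * B i j.

Definition H1per (g : 'I_3 -> E) (v : E -> 'cV[R]_3) : Prop :=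
  H1loc v /\ periodic g v.

Definition H1per0 (g : 'I_3 -> E) (v : E -> 'cV[R]_3) : Prop :=
  H1per g v /\ intM (cell g) v = 0.

Definition LP (g : 'I_3 -> E) (u : E -> 'cV[R]_3) : Prop :=
  exists A phi, [/\ symM A, H1per g phi & forall y, u y = A *m colv y + phi y].

Definition LP0 (g : 'I_3 -> E) (u : E -> 'cV[R]_3) : Prop :=
  LP g u /\ intM (cell g) u = 0.

Definition L2pers (g : 'I_3 -> E) (mu : E -> 'M[R]_3) : Prop :=
  [/\ L2locM mu, periodic g mu & {ae leb3, forall y : E, symM (mu y)}].

Definition meanM (g : 'I_3 -> E) (F : E -> 'M[R]_3) : 'M[R]_3 :=
  (fine (leb3 (cell g)))^-1 *: intM (cell g) F.

Definition stress (g : 'I_3 -> E) (S : 'M[R]_3) (mu : E -> 'M[R]_3) : Prop :=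
  [/\ L2pers g mu, div_free mu & meanM g mu = S].

Definition tensor4 : Type := 'I_3 -> 'I_3 -> 'I_3 -> 'I_3 -> R.

Definition tapp (T : tensor4) (xi : 'M[R]_3) : 'M[R]_3 :=
  \matrix_(i, j) \sum_(k < 3) \sum_(l < 3) T i j k l * xi k l.

(* Only the action of [T] on symmetric matrices is constrained. *)
Definition elastic_sym (T : tensor4) : Prop :=
  (forall xi, symM xi -> symM (tapp T xi)) /\
  (forall xi eta, symM xi -> symM eta ->
     frob (tapp T xi) eta = frob xi (tapp T eta)).

Definition rigidity (g : 'I_3 -> E) (C : E -> tensor4) : Prop :=
  [/\ periodic g C,
      forall i j k l, measurable_fun [set: EB] (fun y => C y i j k l),
      forall i j k l, exists M, {ae leb3, forall y : E, `|C y i j k l| <= M},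
      {ae leb3, forall y : E, elastic_sym (C y)} &
      exists2 alpha : R, 0 < alpha & {ae leb3, forall y : E,
        forall xi, symM xi -> alpha * frob xi xi <= frob (tapp (C y) xi) xi}].

(* The inverse of [tapp T] as a map of [symM] into itself, meaningful when
   [tapp T] is a bijection of [symM]. *)
Definition compliance (T : tensor4) : 'M[R]_3 -> 'M[R]_3 :=
  'pinv_(fun=> 0) symM (tapp T).

Definition problem_a (g : 'I_3 -> E) (C : E -> tensor4) (S : 'M[R]_3)
    (w : E -> 'cV[R]_3) : Prop :=
  [/\ LP0 g w,
      meanM g (fun y => tapp (C y) (grads w y)) = S &
      forall v, H1per0 g v ->
        \int[leb3]_(y in cell g) frob (tapp (C y) (grads w y)) (grads v y) = 0].

Definition problem_b (g : 'I_3 -> E) (C : E -> tensor4) (S : 'M[R]_3)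
    (sigma : E -> 'M[R]_3) : Prop :=
  stress g S sigma /\
  forall mu, stress g 0 mu ->
    \int[leb3]_(y in cell g) frob (compliance (C y) (sigma y)) (mu y) = 0.

End Fields.

(* Main.v *)
(* Everything rests on the orthogonal decomposition of a periodic symmetric field
   [e] of L^2(Y) into a constant, a strain [sym (grad phi)] with [phi] periodic,
   and a divergence-free field of mean zero. It comes from the Hilbert projection
   on the closure of the strains of periodized test functions: what is orthogonal
   to these strains and to the constants is divergence free with mean zero, and
   Korn's inequality (exchange of derivatives, by discrete translations) together
   with Poincare's inequality shows that the limits are still strains.
   Conversely, a periodic divergence-free field [m] is orthogonal to every
   periodic gradient [G]: the correlation [t |-> int_Y m(y) G(y + t) dy] is
   continuous and, by Fubini, integrates to zero against every test function.

   (a) => (b): testing (a) with periodized test functions gives [div sigma = 0],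
   and [D sigma] is the strain of [w], orthogonal to [T(0)].
   (b) => (a): decompose [e = D sigma]; by (b) its divergence-free part is
   orthogonal to itself, hence vanishes, and [e] is the strain of an affine map
   plus a periodic field. *)

From HB Require Import structures.
Require Import Defs.
From mathcomp Require Import all_boot all_order all_algebra.
From mathcomp Require Import all_classical all_reals all_analysis.
From mathcomp Require Import measurable_realfun.
From mathcomp Require Import ring lra zify.

Set Implicit Arguments.
Unset Strict Implicit.
Unset Printing Implicit Defensive.

Import Order.TTheory GRing.Theory Num.Theory.
Import numFieldNormedType.Exports.

Local Open Scope classical_set_scope.
Local Open Scope ring_scope.

(** * Projection in an inner product space *)

(** Functions are never identified almost everywhere: inner products are only semidefinite, a
    Hilbert projection is known up to length zero, and completeness of L^2(Y) yields limits on the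
    cell only, which must then be extended periodically. Two kinds of integrals have to be linked:
    distributions are tested on R^3 with compactly supported functions, while orthogonality lives on
    the cell. The link is unfolding, which replaces a test function by the sum of its lattice
    translates; these sums also serve as the smooth periodic functions. Derivatives enter through
    difference quotients, so that integration by parts, the exchange of derivatives and Poincare's
    inequality all reduce to the translation invariance of integrals. In the orthogonality of
    divergence-free fields and gradients neither factor is smooth; instead of approximating one of
    them by smooth periodic fields, averaging the correlation over small shifts moves the derivative
    to a bump. The matrix of the affine part is the mean of [e]: strains of periodic fields have
    mean zero, so the constants form an orthogonal summand of their own. *)

Section hilbert.
Variables (R : realType) (V : lmodType R) (P : V -> Prop) (ip : V -> V -> R).

Definition cauchy_for (u : nat -> V) : Prop :=
  forall e : R, 0 < e -> exists N, forall m n, (N <= m)%N -> (N <= n)%N ->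
    ip (u m - u n) (u m - u n) <= e.

(** Semidefinite on purpose: [V] will be a space of functions, where a nonzero function may have
    length zero. The predicate [P] stands for the subspace, so that no type of square integrable
    functions has to be built. *)
Record prehilbert : Prop := Prehilbert {
  ph0 : P 0;
  phD : forall x y, P x -> P y -> P (x + y);
  phZ : forall a x, P x -> P (a *: x);
  phC : forall x y, P x -> P y -> ip x y = ip y x;
  phDl : forall x y z, P x -> P y -> P z -> ip (x + y) z = ip x z + ip y z;
  phZl : forall a x y, P x -> P y -> ip (a *: x) y = a * ip x y;
  ph_ge0 : forall x, P x -> 0 <= ip x x }.

Hypothesis H : prehilbert.

Lemma phN x : P x -> P (- x).
Proof. by move=> Px; rewrite -scaleN1r; exact: (phZ H). Qed.

Lemma phB x y : P x -> P y -> P (x - y).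
Proof. by move=> Px Py; apply: (phD H) => //; exact: phN. Qed.

Lemma phNl x y : P x -> P y -> ip (- x) y = - ip x y.
Proof. by move=> Px Py; rewrite -scaleN1r (phZl H) // mulN1r. Qed.

Lemma phBl x y z : P x -> P y -> P z -> ip (x - y) z = ip x z - ip y z.
Proof. by move=> Px Py Pz; rewrite (phDl H) ?phNl //; exact: phN. Qed.

Lemma phBr x y z : P x -> P y -> P z -> ip z (x - y) = ip z x - ip z y.
Proof.
by move=> *; rewrite (phC H) // ?phBl //; first congr (_ - _);
  try exact: (phC H); exact: phB.
Qed.

Lemma phZr a x y : P x -> P y -> ip y (a *: x) = a * ip y x.
Proof.
by move=> *; rewrite (phC H) ?(phZl H) // 1?(phC H) //; exact: (phZ H).
Qed.

Lemma ph_quad a x y : P x -> P y ->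
  ip (x - a *: y) (x - a *: y) = ip x x - 2 * a * ip x y + a ^+ 2 * ip y y.
Proof.
move=> Px Py; have Pay : P (a *: y) by exact: (phZ H).
have Pxy : P (x - a *: y) by exact: phB.
rewrite phBl // !phBr // !(phZl H) // !phZr // (phC H Py Px); ring.
Qed.

Lemma ph_csq x y : P x -> P y -> ip x y ^+ 2 <= ip x x * ip y y.
Proof.
move=> Px Py.
have Q a : 0 <= ip x x - 2 * a * ip x y + a ^+ 2 * ip y y.
  by rewrite -ph_quad //; apply: (ph_ge0 H); apply: phB => //; exact: (phZ H).
have xx := ph_ge0 H Px; have yy := ph_ge0 H Py.
have [y0|y0] := eqVneq (ip y y) 0.
  rewrite y0 mulr0; have [->|xy0] := eqVneq (ip x y) 0; first by rewrite expr0n.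
  (* With [ip y y = 0] the polynomial is affine in [a], and at this point it takes the value -1. *)
  have := Q ((ip x x + 1) / (2 * ip x y)); rewrite y0 mulr0 addr0.
  have -> : 2 * ((ip x x + 1) / (2 * ip x y)) * ip x y = ip x x + 1 by field.
  lra.
have {}yy : 0 < ip y y by rewrite lt_neqAle eq_sym y0.
have := Q (ip x y / ip y y).
have -> : ip x x - 2 * (ip x y / ip y y) * ip x y
   + (ip x y / ip y y) ^+ 2 * ip y y
   = (ip x x * ip y y - ip x y ^+ 2) / ip y y by field.
by rewrite pmulr_lge0 ?invr_gt0 // subr_ge0.
Qed.

(** The parallelogram identity with the midpoint isolated: in [hilbert_proj] the midpoint of two
    elements of [W] competes for the infimum. *)
Lemma ph_para x y : P x -> P y ->
  ip (x - y) (x - y) = 2 * ip x x + 2 * ip y y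
    - 4 * ip (2^-1 *: (x + y)) (2^-1 *: (x + y)).
Proof.
move=> Px Py; have Pxy : P (x + y) by exact: (phD H).
have Pz : P (2^-1 *: (x + y)) by exact: (phZ H).
rewrite (phZl H) // phZr //.
have -> : x + y = x - (-1) *: y by rewrite scaleN1r opprK.
have -> : x - y = x - 1 *: y by rewrite scale1r.
by rewrite !ph_quad //; field.
Qed.

Lemma ph_tri2 x y : P x -> P y ->
  ip (x + y) (x + y) <= 2 * ip x x + 2 * ip y y.
Proof.
move=> Px Py; have -> : x + y = x - (-1) *: y by rewrite scaleN1r opprK.
rewrite ph_quad //.
have : 0 <= ip (x - 1 *: y) (x - 1 *: y).
  by apply: (ph_ge0 H); apply: phB => //; exact: (phZ H).
rewrite ph_quad //; lra.
Qed.

Hypothesis complete : forall u : nat -> V, (forall n, P (u n)) ->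
  cauchy_for u -> exists2 p, P p & ip (u n - p) (u n - p) @[n --> \oo] --> 0.

Variable W : V -> Prop.
Hypothesis WP : forall x, W x -> P x.
Hypothesis W0 : W 0.
Hypothesis WD : forall x y, W x -> W y -> W (x + y).
Hypothesis WZ : forall a x, W x -> W (a *: x).

(** [W] need not be closed, so [p] lies only in its closure; the minimizing sequence is part of the
    conclusion because later arguments pass to the limit along it. *)
Lemma hilbert_proj x : P x -> exists w p, [/\ forall n : nat, W (w n), P p,
  ip (w n - p) (w n - p) @[n --> \oo] --> 0 & forall z, W z -> ip (x - p) z = 0].
Proof.
move=> Px.
pose S := [set ip (x - z) (x - z) | z in W].
have S0 : S !=set0 by exists (ip (x - 0) (x - 0)); exists 0.
have Slb : lbound S 0.
  by move=> _ [z Wz <-]; apply: (ph_ge0 H); apply: phB => //; exact: WP.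
have hS : has_inf S by split => //; exists 0.
set dd := inf S.
have ddle z : W z -> dd <= ip (x - z) (x - z).
  by move=> Wz; apply: ge_inf; [exists 0|exists z].
have ex n : exists z, W z /\ ip (x - z) (x - z) < dd + n.+1%:R^-1.
  have n0 : (0 : R) < n.+1%:R^-1 by rewrite invr_gt0 ltr0n.
  by have [_ [z Wz <-] lt] := @inf_adherent _ S _ n0 hS; exists z.
have [w wP] := choice ex.
have Ww n := (wP n).1; have Pw n := WP (Ww n).
have small (e : R) : 0 < e -> exists N, forall n, (N <= n)%N -> n.+1%:R^-1 <= e.
  move=> e0; have [N HN] : exists N : nat, e^-1 < N%:R.
    by exists (Num.bound e^-1); exact: unstable.ltr_bound.
  exists N => n Nn; rewrite -[e]invrK lef_pV2 ?posrE ?invr_gt0 //.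
  apply: ltW; apply: lt_le_trans HN _; rewrite ler_nat; exact: leqW.
have [p Pp wp] : exists2 p, P p & ip (w n - p) (w n - p) @[n --> \oo] --> 0.
  apply: complete => // e e0.
  have e4 : 0 < e / 4 by rewrite divr_gt0.
  have [N HN] := small _ e4; exists N => m n Nm Nn.
  have -> : w m - w n = (x - w n) - (x - w m) by rewrite opprB [RHS]addrC subrKA.
  have Pm : P (x - w m) by exact: phB.
  have Pn : P (x - w n) by exact: phB.
  rewrite ph_para //.
  have -> : 2^-1 *: (x - w n + (x - w m)) = x - 2^-1 *: (w n + w m).
    rewrite addrACA -opprD scalerBr; congr (_ - _).
    by rewrite -[in RHS](scale1r x) scalerDr -scalerDl -[2^-1]mul1r -(splitr 1) scale1r.
  (* The midpoint is at squared distance at least [dd], the two ends at most [dd] plus [e / 4], and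
     the parallelogram identity leaves at most [e]. *)
  have := ddle _ (WZ 2^-1 (WD (Ww n) (Ww m))).
  have [_] := wP n; have [_] := wP m; have := HN _ Nm; have := HN _ Nn.
  move: (n.+1%:R^-1) (m.+1%:R^-1) => r1 r2; lra.
exists w, p; split => // z Wz; have Pz := WP Wz.
(* Moving [w n] along [z] gains at most the defect [n.+1%:R^-1]; optimizing the length of the move
   bounds the residual product, which therefore vanishes in the limit. *)
have est n : ip (x - w n) z ^+ 2 <= n.+1%:R^-1 * ip z z.
  have Pxw : P (x - w n) by exact: phB.
  have Q a : 0 <= n.+1%:R^-1 - 2 * a * ip (x - w n) z + a ^+ 2 * ip z z.
    have Wa : W (w n + a *: z) by apply: WD => //; exact: WZ.
    have := ddle _ Wa; rewrite opprD addrA ph_quad //.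
    have [_] := wP n; move: (n.+1%:R^-1) => r; lra.
  have zz := ph_ge0 H Pz.
  have [z0|z0] := eqVneq (ip z z) 0.
    have := ph_csq Pxw Pz; rewrite z0 mulr0 => h; rewrite mulr0; exact: h.
  have {}zz : 0 < ip z z by rewrite lt_neqAle eq_sym z0.
  have := Q (ip (x - w n) z / ip z z).
  set q := ip (x - w n) z.
  have -> : n.+1%:R^-1 - 2 * (q / ip z z) * q + (q / ip z z) ^+ 2 * ip z z
     = (n.+1%:R^-1 * ip z z - q ^+ 2) / ip z z.
    by field; rewrite z0 /= addrC natr1 pnatr_eq0.
  by rewrite pmulr_lge0 ?invr_gt0 // subr_ge0.
have est2 n : ip (x - p) z ^+ 2 <=
    2 * (n.+1%:R^-1 * ip z z) + 2 * (ip (w n - p) (w n - p) * ip z z).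
  have -> : x - p = (x - w n) + (w n - p) by rewrite addrA subrK.
  rewrite (phDl H); [|exact: phB|exact: phB|by []].
  have := est n; have := ph_csq (phB (Pw n) Pp) Pz.
  move: (n.+1%:R^-1 * _) (ip (w n - p) (w n - p) * _) => r1 r2.
  move: (ip (x - w n) z) (ip (w n - p) z) => a b.
  have : 0 <= (a - b) ^+ 2 by exact: sqr_ge0.
  rewrite !expr2; lra.
apply/eqP; rewrite -sqrf_eq0 eq_le sqr_ge0 andbT.
have lim0 : (2 * (n.+1%:R^-1 * ip z z) + 2 * (ip (w n - p) (w n - p) * ip z z))
    @[n --> \oo] --> (2 * (0 * ip z z) + 2 * (0 * ip z z) : R).
  apply: cvgD; apply: cvgMr; apply: cvgMl => //; exact: cvg_harmonic.
rewrite mul0r mulr0 addr0 in lim0.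
apply: (ler_cvg_to (cvg_cst _) lim0); apply: nearW => n; exact: est2.
Qed.

End hilbert.

(** * Completeness of L^2 *)

Section L2.
Context d (T : measurableType d) (R : realType) (mu : {measure set T -> \bar R}).
Variables (D : set T) (mD : measurable D).
Implicit Types f g h : T -> R.

Definition L2on f : Prop := measurable_fun setT f /\
  mu.-integrable D (EFin \o (fun x => f x ^+ 2)).

Definition ipL2 f g : R := \int[mu]_(x in D) (f x * g x).

Lemma L2on_lty f : measurable_fun setT f ->
  (\int[mu]_(x in D) (f x ^+ 2)%:E < +oo)%E -> L2on f.
Proof.
move=> mf foo; split=> //; apply/integrableP; split.
  apply/measurable_EFinP; apply: measurable_funTS; exact: measurable_funX.
apply: le_lt_trans foo; apply: ge0_le_integral => //.
- apply: measurableT_comp => //; apply/measurable_EFinP.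
  by apply: measurable_funTS; exact: measurable_funX.
- by apply/measurable_EFinP; apply: measurable_funTS; exact: measurable_funX.
- by move=> x _ /=; rewrite ger0_norm ?sqr_ge0.
Qed.

Lemma integrable_le f g : measurable_fun setT f ->
  mu.-integrable D (EFin \o g) -> (forall x, D x -> `|f x| <= g x) ->
  mu.-integrable D (EFin \o f).
Proof.
move=> mf ig fg; apply: le_integrable ig => //.
  by apply/measurable_EFinP; exact: measurable_funTS.
move=> x Dx /=; rewrite lee_fin (le_trans (fg x Dx)) //; exact: ler_norm.
Qed.

Lemma integrable_addR f g : mu.-integrable D (EFin \o f) ->
  mu.-integrable D (EFin \o g) -> mu.-integrable D (EFin \o (fun x => f x + g x)).
Proof. by move=> f1 g1; have := integrableD mD f1 g1; apply: eq_integrable. Qed.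

Lemma integrable_scaleR a f : mu.-integrable D (EFin \o f) ->
  mu.-integrable D (EFin \o (fun x => a * f x)).
Proof. by move=> f1; have := integrableZl mD a f1; apply: eq_integrable. Qed.

Lemma L2on_mul f g : L2on f -> L2on g ->
  mu.-integrable D (EFin \o (fun x => f x * g x)).
Proof.
move=> [mf f2] [mg g2].
apply: (integrable_le _ (integrable_addR f2 g2)).
  exact: measurable_funM.
move=> x _; rewrite ler_norml.
have := sqr_ge0 (f x + g x); have := sqr_ge0 (f x - g x).
have := sqr_ge0 (f x); have := sqr_ge0 (g x).
rewrite !expr2 => *; apply/andP; split; lra.
Qed.

Lemma L2on0 : L2on 0.
Proof.
apply: L2on_lty; first exact: measurable_cst.
by under eq_integral do rewrite expr0n /=; rewrite integral0.
Qed.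

Lemma L2onZ a f : L2on f -> L2on (a *: f).
Proof.
move=> [mf f2]; split; first exact: measurable_funM.
have := integrable_scaleR (a ^+ 2) f2; apply: eq_integrable => //.
by move=> x _ /=; rewrite exprMn.
Qed.

Lemma L2onD f g : L2on f -> L2on g -> L2on (f + g).
Proof.
move=> Lf Lg; have [mf f2] := Lf; have [mg g2] := Lg.
split; first exact: measurable_funD.
apply: (integrable_le _
  (integrable_addR (integrable_scaleR 2 f2) (integrable_scaleR 2 g2))).
  by apply: measurable_funX; exact: measurable_funD.
move=> x _; rewrite ger0_norm ?sqr_ge0 //.
have := sqr_ge0 (f x - g x); rewrite -[(f + g) x]/(f x + g x) !expr2 => *; lra.
Qed.

Lemma L2on_prehilbert : prehilbert L2on ipL2.
Proof.
split.
- exact: L2on0.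
- exact: L2onD.
- exact: L2onZ.
- by move=> f g _ _; apply: eq_Rintegral => x _; exact: mulrC.
- move=> f g h Lf Lg Lh; rewrite /ipL2 -RintegralD //; try exact: L2on_mul.
  by apply: eq_Rintegral => x _; rewrite -mulrDl.
- move=> a f g Lf Lg; rewrite /ipL2 -RintegralZl //; last exact: L2on_mul.
  by apply: eq_Rintegral => x _; rewrite mulrA.
- by move=> f _; apply: Rintegral_ge0 => x _; rewrite -expr2 sqr_ge0.
Qed.

Lemma ipL2_EFin f : L2on f ->
  (ipL2 f f)%:E = (\int[mu]_(x in D) (f x ^+ 2)%:E)%E.
Proof.
move=> [mf f2]; rewrite /ipL2 /Rintegral fineK //.
rewrite (_ : (fun x => (f x * f x)%:E) = EFin \o (fun x => f x ^+ 2)) //.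
exact: integrable_fin_num.
Qed.

Lemma L2on_ae0 f : L2on f -> ipL2 f f = 0 -> {ae mu, forall x, D x -> f x = 0}.
Proof.
move=> Lf f0; have [mf f2] := Lf.
have := ipL2_EFin Lf; rewrite f0 => /esym h.
have mf2 : measurable_fun D (EFin \o (fun x => f x ^+ 2)) by exact: measurable_int f2.
have /(ae_eq_integral_abs mu mD mf2) : (\int[mu]_(x in D)
   `|(EFin \o (fun x => (f x ^+ 2)%R)) x| = 0)%E.
  by rewrite -[RHS]h; apply: eq_integral => x _ /=; rewrite ger0_norm ?sqr_ge0.
apply: filterS => x h2 Dx; have /= := h2 Dx.
by move=> [] /eqP; rewrite sqrf_eq0 => /eqP.
Qed.

Lemma ae_ipL2 f f' g g' : measurable_fun setT f -> measurable_fun setT f' ->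
  measurable_fun setT g -> measurable_fun setT g' ->
  {ae mu, forall x, D x -> f x = f' x} -> {ae mu, forall x, D x -> g x = g' x} ->
  ipL2 f g = ipL2 f' g'.
Proof.
move=> mf mf' mg mg' ff' gg'; congr fine; apply: ae_eq_integral => //.
- by apply/measurable_EFinP/measurable_funTS; exact: measurable_funM.
- by apply/measurable_EFinP/measurable_funTS; exact: measurable_funM.
by move: ff' gg'; apply: filterS2 => x h1 h2 Dx; rewrite h1 // h2.
Qed.

(** Riesz-Fischer. A subsequence with squared increments at most [8^-1 ^+ k] converges almost
    everywhere, and Fatou's lemma along it transfers the Cauchy estimate of the whole sequence to
    the limit. *)
Lemma L2on_complete (u : nat -> T -> R) : (forall n, L2on (u n)) ->
  cauchy_for ipL2 u ->
  exists2 f, L2on f & ipL2 (u n - f) (u n - f) @[n --> \oo] --> 0.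
Proof.
move=> Lu cu; have LH := L2on_prehilbert.
have LB := phB LH.
have p8 k : (0 : R) < 8^-1 ^+ k by rewrite exprn_gt0 // invr_gt0.
have [N0 HN0] := choice (fun k => cu _ (p8 k)).
(* Summing the ranks puts [ph k] beyond every earlier rank; the successors ensure [k <= ph k]. *)
pose ph k := (\sum_(i < k.+1) (N0 i).+1)%N.
have phN k m : (N0 k <= ph (k + m))%N.
  rewrite /ph; have km : (k < (k + m).+1)%N by rewrite ltnS leq_addr.
  by rewrite (bigD1 (Ordinal km)) //= (leq_trans (leqnSn _)) ?leq_addr.
have phk k : (k <= ph k)%N.
  rewrite -[leqLHS]card_ord -sum1_card /ph big_ord_recr /=.
  by rewrite (leq_trans _ (leq_addr _ _)) // leq_sum.
pose v k := u (ph k); pose t k := v k.+1 - v k.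
have tint k : (\int[mu]_(x in D) ((t k x) ^+ 2)%:E <= (8^-1 ^+ k)%:E)%E.
  rewrite -ipL2_EFin; last by apply: LB; exact: Lu.
  rewrite lee_fin; apply: HN0.
  - by have := phN k 1%N; rewrite addn1.
  - by have := phN k 0%N; rewrite addn0.
have mv k : measurable_fun setT (v k) by have [] := Lu (ph k).
have mt k : measurable_fun setT (t k) by exact: measurable_funB.
(* The weight 4 lies between 1 and 8: the integrals remain bounded by a geometric series of ratio
   1/2, and finiteness of the weighted sum at a point forces [t k x] to decay like [2^-1 ^+ k]. *)
pose a k x := (4 ^+ k * (t k x) ^+ 2)%:E.
have a0 k x : (0 <= a k x)%E.
  by rewrite lee_fin mulr_ge0 ?sqr_ge0 ?exprn_ge0.
have ma k : measurable_fun setT (a k).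
  by apply/measurable_EFinP; apply: measurable_funM => //; exact: measurable_funX.
pose S x := (\sum_(0 <= k <oo) a k x)%E.
have mS : measurable_fun setT S.
  by apply: ge0_emeasurable_sum => //.
have S0 x : (0 <= S x)%E by apply: nneseries_ge0.
have Sint : (\int[mu]_(x in D) S x <= 2%:E)%E.
  rewrite /S integral_nneseries //; last first.
    by move=> k; exact: measurable_funTS.
  apply: lime_le; first by apply: is_cvg_nneseries => k _ _; exact: integral_ge0.
  apply: nearW => n.
  apply: (@le_trans _ _ (\sum_(0 <= k < n) ((2^-1 ^+ k)%:E : \bar R))%E).
    apply: lee_sum => k _.
    rewrite /a; under eq_integral do rewrite EFinM.
    rewrite ge0_integralZl ?lee_fin ?exprn_ge0 //; last 2 first.
    - by apply/measurable_EFinP/measurable_funTS; exact: measurable_funX.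
    - by move=> x _; rewrite lee_fin sqr_ge0.
    have -> : 2^-1 ^+ k = 4 ^+ k * 8^-1 ^+ k :> R.
      by rewrite -exprMn; congr (_ ^+ _); field.
    by rewrite EFinM lee_wpmul2l // lee_fin exprn_ge0.
  rewrite sumEFin lee_fin.
  have := @geometric_le_lim R n 1 2^-1.
  rewrite /series /geometric /=.
  under eq_bigr do rewrite mul1r.
  have -> : 1 / (1 - 2^-1) = 2 :> R by field.
  apply => //; rewrite ger0_norm //; lra.
pose A := [set x | (S x < +oo)%E].
have mA : measurable A.
  by rewrite -[A]setTI; exact: emeasurable_fun_infty_o.
have AD : {ae mu, forall x, D x -> A x}.
  have iS : mu.-integrable D S.
    apply/integrableP; split; first exact: measurable_funTS.
    apply: (@le_lt_trans _ _ 2%:E); last exact: ltry.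
    apply: le_trans Sint; apply: ge0_le_integral => //.
    - by apply: measurableT_comp => //; exact: measurable_funTS.
    - exact: measurable_funTS.
    - by move=> x _; rewrite gee0_abs.
  have := integrable_ae mD iS; apply: filterS => x h Dx.
  by rewrite /A /= -ge0_fin_numE //; exact: h.
(* Cutting off outside [A] makes the sequence converge at every point, which gives a measurable
   limit. *)
pose w k x := v k x * \1_A x.
have mw k : measurable_fun setT (w k).
  by apply: measurable_funM => //; exact: measurable_indic.
have wcvg x : cvgn (w ^~ x).
  have [xA|xA] := boolP (x \in A); last first.
    rewrite (_ : w ^~ x = fun=> 0); first exact: is_cvg_cst.
    by apply/funext => k; rewrite /w indicE (negbTE xA) mulr0.
  rewrite (_ : w ^~ x = v ^~ x); last first.
    by apply/funext => k; rewrite /w indicE xA mulr1.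
  have Sx : S x \is a fin_num by rewrite ge0_fin_numE //; exact: set_mem xA.
  have tS k : 4 ^+ k * (t k x) ^+ 2 <= fine (S x).
    rewrite -lee_fin fineK //; apply: le_trans (nneseries_lim_ge k.+1 _) => //.
    rewrite big_nat_recr //= leeDr //; exact: sume_ge0.
  have tb k : `|t k x| <= (1 + fine (S x)) * 2^-1 ^+ k.
    have p2 : (0 : R) < 2 ^+ k by rewrite exprn_gt0.
    rewrite exprVn -ler_pdivrMr // invrK mulrC ?invr_gt0 //.
    apply: le_trans (lerD (lexx 1) (tS k)).
    have -> : 4 ^+ k * t k x ^+ 2 = (2 ^+ k * `|t k x|) ^+ 2.
      rewrite exprMn real_normK ?num_real // -exprM mulnC exprM.
      by congr (_ ^+ _ * _); ring.
    set q := 2 ^+ k * _; have := sqr_ge0 (q - 1); have := sqr_ge0 q.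
    rewrite !expr2; lra.
  have -> : v ^~ x = fun n => v 0%N x + series (telescope (v ^~ x)) n.
    by apply/funext => n; rewrite -[LHS]/((v ^~ x) n) eq_sum_telescope.
  apply: is_cvgD; first exact: is_cvg_cst.
  apply: normed_cvg.
  apply: (@series_le_cvg _ _ (geometric (1 + fine (S x)) 2^-1)).
  - by move=> n; exact: normr_ge0.
  - by move=> n; rewrite mulr_ge0 ?exprn_ge0 // addr_ge0 // fine_ge0.
  - by move=> n; exact: tb.
  - by apply: is_cvg_geometric_series; rewrite ger0_norm //; lra.
pose f x := limn (w ^~ x).
have wf x : w k x @[k --> \oo] --> f x by exact: wcvg.
have mf : measurable_fun setT f.
  by apply: (measurable_fun_cvg mw) => x _; exact: wf.
have mu_ n : measurable_fun setT (u n) by have [] := Lu n.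
have key e : 0 < e -> exists N, forall n, (N <= n)%N ->
    (\int[mu]_(x in D) ((u n x - f x) ^+ 2)%:E <= e%:E)%E.
  move=> e0; have [N HN] := cu e e0; exists N => n Nn.
  pose F k x := ((u n x - w k x) ^+ 2)%:E.
  have mF k : measurable_fun D (F k).
    apply/measurable_EFinP/measurable_funTS/measurable_funX.
    exact: measurable_funB.
  have -> : (\int[mu]_(x in D) ((u n x - f x) ^+ 2)%:E =
      \int[mu]_(x in D) limn_einf (F ^~ x))%E.
    apply: eq_integral => x _.
    have Fc : F k x @[k --> \oo] --> ((u n x - f x) ^+ 2)%:E.
      apply: cvg_EFin; first by apply: nearW.
      rewrite (_ : fine \o F ^~ x = fun k => (u n x - w k x) * (u n x - w k x)) //.
      by apply: cvgM; apply: cvgB => //; exact: cvg_cst.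
    rewrite is_cvg_limn_einfE; first by rewrite (cvg_lim _ Fc).
    by apply/cvg_ex; eexists; exact: Fc.
  apply: le_trans (fatou mu mD mF _) _.
    by move=> k x _; rewrite lee_fin sqr_ge0.
  have Fe k : (N <= k)%N -> (\int[mu]_(x in D) F k x <= e%:E)%E.
    move=> Nk; apply: (@le_trans _ _ (\int[mu]_(x in D) (((u n - v k) x) ^+ 2)%:E)%E).
      rewrite le_eqVlt; apply/orP; left; apply/eqP; apply: ae_eq_integral => //.
        by apply/measurable_EFinP/measurable_funTS/measurable_funX; exact: measurable_funB.
      move: AD; apply: filterS => x h Dx; rewrite /F /w indicE mem_set ?mulr1 //.
      exact: h.
    rewrite -ipL2_EFin; last by apply: LB; exact: Lu.
    by rewrite lee_fin; apply: HN => //; exact: leq_trans Nk (phk k).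
  rewrite limn_einf_lim; apply: lime_le; first exact: is_cvg_einfs.
  exists N => // k /= Nk; apply: le_trans (Fe _ Nk).
  by apply: ereal_inf_lbound; exists k => /=.
have [N0' HN0'] := key 1 ltr01.
have Luf n : (N0' <= n)%N -> L2on (u n - f).
  move=> Nn; apply: L2on_lty; first exact: measurable_funB.
  by apply: le_lt_trans (HN0' _ Nn) _; exact: ltry.
have Lf : L2on f.
  rewrite (_ : f = u N0' - (u N0' - f)); last by rewrite opprB addrC subrK.
  by apply: LB => //; exact: Luf.
exists f => //; apply/cvgrPdist_le => e e0.
have [N HN] := key e e0; exists N => // n /= Nn.
rewrite sub0r normrN ger0_norm; last exact: (ph_ge0 LH (LB _ _ (Lu n) Lf)).
by rewrite -lee_fin ipL2_EFin; [exact: HN|apply: LB => //; exact: Lu].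
Qed.

End L2.

(** * Lebesgue measure on R^3 *)

Section measure_preserving.
Context d d' (X : measurableType d) (Y : measurableType d') (R : realType).
Variables (m : {measure set X -> \bar R}) (m' : {measure set Y -> \bar R}).

Definition mpres (phi : X -> Y) : Prop := measurable_fun setT phi /\
  forall A, measurable A -> m (phi @^-1` A) = m' A.

Variables (phi : X -> Y) (mphi : mpres phi).

Lemma mpres_ge0_integral (f : Y -> \bar R) : measurable_fun setT f ->
  (forall y, 0 <= f y)%E -> (\int[m]_x f (phi x) = \int[m']_y f y)%E.
Proof.
move=> mf f0; have [mp me] := mphi.
rewrite -[LHS](@ge0_integral_pushforward _ _ _ _ _ _ mp m setT f) //.
by apply: eq_measure_integral => A mA _; exact: me.
Qed.

Lemma mpres_integral (f : Y -> R) : measurable_fun setT f ->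
  (\int[m]_x (f (phi x))%:E = \int[m']_y (f y)%:E)%E.
Proof.
move=> mf; rewrite integralE [RHS]integralE.
have mf' : measurable_fun setT (EFin \o f) by exact/measurable_EFinP.
have h1 := mpres_ge0_integral (measurable_funepos mf') (funepos_ge0 (EFin \o f)).
have h2 := mpres_ge0_integral (measurable_funeneg mf') (funeneg_ge0 (EFin \o f)).
by rewrite -[in RHS]h1 -[in RHS]h2; congr (_ - _)%E; apply: eq_integral => x _; rewrite ?funeposE ?funenegE.
Qed.

Lemma mpres_Rintegral (f : Y -> R) : measurable_fun setT f ->
  \int[m]_x f (phi x) = \int[m']_y f y.
Proof. by move=> mf; rewrite /Rintegral mpres_integral. Qed.

Lemma mpres_integrable (f : Y -> R) : measurable_fun setT f ->
  m'.-integrable setT (EFin \o f) -> m.-integrable setT (EFin \o (f \o phi)).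
Proof.
move=> mf /integrableP[_ foo]; apply/integrableP; split.
  by apply/measurable_EFinP; apply: measurableT_comp => //; case: mphi.
rewrite (mpres_ge0_integral (f := fun y => `|(f y)%:E|%E)) //.
by apply: measurableT_comp => //; exact/measurable_EFinP.
Qed.

Lemma mpres_ae (P : Y -> Prop) : {ae m', forall y, P y} ->
  {ae m, forall x, P (phi x)}.
Proof.
move=> [A [mA A0 PA]]; exists (phi @^-1` A); split.
- by rewrite -[X in measurable X]setTI; case: mphi => + _; exact.
- by case: mphi => _ ->.
- by move=> x /= h; apply: PA.
Qed.

End measure_preserving.

Section prod_sigma_finite.
Context d1 d2 (X1 : measurableType d1) (X2 : measurableType d2) (R : realType).
Variables (m1 : {sigma_finite_measure set X1 -> \bar R})
  (m2 : {sigma_finite_measure set X2 -> \bar R}).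

(** Lebesgue measure on R^3 is an iterated product, so the first factor must itself be packed as a
    sigma-finite measure. Unpickling enumerates the rectangles [F i] times [G j]. *)
Lemma prod_sigma_finite : sigma_finite setT (m1 \x m2)%E.
Proof.
have [F TF Foo] := sigma_finiteT m1; have [G TG Goo] := sigma_finiteT m2.
exists (fun k => if @unpickle (nat * nat)%type k is Some ij
  then F ij.1 `*` G ij.2 else set0).
  apply/seteqP; split => // -[x y] _.
  have [i _ Fx] : (\bigcup_i F i) x by rewrite -TF.
  have [j _ Gy] : (\bigcup_i G i) y by rewrite -TG.
  by exists (pickle (i, j)) => //; rewrite pickleK.
move=> k; case: unpickle => [[i j]|]; last by rewrite measure0.
have [mF F1] := Foo i; have [mG G1] := Goo j.
split; first exact: measurableX.
by rewrite /= product_measure1E // lte_mul_pinfty // ge0_fin_numE.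
Qed.

Definition prod_sfm : {sigma_finite_measure set (X1 * X2)%type -> \bar R} :=
  HB.pack (m1 \x m2)%E (Measure_isSigmaFinite.Build _ _ _ _ prod_sigma_finite).

End prod_sigma_finite.

Lemma mpres_prod d1 d2 d3 d4 (X1 : measurableType d1) (X2 : measurableType d2)
  (Y1 : measurableType d3) (Y2 : measurableType d4) (R : realType)
  (m1 : {sigma_finite_measure set X1 -> \bar R})
  (m2 : {sigma_finite_measure set X2 -> \bar R})
  (n1 : {sigma_finite_measure set Y1 -> \bar R})
  (n2 : {sigma_finite_measure set Y2 -> \bar R}) f1 f2 :
  mpres m1 n1 f1 -> mpres m2 n2 f2 ->
  mpres (prod_sfm m1 m2) (prod_sfm n1 n2) (fun x => (f1 x.1, f2 x.2)).
Proof.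
move=> [mf1 f1E] [mf2 f2E].
have mf : measurable_fun setT (fun x : X1 * X2 => (f1 x.1, f2 x.2)).
  by apply: measurable_fun_pair; exact: measurableT_comp.
split=> // A mA; apply/esym.
change ((n1 \x n2)%E A = (m1 \x m2)%E ((fun x : X1 * X2 => (f1 x.1, f2 x.2)) @^-1` A)).
set f := (fun x : X1 * X2 => _) in mf *.
rewrite -[RHS]/(pushforward (m1 \x m2)%E f A).
apply: product_measure_unique => //.
move=> A1 A2 mA1 mA2; rewrite /pushforward /=.
change ((m1 \x m2)%E ((f1 @^-1` A1) `*` (f2 @^-1` A2)) = (n1 A1 * n2 A2)%E).
rewrite product_measure1E ?f1E ?f2E //.
  by rewrite -[X in measurable X]setTI; exact: mf1.
by rewrite -[X in measurable X]setTI; exact: mf2.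
Qed.

Section leb3.
Variable R : realType.
Local Notation E := (R * R * R)%type.
Local Notation EB :=
  (measurableTypeR R * measurableTypeR R * measurableTypeR R)%type.
Local Notation leb := (@lebesgue_measure R).

Definition leb3s : {sigma_finite_measure set EB -> \bar R} :=
  prod_sfm (prod_sfm leb leb) leb.

(** By uniqueness of Lebesgue measure on half-open intervals. Reflections are treated along with
    translations because a convolution substitutes [y - t] for [t]. *)
Lemma lebesgue_mpres (e c : R) : e = 1 \/ e = -1 ->
  mpres leb leb (fun x : measurableTypeR R => c + e * x : measurableTypeR R).
Proof.
move=> e1.
have mf : measurable_fun setT (fun x : measurableTypeR R => c + e * x : measurableTypeR R).
  by apply: measurable_funD => //; apply: measurable_funM.
split=> // A mA; apply/esym.
rewrite -[RHS]/(pushforward leb (fun x : measurableTypeR R => c + e * x : measurableTypeR R) A).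
apply: lebesgue_measure_unique => //.
move=> _ [[a b]] _ <-.
change (leb [set` `]a, b]%R] = leb ((fun x : R => c + e * x) @^-1` [set` `]a, b]%R])).
case: e1 => ->.
  rewrite (_ : _ @^-1` _ = [set` `](a - c), (b - c)]%R]); last first.
    apply/seteqP; split => x /=; rewrite !in_itv /= mul1r => /andP[h1 h2];
    apply/andP; split; lra.
  rewrite !lebesgue_measure_itv /= !lte_fin ltrD2r; case: ifP => // _.
  by rewrite -!EFinD; congr EFin; ring.
rewrite (_ : _ @^-1` _ = [set` `[(c - b), (c - a)[%R]); last first.
  apply/seteqP; split => x /=; rewrite !in_itv /= mulN1r => /andP[h1 h2];
  apply/andP; split; lra.
rewrite !lebesgue_measure_itv /= !lte_fin ltrD2l ltrN2; case: ifP => // _.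
by rewrite -!EFinD; congr EFin; ring.
Qed.

Lemma leb3_mpres (e : R) (c : E) : e = 1 \/ e = -1 ->
  mpres (leb3 R) (leb3 R) (fun y : EB => c + e *: (y : E) : EB).
Proof.
move=> e1.
have [h1 h2] := (mpres_prod (mpres_prod (lebesgue_mpres c.1.1 e1) (lebesgue_mpres c.1.2 e1))
         (lebesgue_mpres c.2 e1)); split => // A mA; exact: h2.
Qed.

Lemma leb3_shift (t : E) : mpres (leb3 R) (leb3 R) (fun y : EB => (y : E) + t : EB).
Proof.
rewrite (_ : (fun y : EB => _) = (fun y : EB => t + 1 *: (y : E) : EB)).
  by apply: leb3_mpres; left.
by apply/funext => y; rewrite scale1r addrC.
Qed.

Lemma leb3_refl (c : E) : mpres (leb3 R) (leb3 R) (fun y : EB => c - (y : E) : EB).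
Proof.
rewrite (_ : (fun y : EB => _) = (fun y : EB => c + (-1) *: (y : E) : EB)).
  by apply: leb3_mpres; right.
by apply/funext => y; rewrite scaleN1r.
Qed.

Definition obox (a b : E) : set E :=
  [set y | [/\ a.1.1 < y.1.1 < b.1.1, a.1.2 < y.1.2 < b.1.2 & a.2 < y.2 < b.2]].

Lemma oboxE (a b : E) : obox a b =
  ([set` `]a.1.1, b.1.1[] `*` [set` `]a.1.2, b.1.2[]) `*` [set` `]a.2, b.2[].
Proof.
apply/seteqP; split => y /=; rewrite !in_itv /=; first by move=> [? ? ?].
by move=> [[? ?] ?].
Qed.

Lemma measurable_obox (a b : E) : measurable (obox a b : set EB).
Proof.
rewrite oboxE; apply: measurableX; first apply: measurableX;
exact: measurable_itv.
Qed.

Lemma leb3_obox_lty (a b : E) : (leb3 R (obox a b) < +oo)%E.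
Proof.
have itv_lty (x y : R) : (leb [set` `]x, y[%R] < +oo)%E.
  by rewrite lebesgue_measure_itv /=; case: ifP => // _; rewrite -EFinD ltry.
have fn (x y : R) : (leb [set` `]x, y[%R] \is a fin_num)%E.
  by rewrite ge0_fin_numE //; exact: itv_lty.
rewrite -ge0_fin_numE ?measure_ge0 // oboxE.
set I1 : set (measurableTypeR R) := [set` `]a.1.1, b.1.1[%R].
set I2 : set (measurableTypeR R) := [set` `]a.1.2, b.1.2[%R].
set I3 : set (measurableTypeR R) := [set` `]a.2, b.2[%R].
have m1 : measurable I1 by exact: measurable_itv.
have m2 : measurable I2 by exact: measurable_itv.
have m3 : measurable I3 by exact: measurable_itv.
have h := @product_measure1E _ _ _ _ R (prod_sfm leb leb) leb _ _ (measurableX m1 m2) m3.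
have h' := @product_measure1E _ _ _ _ R leb leb _ _ m1 m2.
have -> : leb3 R (I1 `*` I2 `*` I3) = (leb I1 * leb I2 * leb I3)%E by rewrite -h'; exact: h.
by rewrite !fin_numM ?fn.
Qed.

Lemma obox_nbhs (y : E) (U : set E) : nbhs y U -> exists p q : (rat * rat * rat),
  let a := (ratr p.1.1, ratr p.1.2, ratr p.2) : E in
  let b := (ratr q.1.1, ratr q.1.2, ratr q.2) : E in
  obox a b y /\ obox a b `<=` U.
Proof.
move=> /nbhs_ballP[e /= e0 eU].
have ex (x : R) : exists p : rat * rat, x - e < ratr p.1 < x /\ x < ratr p.2 < x + e.
  have [p] : exists p, ratr p \in `]x - e, x[ by apply: rat_in_itvoo; lra.
  have [q] : exists q, ratr q \in `]x, x + e[ by apply: rat_in_itvoo; lra.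
  by rewrite !in_itv /= => *; exists (p, q).
have [p1 [p11 p12]] := ex y.1.1; have [p2 [p21 p22]] := ex y.1.2.
have [p3 [p31 p32]] := ex y.2.
exists (p1.1, p2.1, p3.1), (p1.2, p2.2, p3.2) => /=; split; first by split => /=; lra.
move=> z [/= z1 z2 z3]; apply: eU; split; first split;
  rewrite /= /ball /= ltr_norml; apply/andP; split; lra.
Qed.

(** The sigma-algebra of [EB] is a product one; open sets belong to it as countable unions of boxes
    with rational corners. *)
Lemma open_measurable3 (U : set E) : open U -> measurable (U : set EB).
Proof.
move=> oU.
pose a (p : rat * rat * rat) := (ratr p.1.1, ratr p.1.2, ratr p.2) : E.
pose F (k : (rat * rat * rat) * (rat * rat * rat)) : set EB :=
  if `[<obox (a k.1) (a k.2) `<=` U>] then obox (a k.1) (a k.2) else set0.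
have -> : U = \bigcup_k F k.
  apply/seteqP; split => [y Uy|y [k _]].
    have [p [q [h1 h2]]] := obox_nbhs (open_nbhs_nbhs (conj oU Uy)).
    by exists (p, q) => //; rewrite /F asboolT.
  by rewrite /F; case: asboolP => // h; exact: h.
apply: countable_bigcupT_measurable => // k; rewrite /F; case: ifP => // _.
exact: measurable_obox.
Qed.

Lemma continuous_measurable3 (f : E -> R) : continuous f ->
  measurable_fun [set: EB] f.
Proof.
move=> /continuousP cf.
apply: (measurability _ (RGenOpens.measurableE R)).
move=> _ [_ [a [b ->] <-]]; rewrite setTI; apply: open_measurable3.
exact/cf/interval_open.
Qed.

End leb3.

(** * The lattice and its cell *)

Section coords.
Variable R : realType.
Local Notation E := (R * R * R)%type.
Local Notation EB :=
  (measurableTypeR R * measurableTypeR R * measurableTypeR R)%type.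
Variable g : 'I_3 -> E.

Definition crd (i : 'I_3) (y : E) : R := coord (mktuple g) i y.

Lemma crdD i y z : crd i (y + z) = crd i y + crd i z.
Proof. exact: linearD. Qed.

Lemma crdZ i a y : crd i (a *: y) = a * crd i y.
Proof. exact: linearZ. Qed.

Lemma crdN i y : crd i (- y) = - crd i y.
Proof. exact: linearN. Qed.

Lemma crd_lin i (y : E) : crd i y = y.1.1 * crd i (1, 0, 0) +
  y.1.2 * crd i (0, 1, 0) + y.2 * crd i (0, 0, 1).
Proof.
rewrite -!crdZ -!crdD; congr crd; case: y => [[a b] c].
have sE (u v : R) : u *: v = u * v by [].
by congr (_, _, _); rewrite /= !sE; ring.
Qed.

Hypothesis g_free : free [seq g i | i : 'I_3].

Lemma mktuple_free : free (mktuple g).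
Proof. by move: g_free; rewrite /image_mem (_ : map _ _ = mktuple g). Qed.

Lemma crd_sum (a : 'I_3 -> R) i : crd i (\sum_j a j *: g j) = a i.
Proof.
rewrite /crd -[RHS](coord_sum_free a i mktuple_free).
congr coord; apply: eq_bigr => j _; congr (_ *: _).
by rewrite -tnth_nth tnth_mktuple.
Qed.

Lemma crdK y : y = \sum_j crd j y *: g j.
Proof.
have hb : basis_of fullv (mktuple g).
  rewrite basisEfree mktuple_free subvf size_tuple dimvf.
  exact: (leqnn 3).
rewrite [LHS](coord_basis hb (memvf y)); apply: eq_bigr => j _.
by congr (_ *: _); rewrite -tnth_nth tnth_mktuple.
Qed.

Lemma cellE : cell g = [set y | forall i, 0 <= crd i y <= 1].
Proof.
apply/seteqP; split=> [_ [s hs <-] i|y hy].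
  by rewrite crd_sum; exact: hs.
by exists (fun i => crd i y) => //; rewrite -crdK.
Qed.

(** Half-open, so that its lattice translates partition the space; those of the closed cell share
    their faces. *)
Definition cell0 : set E := [set y | forall i, 0 <= crd i y < 1].

(** Indexing by finite functions gives an additive group with decidable equality, over which lattice
    sums can be taken and reindexed. *)
Definition lat (k : {ffun 'I_3 -> int}) : E := \sum_(i < 3) g i *~ k i.

Lemma latE k : lat k = \sum_i (k i)%:~R *: g i.
Proof. by apply: eq_bigr => i _; rewrite scaler_int. Qed.

Lemma crd_lat i k : crd i (lat k) = (k i)%:~R.
Proof. by rewrite latE crd_sum. Qed.

Lemma latticeP t : lattice g t <-> exists k, t = lat k.
Proof.
split=> [[k _ <-]|[k ->]]; last by exists k.
by exists [ffun i => k i]; apply: eq_bigr => i _; rewrite ffunE.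
Qed.

Lemma lattice_lat k : lattice g (lat k). Proof. by apply/latticeP; exists k. Qed.

Lemma latD k l : lat (k + l) = lat k + lat l.
Proof. by rewrite -big_split; apply: eq_bigr => i _ /=; rewrite ffunE mulrzDr. Qed.

Lemma latN k : lat (- k) = - lat k.
Proof. by rewrite -sumrN; apply: eq_bigr => i _ /=; rewrite ffunE mulrNz. Qed.

Definition fl (y : E) : {ffun 'I_3 -> int} := [ffun i => Num.floor (crd i y)].

Lemma cell0P y k : cell0 (y - lat k) <-> k = fl y.
Proof.
split=> [h|->].
  apply/ffunP => i; rewrite ffunE; apply/esym; apply: floor_def.
  by have := h i; rewrite crdD crdN crd_lat intrD subr_ge0 ltrBlDr addrC.
move=> i; rewrite crdD crdN crd_lat ffunE subr_ge0 ltrBlDr addrC.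
by have := floor_itv (crd i y); rewrite intrD.
Qed.

Definition cub (r : R) : set E :=
  [set y | [/\ `|y.1.1| <= r, `|y.1.2| <= r & `|y.2| <= r]].

Lemma cubS r s : r <= s -> cub r `<=` cub s.
Proof. by move=> rs y [h1 h2 h3]; split; apply: le_trans rs. Qed.

Lemma cubD r s y z : cub r y -> cub s z -> cub (r + s) (y + z).
Proof.
move=> [h1 h2 h3] [k1 k2 k3]; split; apply: le_trans (ler_normD _ _) _; exact: lerD.
Qed.

Lemma cubN r y : cub r (- y) <-> cub r y.
Proof.
rewrite -[cub r (- y)]/([/\ `|- y.1.1| <= r, `|- y.1.2| <= r & `|- y.2| <= r]).
by rewrite !normrN.
Qed.

Lemma in_cub y : exists r : nat, cub r%:R y.
Proof.
exists (Num.bound (`|y.1.1| + `|y.1.2| + `|y.2|)).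
have h : `|y.1.1| + `|y.1.2| + `|y.2| <= (Num.bound (`|y.1.1| + `|y.1.2| + `|y.2|))%:R.
  by apply: ltW; exact: unstable.ltr_bound.
by split; apply: le_trans h; rewrite ?lerDr -?addrA ?lerDl ?addr_ge0 // addrCA lerDl addr_ge0.
Qed.

Lemma cub_crd : exists2 c : R, 0 <= c & forall r y i, cub r y -> `|crd i y| <= c * r.
Proof.
pose c i := `|crd i (1, 0, 0)| + `|crd i (0, 1, 0)| + `|crd i (0, 0, 1)|.
have c0 i : 0 <= c i by rewrite !addr_ge0.
exists (\sum_i c i); first exact: sumr_ge0.
move=> r y i [h1 h2 h3]; have r0 : 0 <= r by exact: le_trans h1.
apply: (@le_trans _ _ (c i * r)); last first.
  apply: ler_wpM2r => //; rewrite (bigD1 i) //= lerDl; exact: sumr_ge0.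
rewrite crd_lin !mulrDl; apply: le_trans (ler_normD _ _) _; apply: lerD.
  apply: le_trans (ler_normD _ _) _; apply: lerD.
    by rewrite normrM mulrC; exact: ler_wpM2l.
  by rewrite normrM mulrC; exact: ler_wpM2l.
by rewrite normrM mulrC; exact: ler_wpM2l.
Qed.

Lemma cell_cub : exists r, cell g `<=` cub r.
Proof.
pose c := \sum_i (`|(g i).1.1| + `|(g i).1.2| + `|(g i).2|).
exists c => y; rewrite cellE /= => hy.
have nm i : `|crd i y| <= 1 by rewrite ger0_norm; case/andP: (hy i).
have pr1 (h : E -> R) : (forall a b, h (a + b) = h a + h b) ->
    h 0 = 0 -> (forall a z, h (a *: z) = a * h z) ->
    (forall i, `|h (g i)| <= `|(g i).1.1| + `|(g i).1.2| + `|(g i).2|) ->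
    `|h y| <= c.
  move=> hD h0 hZ hg; rewrite {1}(crdK y) (big_morph h hD h0).
  apply: le_trans (ler_norm_sum _ _ _) _; apply: ler_sum => i _.
  rewrite hZ normrM -[leRHS]mul1r; apply: ler_pM => //; exact: hg.
split; [apply: (pr1 (fun z => z.1.1))|apply: (pr1 (fun z => z.1.2))|
  apply: (pr1 (fun z => z.2))] => // i.
- by rewrite -addrA lerDl addr_ge0.
- by rewrite addrAC lerDr addr_ge0.
- by rewrite lerDr addr_ge0.
Qed.

Lemma measurable_crd i : measurable_fun [set: EB] (crd i).
Proof.
rewrite (_ : crd i = fun y : E => y.1.1 * crd i (1, 0, 0) +
  y.1.2 * crd i (0, 1, 0) + y.2 * crd i (0, 0, 1)); last first.
  by apply/funext => y; exact: crd_lin.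
have m11 : measurable_fun [set: EB] (fun y : EB => y.1.1).
  by apply: measurableT_comp.
have m12 : measurable_fun [set: EB] (fun y : EB => y.1.2).
  by apply: measurableT_comp.
by apply: measurable_funD; first apply: measurable_funD;
  apply: measurable_funM => //; exact: measurable_snd.
Qed.

Lemma measurable_crd_itv i (I : interval R) :
  measurable ([set y | crd i y \in I] : set EB).
Proof.
have := measurable_crd i measurableT (measurable_itv I).
by rewrite setTI.
Qed.

Lemma measurable_cell : measurable (cell g : set EB).
Proof.
rewrite cellE (_ : [set _ | _] =
    \bigcap_(i in [set: 'I_3]) [set y : EB | crd i y \in `[0, 1]]).
  by apply: fin_bigcap_measurable => // i _; exact: measurable_crd_itv.
apply/seteqP; split => y /= h i.
  by move=> _; rewrite /= in_itv; exact: h.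
by have := h i Logic.I; rewrite /= in_itv.
Qed.

Lemma measurable_cell0 : measurable (cell0 : set EB).
Proof.
rewrite /cell0 (_ : [set _ | _] =
    \bigcap_(i in [set: 'I_3]) [set y : EB | crd i y \in `[0, 1[]).
  by apply: fin_bigcap_measurable => // i _; exact: measurable_crd_itv.
apply/seteqP; split => y /= h i.
  by move=> _; rewrite /= in_itv; exact: h.
by have := h i Logic.I; rewrite /= in_itv.
Qed.

Lemma measurable_cub r : measurable (cub r : set EB).
Proof.
rewrite (_ : cub r = ([set` `[- r, r]%R] `*` [set` `[- r, r]%R]) `*` [set` `[- r, r]%R]).
  by apply: measurableX; [apply: measurableX|]; exact: measurable_itv.
by apply/seteqP; split => y /=; rewrite !in_itv /= -!ler_norml; [move=> [? ? ?]|move=> [[? ?] ?]].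
Qed.

End coords.

(** * Lattice sums and unfolding of integrals *)

Section periodization.
Variable R : realType.
Local Notation E := (R * R * R)%type.
Local Notation EB :=
  (measurableTypeR R * measurableTypeR R * measurableTypeR R)%type.
Local Notation mu := (leb3 R).
Local Notation K := {ffun 'I_3 -> int}.

Lemma aeS (P Q : E -> Prop) : (forall y, P y -> Q y) ->
  {ae mu, forall y, P y} -> {ae mu, forall y, Q y}.
Proof. exact: (@filterS _ _ (ae_filter_ringOfSetsType mu)). Qed.

Lemma aeS2 (P Q S : E -> Prop) : (forall y, P y -> Q y -> S y) ->
  {ae mu, forall y, P y} -> {ae mu, forall y, Q y} -> {ae mu, forall y, S y}.
Proof. exact: (@filterS2 _ _ (ae_filter_ringOfSetsType mu)). Qed.

Lemma ae_forall (I : finType) (P : I -> E -> Prop) :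
  (forall i, {ae mu, forall y, P i y}) -> {ae mu, forall y, forall i, P i y}.
Proof. exact: (@filter_forall _ _ P _ (ae_filter_ringOfSetsType mu)). Qed.

Lemma leb3_cub_lty (r : R) : (mu (cub r) < +oo)%E.
Proof.
apply: le_lt_trans (leb3_obox_lty (- (r + 1), - (r + 1), - (r + 1)) (r + 1, r + 1, r + 1)).
apply: le_measure; rewrite ?inE; [exact: measurable_cub|exact: measurable_obox|].
by move=> y [/=]; rewrite !ler_norml => *; split => /=; lra.
Qed.

Definition loc_int (f : E -> R) : Prop := measurable_fun [set: EB] f /\
  forall r, mu.-integrable (cub r) (EFin \o f).

Definition bsupp (r : R) (psi : E -> R) : Prop := forall y, ~ cub r y -> psi y = 0.

Lemma bsupp_integrable r f : measurable_fun [set: EB] f -> bsupp r f ->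
  mu.-integrable (cub r) (EFin \o f) -> mu.-integrable setT (EFin \o f).
Proof.
move=> mf bf; rewrite (integrable_mkcond _ (measurable_cub r)).
apply: eq_integrable => // y _; rewrite /patch /=.
by case: ifPn => //; rewrite notin_setE => /bf ->.
Qed.

Lemma bsupp_Rintegral r f : measurable_fun [set: EB] f -> bsupp r f ->
  \int[mu]_y f y = \int[mu]_(y in cub r) f y.
Proof.
move=> mf bf; rewrite [RHS]Rintegral_mkcond; apply: eq_Rintegral => y _.
by rewrite /patch /=; case: ifPn => //; rewrite notin_setE => /bf ->.
Qed.

Lemma loc_int_mul_bounded (f psi : E -> R) M : loc_int f ->
  measurable_fun [set: EB] psi -> (forall y, `|psi y| <= M) ->
  loc_int (fun y => f y * psi y).
Proof.
move=> [mf f1] mp pM; split; first exact: measurable_funM.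
move=> r; have M0 : 0 <= M by apply: le_trans (pM 0).
apply: (@le_integrable _ _ _ _ _ (measurable_cub r) _ (EFin \o (fun y => M * f y))).
- by apply/measurable_EFinP/measurable_funTS; exact: measurable_funM.
- move=> y _ /=; rewrite lee_fin !normrM mulrC (ger0_norm M0).
  by apply: ler_wpM2r.
- exact: integrable_scaleR (measurable_cub r) _ _ (f1 r).
Qed.

Lemma loc_int_mul (f psi : E -> R) r M : loc_int f ->
  measurable_fun [set: EB] psi -> (forall y, `|psi y| <= M) -> bsupp r psi ->
  mu.-integrable setT (EFin \o (fun y => f y * psi y)).
Proof.
move=> lf mp pM bp; have [mfp fp1] := loc_int_mul_bounded lf mp pM.
by apply: (@bsupp_integrable r) => // y /bp ->; rewrite mulr0.
Qed.

Lemma Rintegral_sum (I : Type) (s : seq I) (D : set EB) (F : I -> EB -> R) :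
  measurable D -> (forall i, mu.-integrable D (EFin \o F i)) ->
  \int[mu]_(y in D) (\sum_(i <- s) F i y) = \sum_(i <- s) \int[mu]_(y in D) F i y.
Proof.
move=> mD Fi; elim: s => [|i s IH].
  under eq_Rintegral do rewrite big_nil.
  by rewrite big_nil Rintegral_cst // mul0r.
under eq_Rintegral do rewrite big_cons.
rewrite big_cons RintegralD // ?IH //.
have := integrable_sum mD s (P := xpredT) (fun i _ => Fi i).
apply: eq_integrable => // y _ /=.
by rewrite sumEFin.
Qed.

Definition boxK (N : nat) : seq K :=
  [seq [ffun i => (f i : nat)%:Z - N%:Z] | f : {ffun 'I_3 -> 'I_(N.*2.+1)}].

Lemma boxK_uniq N : uniq (boxK N).
Proof.
rewrite map_inj_uniq ?enum_uniq // => f f' /ffunP h; apply/ffunP => i.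
have := h i; rewrite !ffunE => /addIr [] ff; exact: val_inj.
Qed.

Lemma mem_boxK N (k : K) : (forall i, `|k i| <= N%:Z) -> k \in boxK N.
Proof.
move=> kN; apply/mapP; exists [ffun i => inord (absz (k i + N%:Z))]; rewrite ?mem_enum //.
apply/ffunP => i; rewrite !ffunE; have := kN i => h.
move: h; rewrite ler_norml => /andP[h1 h2].
rewrite inordK; last by lia.
by rewrite abszE ger0_norm ?addrK // -lerBlDr sub0r.
Qed.

Section lattice.
Variable g : 'I_3 -> E.
Hypothesis g_free : free [seq g i | i : 'I_3].

(** A finitely supported sum, meaningful when [psi] has bounded support: over a bounded set of
    points it then reduces to a sum over one fixed [boxK N], which is how every property is
    obtained. *)
Definition Per (psi : E -> R) (y : E) : R := \sum_(k \in [set: K]) psi (y + lat g k).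

Lemma boxK_bound : exists c : R, forall r rho y k, cub r (y + lat g k) -> cub rho y ->
  forall i, `|(k i)%:~R| <= c * (r + rho).
Proof.
have [c c0 hc] := cub_crd g; exists c => r rho y k h1 h2 i.
rewrite -(crd_lat g_free i k).
have -> : lat g k = (y + lat g k) - y by rewrite addrC addKr.
by apply: hc; apply: cubD => //; apply/cubN.
Qed.

Lemma boxK_large r rho : exists N : nat, forall M y k, (N <= M)%N ->
  cub r (y + lat g k) -> cub rho y -> k \in boxK M.
Proof.
have [c hc] := boxK_bound; exists (Num.bound (c * (r + rho))) => M y k NM h1 h2.
apply: mem_boxK => i; rewrite -(ler_int R) intr_norm.
apply: le_trans (hc _ _ _ _ h1 h2 i) _.
apply: le_trans (ltW (unstable.ltr_bound _)) _.
by rewrite -[(Posz M)%:~R]/(M%:R) ler_nat.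
Qed.

Lemma Per_fin psi r rho : bsupp r psi -> exists N : nat, forall M y, (N <= M)%N ->
  cub rho y -> Per psi y = \sum_(k <- boxK M) psi (y + lat g k).
Proof.
move=> bp; have [N hN] := boxK_large r rho; exists N => M y NM hy.
rewrite /Per (fsbigE (boxK M)) //; last 2 first.
- exact: boxK_uniq.
- move=> k _ kM; apply: bp => h; move: kM; rewrite (hN M y) //.
by apply: eq_bigl => k; rewrite in_setT.
Qed.

Lemma Per_lat psi y k : Per psi (y + lat g k) = Per psi y.
Proof.
rewrite /Per [RHS](reindex_fsbigT (fun l : K => k + l)).
  by apply: eq_fsbigr => l _; rewrite latD addrA.
by exists (fun l => - k + l) => l; rewrite ?addKr ?addNKr.
Qed.

Lemma periodic_Per psi : Defs.periodic g (Per psi).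
Proof. by move=> t /latticeP[k ->]; apply/aeW => y; exact: Per_lat. Qed.

Lemma Per_shift psi h y : Per (fun z => psi (z + h)) y = Per psi (y + h).
Proof. by apply: eq_fsbigr => k _; rewrite addrAC. Qed.

Lemma measurable_Per psi r : measurable_fun [set: EB] psi -> bsupp r psi ->
  measurable_fun [set: EB] (Per psi).
Proof.
move=> mp bp.
apply: (@measurable_fun_cvg _ _ _ _ (fun n (y : EB) => \sum_(k <- boxK n) psi ((y : E) + lat g k))).
  move=> n; apply: measurable_sum => k.
  by apply: measurableT_comp => //; case: (leb3_shift (lat g k)).
move=> y _; have [rho hr] := in_cub y; have [N hN] := Per_fin rho%:R bp.
apply: cvg_near_cst; exists N => // n /= Nn; exact/esym/hN.
Qed.

Lemma cell0_fl y : cell0 g (y - lat g (fl g y)).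
Proof. exact/cell0P. Qed.

Lemma cell0_cell : cell0 g `<=` cell g.
Proof. by move=> y h; rewrite (cellE g_free) => i /=; have /andP[-> /ltW ->] := h i. Qed.

Lemma Per_bounded psi r M : (forall y, `|psi y| <= M) -> bsupp r psi ->
  exists M' : R, forall y, `|Per psi y| <= M'.
Proof.
move=> pM bp; have [rho hr] := cell_cub g_free; have [N hN] := Per_fin rho bp.
exists (\sum_(k <- boxK N) M) => y.
rewrite -(Per_lat psi y (- fl g y)) latN (hN N) //; last first.
  by apply: hr; apply: cell0_cell; exact: cell0_fl.
by apply: le_trans (ler_norm_sum _ _ _) _; apply: ler_sum => k _.
Qed.

Lemma Per_cell0 y : Per (\1_(cell0 g) : E -> R) y = 1.
Proof.
rewrite /Per (fsbigE [:: - fl g y]) //; last first.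
  move=> k _; rewrite inE => /eqP nk; rewrite indicE; case: (boolP (_ \in _)) => //.
  move=> /set_mem; rewrite -[lat g k]opprK -latN => /(cell0P g_free) h.
  by case: nk; rewrite -h opprK.
rewrite big_mkcond big_seq1 in_setT latN indicE mem_set //; exact: cell0_fl.
Qed.

Lemma leb3_cell_lty : (mu (cell g) < +oo)%E.
Proof.
have [rho hr] := cell_cub g_free; apply: le_lt_trans (leb3_cub_lty rho).
by apply: le_measure => //; rewrite inE; [exact: measurable_cell|exact: measurable_cub].
Qed.

(** The translates of the face by [g i] divided by [n.+1] are pairwise disjoint, have equal measure
    and stay in one bounded cube of finite measure; infinitely many copies force measure zero. *)
Lemma cell_face_null i : mu (cell g `&` [set y | crd g i y = 1]) = 0%E.
Proof.
set F := _ `&` _.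
have mF : measurable (F : set EB).
  apply: measurableI; first exact: measurable_cell.
  rewrite (_ : [set y | _] = [set y | crd g i y \in `[1, 1]]).
    exact: measurable_crd_itv.
  by apply/seteqP; split => y /=; rewrite in_itv /= -eq_le eq_sym; [move=> ->|move=> /eqP].
pose c (n : nat) : R := n.+1%:R^-1.
pose A (n : nat) : set EB := (fun y : EB => (y : E) + c n *: g i) @^-1` F.
have mA n : measurable (A n) /\ mu (A n) = mu F.
  have [m1 m2] := leb3_shift (c n *: g i); split; last exact: m2.
  by rewrite -[A n]setTI; exact: m1.
have cg n : crd g i (c n *: g i) = c n.
  by rewrite crdZ -[g i](_ : \sum_j (j == i)%:R *: g j = _) ?crd_sum ?eqxx ?mulr1 //;
    rewrite (bigD1 i) //= eqxx scale1r big1 ?addr0 // => j /negbTE ->; rewrite scale0r.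
have Acrd n y : A n y -> crd g i y = 1 - c n.
  by move=> [_ /= <-]; rewrite crdD cg addrK.
have tA : trivIset setT A.
  apply/trivIsetP => m n _ _ mn; apply/seteqP; split => // y [/Acrd h1 /Acrd].
  rewrite h1 => /addrI /oppr_inj /invr_inj /eqP; rewrite eqr_nat eqSS => /eqP h.
  by rewrite h eqxx in mn.
have [r0 hr0] := cell_cub g_free.
have [r1 hr1] := in_cub (g i).
have Asub n : A n `<=` cub (r0 + r1%:R).
  move=> y [/hr0 h _]; rewrite -[y](addrK (c n *: g i)).
  apply: cubD => //; apply/cubN; have c1 : `|c n| <= 1.
    by rewrite /c ger0_norm ?invr_ge0 ?ler0n // invf_le1 ?ler1n ?ltr0n.
  by case: hr1 => h1 h2 h3; split; rewrite /= normrM -[leRHS]mul1r; apply: ler_pM.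
have fin : (\sum_(0 <= n <oo) mu (A n) <= mu (cub (r0 + r1%:R)))%E.
  have -> : (\sum_(0 <= n <oo) mu (A n) =
      \sum_(0 <= n <oo | n \in [set: nat]) mu (A n))%E.
    by apply: eq_eseriesl => n; rewrite in_setT.
  rewrite -measure_bigcup //; last by move=> n _; case: (mA n).
  apply: le_measure; rewrite ?inE; last by move=> y [n _]; exact: Asub.
  - by apply: bigcup_measurable => n _; case: (mA n).
  - exact: measurable_cub.
apply/eqP; rewrite eq_le measure_ge0 andbT leNgt; apply/negP => F0.
have Ffin : mu F \is a fin_num.
  rewrite ge0_fin_numE //; apply: le_lt_trans leb3_cell_lty.
  by apply: le_measure; rewrite ?inE; [exact: mF|exact: measurable_cell|exact: subIsetl].
have cfin : mu (cub (r0 + r1%:R)) \is a fin_num.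
  by rewrite ge0_fin_numE //; exact: leb3_cub_lty.
pose a := fine (mu F); have a0 : 0 < a by rewrite fine_gt0 // F0 -ge0_fin_numE.
have hn n : n%:R * a <= fine (mu (cub (r0 + r1%:R))).
  rewrite -lee_fin fineK //; apply: le_trans fin.
  apply: le_trans (nneseries_lim_ge n _); last by move=> *; exact: measure_ge0.
  under eq_bigr do rewrite (mA _).2 -(fineK Ffin).
  by rewrite sumEFin sumr_const_nat subn0 mulr_natl.
have := hn (Num.bound (fine (mu (cub (r0 + r1%:R))) / a)); apply/negP; rewrite -ltNge.
by rewrite -ltr_pdivrMr //; exact: unstable.ltr_bound.
Qed.

Lemma ae_cell0 : {ae mu, forall y, cell g y -> cell0 g y}.
Proof.
have h i : {ae mu, forall y, ~ (cell g `&` [set y | crd g i y = 1]) y}.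
  exists (cell g `&` [set y | crd g i y = 1]); split.
  - apply: measurableI; first exact: measurable_cell.
    rewrite (_ : [set y | _] = [set y | crd g i y \in `[1, 1]]).
      exact: measurable_crd_itv.
    by apply/seteqP; split => y /=; rewrite in_itv /= -eq_le eq_sym; [move=> ->|move=> /eqP].
  - exact: cell_face_null.
  - by move=> y /= /contrapT.
apply: aeS (ae_forall h) => y hy cy i.
have := cy; rewrite (cellE g_free) /= => /(_ i) /andP[-> h2] /=.
by rewrite lt_neqAle h2 andbT; apply/eqP => h1; apply: (hy i).
Qed.

Lemma Rintegral_cell0 f : measurable_fun [set: EB] f ->
  \int[mu]_(y in cell g) f y = \int[mu]_(y in cell0 g) f y.
Proof.
move=> mf; rewrite [LHS]Rintegral_mkcond [RHS]Rintegral_mkcond; congr fine; apply: ae_eq_integral => //.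
- apply/measurable_EFinP/(measurable_restrictT _ _).1; last exact: measurable_funTS.
  exact: measurable_cell.
- apply/measurable_EFinP/(measurable_restrictT _ _).1; last exact: measurable_funTS.
  exact: measurable_cell0.
move: ae_cell0; apply: aeS => y h _; congr EFin; rewrite /patch.
case: ifPn => [/set_mem /h hy|]; first by rewrite mem_set.
rewrite notin_setE => nc; case: ifPn => // /set_mem /cell0_cell; by [].
Qed.

Lemma cell0_sum (f : R) y N :
  fl g y \in boxK N -> f = \sum_(k <- boxK N) f * \1_(cell0 g) (y - lat g k).
Proof.
move=> yN; rewrite (bigD1_seq (fl g y)) ?boxK_uniq //=.
rewrite indicE mem_set ?mulr1; last exact: cell0_fl.
rewrite big1 ?addr0 // => k kN; rewrite indicE; case: (boolP (_ \in _)).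
  by move=> /set_mem /(cell0P g_free) kf; rewrite kf eqxx in kN.
by rewrite mulr0.
Qed.

Lemma fl_large r : exists N : nat, forall M y, (N <= M)%N -> cub r y -> fl g y \in boxK M.
Proof.
have [r0 hr0] := cell_cub g_free; have [N hN] := boxK_large r r0.
exists N => M y NM hy; apply: (hN M (y - lat g (fl g y))) => //; first by rewrite subrK.
by apply: hr0; apply: cell0_cell; exact: cell0_fl.
Qed.

Lemma measurable_lat (f : E -> R) t : measurable_fun [set: EB] f ->
  measurable_fun [set: EB] (fun y : E => f (y + t)).
Proof. by move=> mf; apply: measurableT_comp => //; case: (leb3_shift t). Qed.

Lemma ae_eq_Rintegral (D : set EB) (f h : E -> R) : measurable D ->
  measurable_fun [set: EB] f -> measurable_fun [set: EB] h ->
  {ae mu, forall y, f y = h y} -> \int[mu]_(y in D) f y = \int[mu]_(y in D) h y.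
Proof.
move=> mD mf mh fh; congr fine; apply: ae_eq_integral => //.
- by apply/measurable_EFinP/measurable_funTS.
- by apply/measurable_EFinP/measurable_funTS.
- by move: fh; apply: aeS => y -> _.
Qed.

(** Cut the space into translates of the half-open cell and shift each piece back: [f] is unchanged
    by periodicity while the translates of [psi] add up. Only finitely many pieces meet the support
    of [psi]. *)
Lemma unfold_Per (f psi : E -> R) (r M : R) : loc_int f -> Defs.periodic g f ->
  measurable_fun [set: EB] psi -> (forall y, `|psi y| <= M) -> bsupp r psi ->
  \int[mu]_y (f y * psi y) = \int[mu]_(y in cell g) (f y * Per psi y).
Proof.
move=> lf pf mp pM bp; have [mf _] := lf.
have mc0 := measurable_cell0 g.
have mind k : measurable_fun [set: EB] (fun y : E => \1_(cell0 g) (y - lat g k) : R).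
  by rewrite -latN; apply: (measurable_lat (f := \1_(cell0 g))); exact: measurable_indic.
have [N1 hN1] := fl_large r; have [r0 hr0] := cell_cub g_free.
have [N2 hN2] := Per_fin r0 bp; pose N := maxn N1 N2.
have ifp k : mu.-integrable setT (EFin \o (fun y => f y * (psi y * \1_(cell0 g) (y - lat g k)))).
  apply: (loc_int_mul (r := r) (M := M)) => //.
  - by apply: measurable_funM.
  - by move=> y; rewrite normrM -[leRHS]mulr1; apply: ler_pM => //;
      rewrite indicE; case: (_ \in _); rewrite ?normr1 ?normr0.
  - by move=> y /bp ->; rewrite mul0r.
transitivity (\sum_(k <- boxK N) \int[mu]_y (f y * (psi y * \1_(cell0 g) (y - lat g k)))).
  rewrite -Rintegral_sum //; apply: eq_Rintegral => y _.
  rewrite -big_distrr /=; congr (_ * _).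
  have [cy|cy] := pselect (cub r y); last first.
    by rewrite bp // big1 // => k _; rewrite mul0r.
  by apply: cell0_sum => //; apply: hN1 => //; exact: leq_maxl.
have mps k : measurable_fun [set: EB] (fun y : E => psi (y + lat g k)).
  exact: measurable_lat.
transitivity (\sum_(k <- boxK N) \int[mu]_(y in cell0 g) (f y * psi (y + lat g k))).
  apply: eq_bigr => k _.
  rewrite -(mpres_Rintegral (leb3_shift (lat g k))); last first.
    by do 2 apply: measurable_funM => //.
  rewrite [RHS]Rintegral_mkcond.
  have -> : (fun y : E => f y * psi (y + lat g k)) \_ (cell0 g) =
      (fun y => f y * (psi (y + lat g k) * \1_(cell0 g) y)).
    apply/funext => y; rewrite /patch indicE; case: ifP => _.
      by rewrite mulr1.
    by rewrite !mulr0.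
  apply: ae_eq_Rintegral => //.
  - apply: measurable_funM; first exact: measurable_lat.
    by apply: measurable_funM => //; exact: (measurable_lat (lat g k) (mind k)).
  - by do 2 apply: measurable_funM => //; exact: measurable_indic.
  have := pf _ (lattice_lat g k); apply: aeS => y ->.
  by rewrite addrK.
rewrite Rintegral_cell0; last first.
  by apply: measurable_funM => //; apply: measurable_Per bp.
rewrite -Rintegral_sum //; last first.
  move=> k; apply: (integrableS (measurable_cub r0)) => //.
    by move=> y /cell0_cell /hr0.
  by have [_ h] := loc_int_mul_bounded lf (mps k) (fun y => pM _); exact: h.
apply: eq_Rintegral => y /set_mem cy; rewrite -big_distrr /=; congr (_ * _).
apply/esym/hN2; first exact: leq_maxr.
exact/hr0/cell0_cell.
Qed.

End lattice.
End periodization.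

(** * Locally square integrable and periodic fields *)

Section L2l.
Variable R : realType.
Local Notation E := (R * R * R)%type.
Local Notation EB :=
  (measurableTypeR R * measurableTypeR R * measurableTypeR R)%type.
Local Notation mu := (leb3 R).

Definition L2l (f : E -> R) : Prop := measurable_fun [set: EB] f /\
  forall r, L2on mu (cub r) (f : EB -> R).

Lemma compact_cub (r : R) : compact (cub r).
Proof.
rewrite (_ : cub r = ([set` `[- r, r]%R] `*` [set` `[- r, r]%R]) `*` [set` `[- r, r]%R]).
  by apply: compact_setX; [apply: compact_setX|]; exact: segment_compact.
by apply/seteqP; split => y /=; rewrite !in_itv /= -!ler_norml; [move=> [? ? ?]|move=> [[? ?] ?]].
Qed.

Lemma compact_sub_cub (K : set E) : compact K -> exists r, K `<=` cub r.
Proof.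
move=> /compact_bounded [M [_ hM]]; exists (M + 1) => y Ky.
have := hM (M + 1); rewrite ltrDl ltr01 => /(_ isT y Ky).
by rewrite [X in X -> _]/= prod_normE ge_max prod_normE ge_max => /andP[/andP[h1 h2] h3].
Qed.

Lemma compact_measurable3 (K : set E) : compact K -> measurable (K : set EB).
Proof.
move=> cK; rewrite -[K]setCK; apply: measurableC; apply: open_measurable3.
apply: closed_openC; apply: compact_closed cK; exact: norm_hausdorff.
Qed.

Lemma L2l_L2loc f : L2l f <-> L2loc f.
Proof.
split=> -[mf h]; split => //.
  move=> K cK; have [r Kr] := compact_sub_cub cK.
  have [_ /integrableP[_ foo]] := h r; apply: le_lt_trans foo.
  apply: (@le_trans _ _ (\int[mu]_(y in cub r) (f y ^+ 2)%:E)%E).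
    apply: ge0_subset_integral => //.
    - exact: compact_measurable3.
    - exact: measurable_cub.
    - by apply/measurable_EFinP/measurable_funTS; exact: measurable_funX.
    - by move=> y _; rewrite lee_fin sqr_ge0.
  apply: ge0_le_integral => //.
  - exact: measurable_cub.
  - by move=> y _; rewrite lee_fin sqr_ge0.
  - by apply/measurable_EFinP/measurable_funTS; exact: measurable_funX.
  - apply: measurableT_comp => //.
    by apply/measurable_EFinP/measurable_funTS; exact: measurable_funX.
  - by move=> y _; rewrite /= lee_fin ler_norm.
move=> r; apply: L2on_lty => //; first exact: measurable_cub.
by apply: h; exact: compact_cub.
Qed.

Lemma L2l_add f h : L2l f -> L2l h -> L2l (fun y => f y + h y).
Proof.
move=> [mf f2] [mh h2]; split; first exact: measurable_funD.
move=> r; exact: (L2onD (measurable_cub r) (f2 r) (h2 r)).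
Qed.

Lemma L2l_scale a f : L2l f -> L2l (fun y => a * f y).
Proof.
move=> [mf f2]; split; first exact: measurable_funM.
move=> r; exact: (L2onZ (measurable_cub r) a (f2 r)).
Qed.

Lemma L2l_opp f : L2l f -> L2l (fun y => - f y).
Proof.
move=> /(L2l_scale (-1)); congr L2l; apply/funext => y; exact: mulN1r.
Qed.

Lemma L2l_sub f h : L2l f -> L2l h -> L2l (fun y => f y - h y).
Proof. by move=> lf lh; apply: L2l_add => //; exact: L2l_opp. Qed.

Lemma L2l_sum (I : Type) (s : seq I) (F : I -> E -> R) : (forall i, L2l (F i)) ->
  L2l (fun y => \sum_(i <- s) F i y).
Proof.
move=> h; elim: s => [|i s IH].
  under [X in L2l X]funext do rewrite big_nil.
  split; first exact: measurable_cst.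
  by move=> r; exact: (L2on0 mu (measurable_cub r)).
by under [X in L2l X]funext do rewrite big_cons; exact: L2l_add.
Qed.

Lemma L2l_loc_bounded (f : E -> R) : measurable_fun [set: EB] f ->
  (forall r, exists M : R, forall y, cub r y -> `|f y| <= M) -> L2l f.
Proof.
move=> mf fM; split=> // r; split => //; have [M hM] := fM r.
apply: measurable_bounded_integrable.
- exact: measurable_cub.
- exact: leb3_cub_lty.
- by apply: measurable_funTS; exact: measurable_funX.
- exists (M ^+ 2); split; rewrite ?num_real // => x /ltW Mx y cy /=.
  apply: le_trans Mx; rewrite normrX lerXn2r ?nnegrE //; last exact: hM.
  by apply: le_trans (hM y cy).
Qed.

Lemma L2l_bounded (f : E -> R) M : measurable_fun [set: EB] f ->
  (forall y, `|f y| <= M) -> L2l f.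
Proof. by move=> mf fM; apply: L2l_loc_bounded => // r; exists M. Qed.

Lemma L2l_cst a : L2l (fun=> a).
Proof. by apply: (@L2l_bounded _ `|a|). Qed.

Lemma L2l_mul f h : L2l f -> L2l h -> loc_int (fun y => f y * h y).
Proof.
move=> [mf f2] [mh h2]; split; first exact: measurable_funM.
move=> r; exact: (L2on_mul (measurable_cub r) (f2 r) (h2 r)).
Qed.

Lemma L2l_loc_int f : L2l f -> loc_int f.
Proof.
move=> lf; have := L2l_mul lf (L2l_cst 1); congr loc_int.
by apply/funext => y; rewrite mulr1.
Qed.

Lemma L2l_ae (f h : E -> R) : L2l f -> measurable_fun [set: EB] h ->
  {ae mu, forall y, f y = h y} -> L2l h.
Proof.
move=> [mf f2] mh fh; split => // r; apply: L2on_lty => //; first exact: measurable_cub.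
have [_ /integrableP[_]] := f2 r; apply: le_lt_trans.
rewrite le_eqVlt; apply/orP; left; apply/eqP.
apply: ge0_ae_eq_integral => //.
- exact: measurable_cub.
- by apply/measurable_EFinP/measurable_funTS; exact: measurable_funX.
- apply: measurableT_comp => //.
  by apply/measurable_EFinP/measurable_funTS; exact: measurable_funX.
- by move=> y _; rewrite lee_fin sqr_ge0.
- by move: fh; apply: aeS => y e _; rewrite /= e ger0_norm ?sqr_ge0.
Qed.

Lemma L2l_mul_ae_bounded (f h : E -> R) M : measurable_fun [set: EB] h ->
  {ae mu, forall y, `|h y| <= M} -> L2l f -> L2l (fun y => h y * f y).
Proof.
move=> mh hM [mf f2].
(* The truncation is bounded everywhere and agrees with [h] almost everywhere. *)
pose h' y := Num.max (- `|M|) (Num.min `|M| (h y)).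
have mh' : measurable_fun [set: EB] h'.
  by apply: measurable_maxr => //; apply: measurable_minr.
have h'M y : `|h' y| <= `|M|.
  have := normr_ge0 M; rewrite /h' ler_norml.
  by move=> M0; rewrite le_max lexx ge_max ge_min lexx /= andbT; lra.
apply: (@L2l_ae (fun y => h' y * f y)); last 1 first.
- move: hM; apply: aeS => y hy; congr (_ * _); rewrite /h'.
  have := le_trans hy (ler_norm M); rewrite ler_norml => /andP[h1 h2].
  by rewrite (min_idPr h2) (max_idPr h1).
- split; first exact: measurable_funM.
  move=> r; split; first exact: measurable_funM.
  have [_ fi] := f2 r.
  apply: (integrable_le (measurable_cub r) _
     (integrable_scaleR (measurable_cub r) (`|M| ^+ 2) fi)).
    by apply: measurable_funX; exact: measurable_funM.
  move=> y _; rewrite ger0_norm ?sqr_ge0 // exprMn; apply: ler_wpM2r.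
    exact: sqr_ge0.
  by rewrite -[leLHS]real_normK ?num_real // lerXn2r ?nnegrE.
- exact: measurable_funM.
Qed.

Lemma L2l_affine e c f : e = 1 \/ e = -1 -> L2l f -> L2l (fun y : E => f (c + e *: y)).
Proof.
move=> e1 [mf f2]; have mp := leb3_mpres c e1.
have mfc : measurable_fun [set: EB] (fun y : E => f (c + e *: y)).
  by apply: measurableT_comp => //; case: mp.
split=> // r; split => //.
have [rc hc] := in_cub c.
have [_ fi] := f2 (rc%:R + r).
have mi : measurable_fun [set: EB] (fun y : E => \1_(cub (rc%:R + r)) y * (f y) ^+ 2).
  apply: measurable_funM; last exact: measurable_funX.
  by apply: measurable_indic; exact: measurable_cub.
have := mpres_integrable mp mi.
have mc := measurable_cub (rc%:R + r).
have -> : mu.-integrable setT (EFin \o (fun y : E => \1_(cub (rc%:R + r)) y * f y ^+ 2)).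
  have /(integrable_mkcond _ mc) := fi; apply: eq_integrable => // y _.
  rewrite /patch /= indicE; case: ifP => _; first by rewrite mul1r.
  by rewrite mul0r.
move=> /(_ isT) /(@integrableS _ _ _ _ _ (cub r : set EB) _ measurableT (measurable_cub r) (subsetT _)).
apply: eq_integrable; first exact: measurable_cub.
move=> y /set_mem cy /=; rewrite indicE mem_set ?mul1r //.
apply: cubD => //; case: e1 => ->; rewrite ?scale1r // scaleN1r; exact/cubN.
Qed.

Lemma L2l_shift t f : L2l f -> L2l (fun y : E => f (y + t)).
Proof.
move=> /(@L2l_affine 1 t) h; have := h (or_introl erefl); congr L2l.
by apply/funext => y; rewrite scale1r addrC.
Qed.

Section lattice.
Variable g : 'I_3 -> E.
Hypothesis g_free : free [seq g i | i : 'I_3].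

Lemma integrable_cell f : loc_int f -> mu.-integrable (cell g) (EFin \o f).
Proof.
move=> [_ f1]; have [r hr] := cell_cub g_free.
by apply: (integrableS (measurable_cub r)) (f1 r) => //; exact: measurable_cell.
Qed.

Lemma L2l_cell f : L2l f -> L2on mu (cell g) f.
Proof.
move=> [mf f2]; split => //; have [r hr] := cell_cub g_free.
by have [_] := f2 r; apply: integrableS => //; [exact: measurable_cub|exact: measurable_cell].
Qed.

(** Any translate of the half-open cell is a fundamental domain: once the shift is moved to the
    indicator, unfolding replaces the indicator by its lattice sum, which is 1. *)
Lemma shift_cell (f : E -> R) h : loc_int f -> Defs.periodic g f ->
  \int[mu]_(y in cell g) f (y + h) = \int[mu]_(y in cell g) f y.
Proof.
move=> lf pf; have [mf f1] := lf; have mc0 := measurable_cell0 g.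
have mi : measurable_fun [set: EB] (\1_(cell0 g) : E -> R) by exact: measurable_indic.
rewrite (Rintegral_cell0 g_free); last exact: measurable_lat.
transitivity (\int[mu]_y (f (y + h) * \1_(cell0 g) y)).
  rewrite Rintegral_mkcond; apply: eq_Rintegral => y _.
  by rewrite /patch indicE; case: ifP => _; rewrite ?mulr1 ?mulr0.
transitivity (\int[mu]_y (f y * \1_(cell0 g) (y - h))).
  rewrite -[RHS](mpres_Rintegral (leb3_shift h)).
    by apply: eq_Rintegral => y _; rewrite addrK.
  by apply: measurable_funM => //; exact: measurable_lat.
have [r hr] := cell_cub g_free; have [rh hrh] := in_cub h.
rewrite (unfold_Per g_free (r := r + rh%:R) (M := 1)) //; last 3 first.
- exact: measurable_lat.
- by move=> y; rewrite indicE; case: (_ \in _); rewrite ?normr1 ?normr0.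
- move=> y ny; rewrite indicE; case: (boolP (_ \in _)) => // /set_mem /(cell0_cell g_free) /hr cy.
  by case: ny; rewrite -[y](subrK h); apply: cubD.
apply: eq_Rintegral => y _.
by rewrite Per_shift (Per_cell0 g_free) mulr1.
Qed.

(** No determinant is computed: if the cell were null, unfolding the indicator of [cub 1] would give
    this cube measure 0 instead of 8. *)
Lemma leb3_cell_gt0 : 0 < fine (mu (cell g)).
Proof.
have mc := measurable_cell g_free.
rewrite fine_gt0 // (leb3_cell_lty g_free) andbT lt0e measure_ge0 andbT.
apply/eqP => c0.
have mi : measurable_fun [set: EB] (\1_(cub 1) : E -> R).
  by apply: measurable_indic; exact: measurable_cub.
have ib (y : E) : `|\1_(cub 1) y| <= (1 : R).
  by rewrite indicE; case: (_ \in _); rewrite ?normr1 ?normr0.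
have bi : bsupp 1 (\1_(cub 1) : E -> R) by move=> y ny; rewrite indicE memNset.
have p1 : Defs.periodic g (fun=> 1 : R) by move=> t _; exact: aeW.
have := unfold_Per g_free (L2l_loc_int (L2l_cst 1)) p1 mi ib bi.
have -> : \int[mu]_(y in cell g) (1 * Per g (\1_(cub 1)) y) = 0.
  rewrite /Rintegral null_set_integral //.
  apply/measurable_EFinP/measurable_funTS/measurable_funM => //.
  exact: (measurable_Per g_free mi bi).
under eq_Rintegral do rewrite mul1r.
rewrite /Rintegral integral_indic //; last exact: measurable_cub.
rewrite setIT.
pose I : set (measurableTypeR R) := [set` `[-1, 1]%R].
have mI : measurable I by exact: measurable_itv.
have h1 := @product_measure1E _ _ _ _ R (prod_sfm (@lebesgue_measure R) (@lebesgue_measure R)) (@lebesgue_measure R) _ _ (measurableX mI mI) mI.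
have h2 := @product_measure1E _ _ _ _ R (@lebesgue_measure R) (@lebesgue_measure R) _ _ mI mI.
have -> : cub 1 = (I `*` I) `*` I.
  by apply/seteqP; split => y /=; rewrite /I /= !in_itv /= -!ler_norml; [move=> [? ? ?]|move=> [[? ?] ?]].
have -> : mu (I `*` I `*` I) = (@lebesgue_measure R I * @lebesgue_measure R I * @lebesgue_measure R I)%E.
  by rewrite -h2; exact: h1.
have -> : @lebesgue_measure R I = 2%:E.
  by rewrite lebesgue_measure_itv /= lte_fin ifT -?EFinD ?opprK //; lra.
rewrite -!EFinM /=; lra.
Qed.

(** Local integrability is what has to be proved, so [unfold_Per] cannot be applied; the cutting is
    redone with nonnegative extended integrals. *)
Lemma periodic_L2l (f : E -> R) : measurable_fun [set: EB] f -> Defs.periodic g f ->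
  L2on mu (cell g) f -> L2l f.
Proof.
move=> mf pf [_ /integrableP[_ foo]]; split => // r.
apply: L2on_lty => //; first exact: measurable_cub.
have mc0 := measurable_cell0 g.
have [N hN] := fl_large g_free r.
pose F k y := ((f y) ^+ 2 * \1_(cell0 g) (y - lat g k))%:E.
have mind k : measurable_fun [set: EB] (fun y : E => \1_(cell0 g) (y - lat g k) : R).
  by rewrite -latN; apply: (measurable_lat (f := \1_(cell0 g))); exact: measurable_indic.
have mF k : measurable_fun [set: EB] (F k).
  by apply/measurable_EFinP; apply: measurable_funM => //; exact: measurable_funX.
have F0 k y : (0 <= F k y)%E.
  by rewrite lee_fin mulr_ge0 ?sqr_ge0 // indicE; case: (_ \in _).
apply: (@le_lt_trans _ _ (\sum_(k <- boxK N) \int[mu]_y F k y)%E).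
  rewrite -ge0_integral_sum //.
  apply: (@le_trans _ _ (\int[mu]_(y in cub r) (\sum_(k <- boxK N) F k y))%E).
    apply: ge0_le_integral => //.
    - exact: measurable_cub.
    - by move=> y _; rewrite lee_fin sqr_ge0.
    - by apply/measurable_EFinP/measurable_funTS; exact: measurable_funX.
    - by apply: measurable_funTS; apply: emeasurable_sum => k; exact: mF.
    move=> y cy; rewrite sumEFin lee_fin -(cell0_sum g_free _ (hN N y (leqnn _) cy)) //.
  apply: ge0_subset_integral => //; first exact: measurable_cub.
  - by apply: emeasurable_sum => k; exact: mF.
  - by move=> y _; exact: sume_ge0.
apply: lte_sum_pinfty => k _.
have -> : (\int[mu]_y F k y = \int[mu]_(y in cell0 g) (f y ^+ 2)%:E)%E.
  rewrite -(mpres_ge0_integral (leb3_shift (lat g k))) //.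
  rewrite [RHS]integral_mkcond.
  apply: ge0_ae_eq_integral => //.
  - by apply: (measurableT_comp (mF k)); case: (leb3_shift (lat g k)).
  - apply/(measurable_restrictT _ _).1 => //.
    by apply/measurable_EFinP/measurable_funTS; exact: measurable_funX.
  - by move=> y _; rewrite /patch; case: ifP => // _; rewrite lee_fin sqr_ge0.
  have := pf _ (lattice_lat g k); apply: aeS => y h _.
  rewrite /F addrK h /patch indicE; case: ifP => _; first by rewrite mulr1.
  by rewrite mulr0.
apply: le_lt_trans foo.
apply: (@le_trans _ _ (\int[mu]_(y in cell g) (f y ^+ 2)%:E)%E).
  apply: ge0_subset_integral => //.
  - exact: measurable_cell.
  - by apply/measurable_EFinP/measurable_funTS; exact: measurable_funX.
  - by move=> y _; rewrite lee_fin sqr_ge0.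
  - exact: cell0_cell.
apply: ge0_le_integral => //.
- exact: measurable_cell.
- by move=> y _; rewrite lee_fin sqr_ge0.
- by apply/measurable_EFinP/measurable_funTS; exact: measurable_funX.
- apply: measurableT_comp => //.
  by apply/measurable_EFinP/measurable_funTS; exact: measurable_funX.
- by move=> y _; rewrite /= lee_fin ler_norm.
Qed.

End lattice.
End L2l.

(** * Test functions *)

Section line.
Variables (R : realType) (V : normedModType R).

Lemma is_derive_line (f : V -> R) (y v : V) (t l : R) :
  is_derive (t *: v + y) v f l <-> is_derive t 1 (fun h : R => f (h *: v + y)) l.
Proof.
have E : (fun h : R => h^-1 *: ((f \o shift (t *: v + y)) (h *: v) - f (t *: v + y))) =
  (fun h : R => h^-1 *: (((fun h : R => f (h *: v + y)) \o shift t) (h *: (1 : R)) - f (t *: v + y))).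
  apply/funext => h /=; congr (_ *: (f _ - _)).
  by rewrite addrA -scalerDl /GRing.scale /= mulr1.
by split=> -[h1 h2]; constructor; move: h1 h2; rewrite /derivable /derive E.
Qed.

End line.

Section smooth1.
Variable R : realType.
Implicit Types f : R -> R.

(** The powers [x ^- k] close the family under differentiation ([is_derive_flat]), so that
    smoothness needs no formula for higher derivatives. *)
Definition flat (k : nat) (x : R) : R :=
  if 0 < x then x ^- k * expR (- x^-1) else 0.

Lemma flat_ge0 k x : 0 <= flat k x.
Proof.
rewrite /flat; case: ifP => // x0; rewrite mulr_ge0 ?expR_ge0 // invr_ge0 exprn_ge0 //.
exact: ltW.
Qed.

(** One term of the exponential series at [x^-1] suffices. Since [flat k h / h] is [flat k.+1 h] for
    positive [h], this linear bound gives the zero derivative at the origin. *)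
Lemma flat_le k x : 0 < x -> flat k x <= (k.+1)`!%:R * x.
Proof.
move=> x0; rewrite /flat x0 expRN.
have ix : 0 <= x^-1 by rewrite invr_ge0 ltW.
have h := expR_ge1Dxn k ix.
have f0 : (0 : R) < (k.+1)`!%:R by rewrite ltr0n fact_gt0.
have h2 : x ^- k.+1 / (k.+1)`!%:R <= expR x^-1.
  by apply: le_trans h; rewrite -exprVn lerDr.
have p0 : 0 < x ^- k.+1 / (k.+1)`!%:R by rewrite divr_gt0 // invr_gt0 exprn_gt0.
have : (expR x^-1)^-1 <= (x ^- k.+1 / (k.+1)`!%:R)^-1.
  by rewrite lef_pV2 // posrE ?expR_gt0.
rewrite invf_div invrK => h3.
apply: (@le_trans _ _ (x ^- k * ((k.+1)`!%:R * x ^+ k.+1))).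
  by apply: ler_wpM2l => //; rewrite invr_ge0 exprn_ge0 // ltW.
rewrite le_eqVlt; apply/orP; left; apply/eqP; rewrite exprS.
have xk : x ^+ k != 0 by rewrite expf_neq0 // gt_eqF.
by field.
Qed.

Lemma is_derive_flat k (x : R) : is_derive x 1 (flat k) (- k%:R * flat k.+1 x + flat k.+2 x).
Proof.
have [x0|x0|<-] := ltgtP 0 x.
- have xn0 : x != 0 by rewrite gt_eqF.
  apply: (@near_eq_is_derive _ _ _ (fun y : R => (y^-1) ^+ k * expR (- y^-1))).
    near=> y; rewrite /flat ifT ?exprVn //.
    by near: y; apply: lt_nbhsr.
  have dV : is_derive x 1 (fun y : R => y^-1) (- x ^- 2).
    have := @is_deriveV R id x 1 1 xn0 (is_derive_id _ _).
    by rewrite /GRing.scale /= mulr1.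
  have dN : is_derive x 1 (fun y : R => - y^-1) (x ^- 2).
    by rewrite -[x ^- 2]opprK; exact: is_deriveN.
  have dE : is_derive x 1 (fun y : R => expR (- y^-1)) (expR (- x^-1) * x ^- 2).
    exact: (@is_derive1_comp R expR (fun y => - y^-1) x _ _ (is_derive_expR (- x^-1)) dN).
  have dX : is_derive x 1 (fun y : R => y^-1 ^+ k) (k%:R * x^-1 ^+ k.-1 * - x ^- 2).
    by have := is_deriveX k dV; rewrite exprfctE.
  apply: (is_derive_eq (is_deriveM dX dE)).
  rewrite /flat x0 /GRing.scale /=.
  case: k {dX} => [|k].
    by rewrite !mul0r !mulr0 addr0 expr0 oppr0 mul0r add0r mul1r mulrC.
  rewrite !exprVn /= !exprS; have xk : x ^+ k != 0 by rewrite expf_neq0.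
  move: (expR _) (x ^+ k) xk (k.+1%:R) => e q q0 n.
  by field; rewrite xn0 q0.
- have z (m : nat) : flat m x = 0 by rewrite /flat ltNge ltW.
  rewrite !z mulr0 addr0.
  apply: (@near_eq_is_derive _ _ _ (fun=> 0)).
  near=> y; rewrite /flat ifF //; apply/negbTE; rewrite -leNgt ltW //.
  by near: y; apply: lt_nbhsl.
have z (m : nat) : flat m 0 = 0 by rewrite /flat ltxx.
rewrite !z mulr0 addr0.
have H : (h : R)^-1 *: ((flat k \o shift 0) (h *: (1 : R)) - flat k 0) @[h --> 0^'] --> (0 : R).
  apply/cvgrPdist_le => e e0.
  near=> h; rewrite sub0r normrN z subr0 /= addr0 /GRing.scale /= mulr1.
  have hn0 : h != 0 by near: h; exact: nbhs_dnbhs_neq.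
  have [h0|h0] := ltP 0 h; last by rewrite /flat ltNge h0 /= mulr0 normr0 ltW.
  have -> : h^-1 * flat k h = flat k.+1 h.
    by rewrite /flat h0 mulrA exprS invfM.
  rewrite ger0_norm ?flat_ge0 //; apply: le_trans (flat_le _ h0) _.
  have f0 : (0 : R) < (k.+2)`!%:R by rewrite ltr0n fact_gt0.
  rewrite mulrC -ler_pdivlMr //; apply: le_trans (ler_norm _) _.
  near: h; apply: dnbhs0_le; exact: divr_gt0.
by constructor; [apply/cvg_ex; exists 0|apply/cvg_lim].
Unshelve. all: by end_near.
Qed.

(** A syntactic class: its stability under differentiation is an induction, and all iterated
    derivatives follow. [smoothE] plays the same role in three variables. *)
Inductive smooth1 : (R -> R) -> Prop :=
| smooth1_flat k : smooth1 (flat k)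
| smooth1_add f1 f2 : smooth1 f1 -> smooth1 f2 -> smooth1 (fun x => f1 x + f2 x)
| smooth1_scale a f1 : smooth1 f1 -> smooth1 (fun x => a * f1 x)
| smooth1_mul f1 f2 : smooth1 f1 -> smooth1 f2 -> smooth1 (fun x => f1 x * f2 x)
| smooth1_aff a b f1 : smooth1 f1 -> smooth1 (fun x => f1 (a * x + b)).

Lemma is_derive_aff (a b x : R) : is_derive x 1 (fun x => a * x + b) a.
Proof.
have := is_deriveD (is_deriveZ a (is_derive_id x (1 : R))) (is_derive_cst b x 1).
by rewrite addr0 /GRing.scale /= mulr1.
Qed.

Lemma smooth1_derive f : smooth1 f ->
  exists2 f', smooth1 f' & forall x : R, is_derive x 1 f (f' x).
Proof.
elim=> [k|f1 f2 s1 [d1 sd1 D1] s2 [d2 sd2 D2]|a f1 s1 [d1 sd1 D1]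
       |f1 f2 s1 [d1 sd1 D1] s2 [d2 sd2 D2]|a b f1 s1 [d1 sd1 D1]].
- exists (fun x => - k%:R * flat k.+1 x + flat k.+2 x); last exact: is_derive_flat.
  by apply: smooth1_add; [apply: smooth1_scale|]; exact: smooth1_flat.
- exists (fun x => d1 x + d2 x); first exact: smooth1_add.
  by move=> x; exact: (is_deriveD (D1 x) (D2 x)).
- exists (fun x => a * d1 x); first exact: smooth1_scale.
  by move=> x; exact: (is_deriveZ a (D1 x)).
- exists (fun x => f1 x * d2 x + f2 x * d1 x).
    by apply: smooth1_add; exact: smooth1_mul.
  by move=> x; exact: (is_deriveM (D1 x) (D2 x)).
- exists (fun x => a * d1 (a * x + b)).
    by apply: smooth1_scale; exact: (smooth1_aff a b).
  move=> x; rewrite mulrC.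
  exact: (@is_derive1_comp R f1 (fun x => a * x + b) x _ _ (D1 (a * x + b)) (is_derive_aff a b x)).
Qed.

Lemma smooth1_continuous f : smooth1 f -> continuous f.
Proof.
move=> /smooth1_derive [f' _ D] x; apply: differentiable_continuous.
by apply/derivable1_diffP; case: (D x).
Qed.

End smooth1.

Section smooth3.
Variable R : realType.
Local Notation E := (R * R * R)%type.
Local Notation EB :=
  (measurableTypeR R * measurableTypeR R * measurableTypeR R)%type.
Implicit Types f : E -> R.

Definition pr (i : 'I_3) (y : E) : R := [:: y.1.1; y.1.2; y.2]`_i.

Lemma pr_line i j (h : R) y : pr i (h *: dirv R j + y) = (i == j)%:R * h + pr i y.
Proof.
case: i => [[|[|[|]]]] // ?; case: j => [[|[|[|]]]] // ?;
by rewrite /pr /dirv /= /GRing.scale /= ?mul0r ?mulr0 ?mulr1 ?mul1r.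
Qed.

Lemma pr_continuous i : continuous (pr i).
Proof.
case: i => [[|[|[|]]]] // ? y; rewrite /pr /=.
- by apply: continuous_comp; exact: cvg_fst.
- by apply: continuous_comp; [exact: cvg_fst|exact: cvg_snd].
- exact: cvg_snd.
Qed.

Inductive smoothE : (E -> R) -> Prop :=
| smoothE_pr i (th : R -> R) : smooth1 th -> smoothE (fun y => th (pr i y))
| smoothE_add f1 f2 : smoothE f1 -> smoothE f2 -> smoothE (fun x => f1 x + f2 x)
| smoothE_scale a f1 : smoothE f1 -> smoothE (fun x => a * f1 x)
| smoothE_mul f1 f2 : smoothE f1 -> smoothE f2 -> smoothE (fun x => f1 x * f2 x)
| smoothE_aff (c : E) (e : R) f1 : smoothE f1 -> smoothE (fun x => f1 (c + e *: x)).

Lemma is_derive_affine f (c : E) (e : R) (y v : E) l : is_derive (c + e *: y) v f l ->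
  is_derive y v (fun y => f (c + e *: y)) (e * l).
Proof.
move=> h.
suff : is_derive ((0 : R) *: v + y) v (fun y => f (c + e *: y)) (e * l).
  by rewrite scale0r add0r.
apply/is_derive_line.
have h' : is_derive ((e * 0 + 0) *: v + (c + e *: y)) v f l.
  by rewrite mulr0 add0r scale0r add0r.
have /is_derive_line h2 := h'.
have := @is_derive1_comp R _ (fun x => e * x + 0) 0 _ _ h2 (is_derive_aff e 0 0); rewrite mulrC.
congr (is_derive _ _ _ _); apply/funext => t /=.
by rewrite addr0 scalerDr scalerA addrCA.
Qed.

Lemma smoothE_continuous f : smoothE f -> continuous f.
Proof.
elim=> [i th s|f1 f2 _ c1 _ c2|a f1 _ c1|f1 f2 _ c1 _ c2|c e f1 _ c1] y.
- by apply: continuous_comp; [exact: pr_continuous|exact: smooth1_continuous].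
- by apply: cvgD; [exact: c1|exact: c2].
- by apply: cvgM; [exact: cvg_cst|exact: c1].
- by apply: cvgM; [exact: c1|exact: c2].
- apply: (@continuous_comp _ _ _ (fun y : E => c + e *: y) f1); last exact: c1.
  by apply: cvgD; [exact: cvg_cst|apply: cvgZr].
Qed.

Lemma smoothE_derive f j : smoothE f ->
  exists2 f', smoothE f' & forall y, is_derive y (dirv R j) f (f' y).
Proof.
elim=> [i th s|f1 f2 s1 [d1 sd1 D1] s2 [d2 sd2 D2]|a f1 s1 [d1 sd1 D1]
       |f1 f2 s1 [d1 sd1 D1] s2 [d2 sd2 D2]|c e f1 s1 [d1 sd1 D1]].
- have [th' s' D] := smooth1_derive s.
  exists (fun y => (i == j)%:R * th' (pr i y)); first by apply: smoothE_scale; exact: smoothE_pr.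
  move=> y; suff : is_derive ((0 : R) *: dirv R j + y) (dirv R j) (fun y => th (pr i y))
      ((i == j)%:R * th' (pr i y)) by rewrite scale0r add0r.
  apply/is_derive_line.
  have h : is_derive ((i == j)%:R * 0 + pr i y) 1 th (th' (pr i y)).
    by rewrite mulr0 add0r; exact: D.
  have := @is_derive1_comp R th (fun x => (i == j)%:R * x + pr i y) 0 _ _ h (is_derive_aff (i == j)%:R (pr i y) 0); rewrite mulrC.
  by congr (is_derive _ _ _ _); apply/funext => t /=; rewrite pr_line.
- exists (fun x => d1 x + d2 x); first exact: smoothE_add.
  by move=> x; exact: (is_deriveD (D1 x) (D2 x)).
- exists (fun x => a * d1 x); first exact: smoothE_scale.
  by move=> x; exact: (is_deriveZ a (D1 x)).
- exists (fun x => f1 x * d2 x + f2 x * d1 x).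
    by apply: smoothE_add; exact: smoothE_mul.
  by move=> x; exact: (is_deriveM (D1 x) (D2 x)).
- exists (fun y => e * d1 (c + e *: y)).
    by apply: smoothE_scale; exact: (smoothE_aff c e).
  by move=> y; exact: is_derive_affine.
Qed.

Lemma smoothE_partial f j : smoothE f -> smoothE (fun y => 'D_(dirv R j) f y).
Proof.
move=> /(smoothE_derive j) [f' sf' D].
rewrite (_ : (fun y => _) = f') //; apply/funext => y.
by have [_ ->] := D y.
Qed.

Lemma smoothE_smooth f : smoothE f -> Defs.smooth f.
Proof.
move=> sf s; have sp : smoothE (iter_partial s f).
  by elim: s => //= j s IH; exact: smoothE_partial.
split; first exact: smoothE_continuous.
by move=> j y; have [f' _ D] := smoothE_derive j sp; case: (D y).
Qed.

End smooth3.

Section test_functions.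
Variable R : realType.
Local Notation E := (R * R * R)%type.
Local Notation EB :=
  (measurableTypeR R * measurableTypeR R * measurableTypeR R)%type.
Local Notation mu := (leb3 R).
Implicit Types f psi : E -> R.

Lemma closed_cub (r : R) : closed (cub r : set E).
Proof. by apply: compact_closed; [exact: norm_hausdorff|exact: compact_cub]. Qed.

Lemma test_bsupp psi : test_fun psi -> exists r, bsupp r psi.
Proof.
move=> [_ /compact_sub_cub [r hr]]; exists r => y ny; apply/eqP.
by apply: contra_notT ny => h; apply: hr; exact: subset_closure.
Qed.

Lemma test_funP psi : test_fun psi <-> Defs.smooth psi /\ exists r, bsupp r psi.
Proof.
split=> [tp|[sp [r bp]]]; first by split; [exact: tp.1|exact: test_bsupp].
split=> //; apply: (subclosed_compact _ (@compact_cub R r)).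
  exact: closed_closure.
rewrite closureE; apply: smallest_sub; first exact: closed_cub.
by move=> y /= h; apply: contrapT => /bp p0; rewrite p0 eqxx in h.
Qed.

Lemma smooth_partial psi j : Defs.smooth psi -> Defs.smooth ('D_(dirv R j) psi).
Proof.
move=> sp s; have -> : iter_partial s ('D_(dirv R j) psi) = iter_partial (rcons s j) psi.
  by rewrite /iter_partial foldr_rcons.
exact: sp.
Qed.

Lemma smooth_continuous psi : Defs.smooth psi -> continuous psi.
Proof. by move=> /(_ [::]) []. Qed.

Lemma smooth_derivable psi j (y : E) : Defs.smooth psi -> derivable psi y (dirv R j).
Proof. by move=> /(_ [::]) [_]; apply. Qed.

Lemma smooth_measurable psi : Defs.smooth psi -> measurable_fun [set: EB] psi.
Proof. by move=> /smooth_continuous /continuous_measurable3. Qed.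

Lemma smooth_add f1 f2 : Defs.smooth f1 -> Defs.smooth f2 -> Defs.smooth (fun y => f1 y + f2 y).
Proof.
move=> s1 s2.
have E s : iter_partial s (fun y => f1 y + f2 y) =
    (fun y => iter_partial s f1 y + iter_partial s f2 y).
  elim: s => //= j s ->; apply/funext => y.
  by apply: deriveD; [exact: (s1 s).2|exact: (s2 s).2].
move=> s; rewrite E; split=> [y|j y].
  by apply: cvgD; [exact: (s1 s).1|exact: (s2 s).1].
by apply: derivableD; [exact: (s1 s).2|exact: (s2 s).2].
Qed.

Lemma smooth_scale a f : Defs.smooth f -> Defs.smooth (fun y => a * f y).
Proof.
move=> s1.
have E s : iter_partial s (fun y => a * f y) = (fun y => a * iter_partial s f y).
  elim: s => //= j s ->; apply/funext => y.
  by apply: deriveZ; exact: (s1 s).2.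
move=> s; rewrite E; split=> [y|j y].
  by apply: cvgM; [exact: cvg_cst|exact: (s1 s).1].
by apply: derivableZ; exact: (s1 s).2.
Qed.

Lemma bsuppS r s f : r <= s -> bsupp r f -> bsupp s f.
Proof. by move=> rs bf y ny; apply: bf => /(cubS rs). Qed.

Lemma bsupp_add r s f1 f2 : bsupp r f1 -> bsupp s f2 ->
  bsupp (Num.max r s) (fun y => f1 y + f2 y).
Proof.
move=> b1 b2 y ny; rewrite (bsuppS _ b1 ny) ?(bsuppS _ b2 ny) ?addr0 //;
by rewrite le_max lexx ?orbT.
Qed.

Lemma test_add f1 f2 : test_fun f1 -> test_fun f2 -> test_fun (fun y => f1 y + f2 y).
Proof.
move=> /test_funP [s1 [r1 b1]] /test_funP [s2 [r2 b2]]; apply/test_funP; split.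
  exact: smooth_add.
by exists (Num.max r1 r2); exact: bsupp_add.
Qed.

Lemma test_scale a f : test_fun f -> test_fun (fun y => a * f y).
Proof.
move=> /test_funP [s1 [r1 b1]]; apply/test_funP; split; first exact: smooth_scale.
by exists r1 => y ny; rewrite b1 ?mulr0.
Qed.

Lemma test0 : test_fun (fun=> 0 : R).
Proof.
apply/test_funP; split; last by exists 0.
have -> : (fun=> 0 : R) = (fun y : E => 0 * flat 0 (pr ord0 y)).
  by apply/funext => y; rewrite mul0r.
by apply: smoothE_smooth; apply: smoothE_scale; apply: smoothE_pr; exact: smooth1_flat.
Qed.

Lemma bsupp_bounded r f : continuous f -> bsupp r f -> exists M : R, forall y : E, `|f y| <= M.
Proof.
move=> cf bf.
have cK : compact (f @` cub r).
  apply: continuous_compact; last exact: compact_cub.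
  by apply: continuous_subspaceT.
have [M [_ hM]] := compact_bounded cK; exists (`|M| + 1) => y.
have [cy|ny] := pselect (cub r y).
  by apply: (hM (`|M| + 1)); [rewrite (le_lt_trans (ler_norm M)) // ltrDl|exists y].
by rewrite bf // normr0 addr_ge0.
Qed.

Lemma bsupp_partial r psi j : bsupp r psi -> bsupp r ('D_(dirv R j) psi).
Proof.
move=> bp y ny; rewrite (@near_eq_derive _ _ _ _ (cst 0) y) ?derive_cst //.
have oc : open (~` (cub r : set E)) by apply: closed_openC; exact: closed_cub.
by have := open_nbhs_nbhs (conj oc ny); apply: filterS => z /bp.
Qed.

Lemma test_partial psi j : test_fun psi -> test_fun ('D_(dirv R j) psi).
Proof.
move=> /test_funP [s1 [r1 b1]]; apply/test_funP; split; first exact: smooth_partial.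
by exists r1; exact: bsupp_partial.
Qed.

Lemma test_bounded psi : test_fun psi -> exists M : R, forall y : E, `|psi y| <= M.
Proof.
move=> tp; have [r bp] := test_bsupp tp.
by apply: bsupp_bounded bp; apply: smooth_continuous; exact: tp.1.
Qed.

Lemma test_measurable psi : test_fun psi -> measurable_fun [set: EB] psi.
Proof. by case=> /smooth_measurable. Qed.

Definition dq (j : 'I_3) (h : R) f (y : E) : R := h^-1 * (f (y + h *: dirv R j) - f y).

Lemma smooth_line psi j (y : E) (t : R) : Defs.smooth psi ->
  is_derive t 1 (fun h : R => psi (h *: dirv R j + y)) ('D_(dirv R j) psi (t *: dirv R j + y)).
Proof.
move=> sp.
have D (z : E) : is_derive z (dirv R j) psi ('D_(dirv R j) psi z).
  exact: (DeriveDef (@smooth_derivable psi j z sp) erefl).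
have := (is_derive_line psi y (dirv R j) t ('D_(dirv R j) psi (t *: dirv R j + y))).1.
by move=> /(_ (D _)).
Qed.

Lemma smooth_lip psi j M (y : E) (h : R) : Defs.smooth psi ->
  (forall y : E, `|'D_(dirv R j) psi y| <= M) ->
  `|psi (y + h *: dirv R j) - psi y| <= M * `|h|.
Proof.
move=> sp hM; have M0 : 0 <= M by apply: le_trans (hM 0).
pose phi (t : R) := psi (t *: dirv R j + y).
have D (t : R) : is_derive t 1 phi ('D_(dirv R j) psi (t *: dirv R j + y)) by exact: smooth_line.
have cphi : continuous phi.
  move=> t; apply: differentiable_continuous; apply/derivable1_diffP.
  by case: (D t).
have key a b : a <= b -> `|phi b - phi a| <= M * (b - a).
  rewrite le_eqVlt => /predU1P[->|ab]; first by rewrite !subrr normr0 mulr0.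
  have [c _ ->] := MVT ab (fun t _ => D t) (continuous_subspaceT cphi).
  have ba : 0 <= b - a by rewrite subr_ge0 ltW.
  by rewrite normrM (ger0_norm ba); exact: (ler_wpM2r ba (hM _)).
have -> : psi (y + h *: dirv R j) - psi y = phi h - phi 0.
  by rewrite /phi scale0r add0r [h *: _ + y]addrC.
have [h0|h0] := leP 0 h.
  by apply: le_trans (key _ _ h0) _; rewrite subr0 ger0_norm.
by rewrite distrC; apply: le_trans (key _ _ (ltW h0)) _; rewrite sub0r ltr0_norm.
Qed.

Lemma test_dq_bounded psi j : test_fun psi ->
  exists M : R, forall (y : E) (h : R), `|dq j h psi y| <= M.
Proof.
move=> tp; have [M hM] := test_bounded (test_partial j tp).
exists M => y h; rewrite /dq normrM.
have M0 : 0 <= M by apply: le_trans (hM 0).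
have [->|h0] := eqVneq h 0; first by rewrite invr0 normr0 mul0r.
rewrite normfV mulrC ler_pdivrMr ?normr_gt0 //.
by apply: smooth_lip => //; exact: tp.1.
Qed.

Lemma smooth_dq_cvg psi j (y : E) (u : nat -> R) : Defs.smooth psi ->
  (forall n, u n != 0) -> u n @[n --> \oo] --> 0 ->
  dq j (u n) psi y @[n --> \oo] --> 'D_(dirv R j) psi y.
Proof.
move=> sp u0 ul; have /cvg_ex[l hl] := @smooth_derivable psi j y sp.
have Dl : 'D_(dirv R j) psi y = l by apply/cvg_lim.
rewrite Dl; have /cvgr_dnbhsP /(_ u (conj u0 ul)) hl' := hl.
have -> : (fun n => dq j (u n) psi y) =
    (fun n => (u n)^-1 *: ((psi \o shift y) (u n *: dirv R j) - psi y)); last exact: hl'.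
by apply/funext => n; rewrite /dq /= [X in psi X]addrC.
Qed.

(* Difference quotients converging boundedly are all that is needed to integrate
   by parts, thanks to the translation invariance of the Lebesgue measure. *)
Definition dqlim (j : 'I_3) (f f' : E -> R) : Prop :=
  [/\ measurable_fun [set: EB] f, measurable_fun [set: EB] f',
      forall r, exists M : R, forall (y : E) (h : R), cub r y -> 0 < `|h| <= 1 ->
        `|f y| <= M /\ `|dq j h f y| <= M &
      forall (y : E) (u : nat -> R), (forall n, u n != 0) -> u n @[n --> \oo] --> 0 ->
        dq j (u n) f y @[n --> \oo] --> f' y].

(** The sign [e] selects forward or backward difference quotients. *)
Definition hseq (e : R) (n : nat) : R := e * n.+1%:R^-1.

Lemma hseq_neq0 e n : `|e| = 1 -> hseq e n != 0.
Proof. by move=> e1; rewrite mulf_neq0 ?invr_eq0 ?pnatr_eq0 // -normr_eq0 e1 oner_eq0. Qed.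

Lemma hseq_le1 e n : `|e| = 1 -> 0 < `|hseq e n| <= 1.
Proof.
move=> e1; rewrite normr_gt0 hseq_neq0 //= normrM e1 mul1r ger0_norm ?invr_ge0 ?ler0n //.
by rewrite invf_le1 ?ler1n ?ltr0n.
Qed.

Lemma hseq_cvg e : hseq e n @[n --> \oo] --> 0.
Proof. by rewrite -(mulr0 e); apply: cvgMr; exact: cvg_harmonic. Qed.

Lemma dqlim_bound j f f' : dqlim j f f' -> forall r, exists M : R, forall y : E, cub r y ->
  `|f y| <= M /\ `|f' y| <= M.
Proof.
move=> [_ _ hb hc] r; have [M hM] := hb r; exists M => y cy.
have n1 : `|1| = 1 :> R by rewrite normr1.
split; first by have [] := hM y _ cy (hseq_le1 0 n1).
have h : `|dq j (hseq 1 n) f y| @[n --> \oo] --> `|f' y|.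
  by apply: cvg_norm; apply: hc; [move=> n; exact: hseq_neq0|exact: hseq_cvg].
apply: (ler_cvg_to h (cvg_cst M)); apply: nearW => n.
by have [] := hM y _ cy (hseq_le1 n n1).
Qed.

Lemma Rintegral_dominated (D : set EB) (f_ : nat -> E -> R) (f g : E -> R) : measurable D ->
  (forall n, measurable_fun [set: EB] (f_ n)) -> measurable_fun [set: EB] f ->
  mu.-integrable D (EFin \o g) -> (forall n y, D y -> `|f_ n y| <= g y) ->
  (forall y, D y -> f_ n y @[n --> \oo] --> f y) ->
  \int[mu]_(y in D) f_ n y @[n --> \oo] --> \int[mu]_(y in D) f y.
Proof.
move=> mD mf_ mf ig fg fc.
have [|||||h1 _ h2] := @dominated_convergence _ _ _ mu D mD (fun n y => (f_ n y)%:E)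
  (fun y => (f y)%:E) (fun y => (g y)%:E).
- by move=> n; apply/measurable_EFinP/measurable_funTS.
- by apply/measurable_EFinP/measurable_funTS.
- by apply/aeW => y Dy; apply: cvg_EFin; [exact: nearW|exact: fc].
- exact: ig.
- by apply/aeW => y n Dy; rewrite lee_fin; exact: fg.
- by apply: fine_cvg; rewrite fineK //; exact: integrable_fin_num.
Qed.

Lemma measurable_dq j h f : measurable_fun [set: EB] f -> measurable_fun [set: EB] (dq j h f).
Proof.
move=> mf; apply: measurable_funM => //; apply: measurable_funB => //.
exact: measurable_lat.
Qed.

Lemma cub_dirv j (h : R) : `|h| <= 1 -> cub 1 (h *: dirv R j).
Proof.
move=> h1; case: j => [[|[|[|]]]] // ?; split;
by rewrite /dirv /= /GRing.scale /= ?mulr0 ?mulr1 ?normr0.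
Qed.

Lemma integral_by_parts j f f' psi : dqlim j f f' -> test_fun psi ->
  \int[mu]_y (f' y * psi y) = - \int[mu]_y (f y * 'D_(dirv R j) psi y).
Proof.
move=> df tp; have [mf mf' hb hc] := df.
have [rp bp] := test_bsupp tp; have [Mp hMp] := test_bounded tp.
have [Mq hMq] := test_dq_bounded j tp.
have mp := test_measurable tp; have mp' := test_measurable (test_partial j tp).
(* Steps have length at most 1, so quotients of [psi] are supported in the cube of half-side
   [rp + 1], where the domination takes place. *)
have [M hM] := hb (rp + 1).
have icst r (c : R) : mu.-integrable (cub r) (EFin \o fun=> c).
  exact: (L2l_loc_int (L2l_cst c)).2.
have n1 : `|1| = 1 :> R by rewrite normr1.
have nN1 : `|-1| = 1 :> R by rewrite normrN normr1.
have bsub h : 0 < `|h| <= 1 -> bsupp (rp + 1) (dq j h psi).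
  move=> /andP[_ h1] y ny; rewrite /dq !bp ?subrr ?mulr0 //.
  - by move=> /(cubS _) cy; apply: ny; apply: cy; rewrite lerDl.
  - move=> cy; apply: ny; rewrite -[y](addrK (h *: dirv R j)); apply: cubD => //.
    by apply/cubN; exact: cub_dirv.
have L1 : \int[mu]_y (dq j (hseq 1 n) f y * psi y) @[n --> \oo] -->
    \int[mu]_y (f' y * psi y).
  rewrite (@bsupp_Rintegral _ (rp + 1)); last 2 first.
  - exact: measurable_funM.
  - by move=> y ny; rewrite (bsuppS _ bp ny) ?mulr0 // lerDl.
  have -> : (fun n => \int[mu]_y (dq j (hseq 1 n) f y * psi y)) =
     (fun n => \int[mu]_(y in cub (rp + 1)) (dq j (hseq 1 n) f y * psi y)).
    apply/funext => n; rewrite (@bsupp_Rintegral _ (rp + 1)) //.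
    - by apply: measurable_funM => //; exact: measurable_dq.
    - by move=> y ny; rewrite (bsuppS _ bp ny) ?mulr0 // lerDl.
  apply: (@Rintegral_dominated _ _ _ (fun=> M * Mp)) => //.
  - exact: measurable_cub.
  - by move=> n; apply: measurable_funM => //; exact: measurable_dq.
  - exact: measurable_funM.
  - move=> n y cy; rewrite normrM; apply: ler_pM => //.
    by have [] := hM y _ cy (hseq_le1 n n1).
  - move=> y _; apply: cvgMl; apply: hc; last exact: hseq_cvg.
    by move=> n; exact: hseq_neq0.
have L2 : \int[mu]_y (f y * dq j (hseq (-1) n) psi y) @[n --> \oo] -->
    \int[mu]_y (f y * 'D_(dirv R j) psi y).
  rewrite (@bsupp_Rintegral _ (rp + 1)); last 2 first.
  - exact: measurable_funM.
  - move=> y ny; rewrite (bsuppS _ (bsupp_partial j bp) ny) ?mulr0 // lerDl //.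
  have -> : (fun n => \int[mu]_y (f y * dq j (hseq (-1) n) psi y)) =
     (fun n => \int[mu]_(y in cub (rp + 1)) (f y * dq j (hseq (-1) n) psi y)).
    apply/funext => n; rewrite (@bsupp_Rintegral _ (rp + 1)) //.
    - by apply: measurable_funM => //; exact: measurable_dq.
    - by move=> y ny; rewrite (bsub _ (hseq_le1 n nN1)) // mulr0.
  apply: (@Rintegral_dominated _ _ _ (fun=> M * Mq)) => //.
  - exact: measurable_cub.
  - by move=> n; apply: measurable_funM => //; exact: measurable_dq.
  - exact: measurable_funM.
  - move=> n y cy; rewrite normrM; apply: ler_pM => //.
    by have [] := hM y _ cy (hseq_le1 n n1).
  - move=> y _; apply: cvgMr; apply: smooth_dq_cvg; [exact: tp.1| |exact: hseq_cvg].
    by move=> n; exact: hseq_neq0.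
have lf : loc_int f.
  apply: L2l_loc_int; apply: L2l_loc_bounded => // r.
  by have [M' hM'] := dqlim_bound df r; exists M' => y /hM' [].
(* An exact discrete summation by parts: the substitution [y - h] turns the forward quotient of [f]
   into minus the backward quotient of [psi]. *)
have key n : \int[mu]_y (dq j (hseq 1 n) f y * psi y) =
    - \int[mu]_y (f y * dq j (hseq (-1) n) psi y).
  set h := hseq 1 n; have -> : hseq (-1) n = - h by rewrite /h /hseq mulN1r mul1r.
  have h1 : 0 < `|h| <= 1 by exact: hseq_le1.
  have i0 : mu.-integrable setT (EFin \o (fun y => f y * psi y)).
    exact: (loc_int_mul (r := rp) (M := Mp)).
  have mps : measurable_fun [set: EB] (fun y : E => psi (y - h *: dirv R j)).
    exact: measurable_lat.
  have ms : measurable_fun [set: EB] (fun y : E => f y * psi (y - h *: dirv R j)).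
    exact: measurable_funM.
  have i1 : mu.-integrable setT (EFin \o (fun y => f y * psi (y - h *: dirv R j))).
    apply: (loc_int_mul (r := rp + 1) (M := Mp)) => //.
    move=> y ny; apply: bp => cy; apply: ny; rewrite -[y](subrK (h *: dirv R j)).
    by apply: cubD => //; apply: cub_dirv; case/andP: h1.
  have i2 := mpres_integrable (leb3_shift (h *: dirv R j)) ms i1.
  transitivity (h^-1 * (\int[mu]_y (f y * psi (y - h *: dirv R j)) - \int[mu]_y (f y * psi y))).
    rewrite -[X in _ * (X - _)](mpres_Rintegral (leb3_shift (h *: dirv R j)) ms).
    rewrite -RintegralB // -RintegralZl //; last first.
      by have := integrableB measurableT i2 i0; apply: eq_integrable.
    by apply: eq_Rintegral => y _; rewrite /dq /= addrK; ring.
  rewrite -RintegralB // -RintegralZl //; last first.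
    by have := integrableB measurableT i1 i0; apply: eq_integrable.
  rewrite -[RHS]mulN1r -[RHS]RintegralZl //; last first.
    have : mu.-integrable setT (EFin \o (fun y => (- h)^-1 * (f y * psi (y - h *: dirv R j) - f y * psi y))).
      apply: integrable_scaleR => //.
      by have := integrableB measurableT i1 i0; apply: eq_integrable.
    by apply: eq_integrable => // y _ /=; rewrite /dq scaleNr -mulrBr mulrCA.
  by apply: eq_Rintegral => y _; rewrite /dq scaleNr invrN; ring.
have L2' : (- \int[mu]_y (f y * dq j (hseq (-1) n) psi y)) @[n --> \oo] -->
    - \int[mu]_y (f y * 'D_(dirv R j) psi y) by exact: cvgN.
rewrite -(cvg_lim (@Rhausdorff R) L1) -(cvg_lim (@Rhausdorff R) L2').
by congr (lim (_ @ \oo)); apply/funext => n; exact: key.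
Qed.

End test_functions.

(** * Bumps on boxes and functions orthogonal to all test functions *)

Section density.
Variable R : realType.
Local Notation E := (R * R * R)%type.
Local Notation EB :=
  (measurableTypeR R * measurableTypeR R * measurableTypeR R)%type.
Local Notation mu := (leb3 R).

Lemma flat0_le1 (x : R) : flat 0 x <= 1.
Proof.
rewrite /flat; case: ifP => // x0; rewrite expr0 invr1 mul1r -[leRHS]expR0 ler_expR.
by rewrite oppr_le0 invr_ge0 ltW.
Qed.

Lemma flat0_gt0 (x : R) : 0 < x -> 0 < flat 0 x.
Proof. by move=> x0; rewrite /flat x0 expr0 invr1 mul1r expR_gt0. Qed.

Lemma flat_le0 k (x : R) : x <= 0 -> flat k x = 0.
Proof. by move=> x0; rewrite /flat ltNge x0. Qed.

Lemma flat0_cvg (x : R) : 0 < x -> flat 0 (n.+1%:R * x) @[n --> \oo] --> (1 : R).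
Proof.
move=> x0; have -> : (fun n : nat => flat 0 (n.+1%:R * x)) =
    (fun n : nat => expR (- (n.+1%:R^-1 * x^-1))).
  apply/funext => n; rewrite /flat ifT; last by rewrite mulr_gt0 ?ltr0n.
  by rewrite expr0 invr1 mul1r invfM.
rewrite -[X in _ --> X]expR0; apply: continuous_cvg; first exact: continuous_expR.
rewrite -oppr0 -(mul0r x^-1); apply: cvgN; apply: cvgMl; exact: cvg_harmonic.
Qed.

(** Smooth, with values in [0, 1], positive exactly on the open interval from [c] to [d], and
    convergent there to 1: dilating by [n.+1] drives the exponent of [flat 0] to 0. *)
Definition bump (c d : R) (n : nat) (x : R) : R :=
  flat 0 (n.+1%:R * (x - c)) * flat 0 (n.+1%:R * (d - x)).

Lemma bump_smooth1 c d n : smooth1 (bump c d n).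
Proof.
have -> : bump c d n = fun x => flat 0 (n.+1%:R * x + (- (n.+1%:R * c))) *
    flat 0 ((- n.+1%:R) * x + n.+1%:R * d).
  by apply/funext => x; rewrite /bump mulrBr mulrBr mulNr [X in _ = _ * flat 0 X]addrC.
by apply: smooth1_mul; apply: (smooth1_aff _ _ (smooth1_flat _ _)).
Qed.

Lemma bump_ge0 c d n x : 0 <= bump c d n x.
Proof. by rewrite mulr_ge0 ?flat_ge0. Qed.

Lemma bump_le1 c d n x : bump c d n x <= 1.
Proof. by rewrite -[leRHS]mulr1; apply: ler_pM; rewrite ?flat_ge0 ?flat0_le1. Qed.

Lemma bump_out c d n x : ~~ (c < x < d) -> bump c d n x = 0.
Proof.
rewrite negb_and -!leNgt /bump => /orP[h|h].
  by rewrite flat_le0 ?mul0r // mulr_ge0_le0 // subr_le0.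
by rewrite [X in _ * X]flat_le0 ?mulr0 // mulr_ge0_le0 // subr_le0.
Qed.

Lemma bump_gt0 c d n x : c < x < d -> 0 < bump c d n x.
Proof.
by move=> /andP[h1 h2]; rewrite /bump mulr_gt0 ?flat0_gt0 ?mulr_gt0 ?ltr0n ?subr_gt0.
Qed.

Lemma bump_cvg c d x : c < x < d -> bump c d n x @[n --> \oo] --> (1 : R).
Proof.
move=> /andP[h1 h2]; rewrite -[X in _ --> X]mulr1.
by apply: cvgM; apply: flat0_cvg; rewrite subr_gt0.
Qed.

Let i0 : 'I_3 := @Ordinal 3 0 isT.
Let i1 : 'I_3 := @Ordinal 3 1 isT.
Let i2 : 'I_3 := @Ordinal 3 2 isT.

Definition bbox (a b : E) (n : nat) (y : E) : R :=
  bump (pr i0 a) (pr i0 b) n (pr i0 y) * bump (pr i1 a) (pr i1 b) n (pr i1 y) *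
  bump (pr i2 a) (pr i2 b) n (pr i2 y).

Lemma bbox_smooth a b n : smoothE (bbox a b n).
Proof.
by apply: smoothE_mul; [apply: smoothE_mul|]; apply: smoothE_pr; exact: bump_smooth1.
Qed.

Lemma bbox_ge0 a b n y : 0 <= bbox a b n y.
Proof. by apply: mulr_ge0; [apply: mulr_ge0|]; exact: bump_ge0. Qed.

Lemma bbox_le1 a b n y : bbox a b n y <= 1.
Proof.
rewrite -[leRHS]mulr1; apply: ler_pM; [|exact: bump_ge0| |exact: bump_le1].
  by apply: mulr_ge0; exact: bump_ge0.
by rewrite -[leRHS]mulr1; apply: ler_pM; [exact: bump_ge0..|exact: bump_le1|exact: bump_le1].
Qed.

Lemma bbox_out a b n y : ~ obox a b y -> bbox a b n y = 0.
Proof.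
move=> ny; rewrite /bbox.
have [h1|h1] := boolP (pr i0 a < pr i0 y < pr i0 b); last by rewrite (bump_out _ h1) !mul0r.
have [h2|h2] := boolP (pr i1 a < pr i1 y < pr i1 b); last by rewrite (bump_out _ h2) mulr0 mul0r.
have [h3|h3] := boolP (pr i2 a < pr i2 y < pr i2 b); last by rewrite (bump_out _ h3) mulr0.
by case: ny; split.
Qed.

Lemma bbox_gt0 a b n y : obox a b y -> 0 < bbox a b n y.
Proof.
by move=> [h1 h2 h3]; apply: mulr_gt0; [apply: mulr_gt0|]; exact: bump_gt0.
Qed.

Lemma bbox_cvg a b y : obox a b y -> bbox a b n y @[n --> \oo] --> (1 : R).
Proof.
move=> [h1 h2 h3]; rewrite -[X in _ --> X]mulr1; apply: cvgM; last exact: bump_cvg.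
by rewrite -[X in _ --> X]mulr1; apply: cvgM; exact: bump_cvg.
Qed.

Lemma obox_cub (a b : E) : exists r : R, obox a b `<=` cub r.
Proof.
have [r ha] := in_cub a; have [s hb] := in_cub b; exists (r%:R + s%:R).
case: ha => a1 a2 a3; case: hb => b1 b2 b3.
have key (x u v : R) : `|u| <= r%:R -> `|v| <= s%:R -> u < x < v -> `|x| <= r%:R + s%:R.
  have : (0 : R) <= r%:R by []. have : (0 : R) <= s%:R by [].
  move: (r%:R) (s%:R) => p q; rewrite !ler_norml => *; lra.
by move=> y [h1 h2 h3]; split; [exact: key h1|exact: key h2|exact: key h3].
Qed.

Lemma bbox_test a b n : test_fun (bbox a b n).
Proof.
apply/test_funP; split; first by apply: smoothE_smooth; exact: bbox_smooth.
have [r hr] := obox_cub a b; exists r => y ny; apply: bbox_out => /hr; exact: ny.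
Qed.

Lemma test_affine (a b : E) n (c : E) (e : R) : e = 1 \/ e = -1 ->
  test_fun (fun y => bbox a b n (c + e *: y)).
Proof.
move=> e1; apply/test_funP; split.
  by apply: smoothE_smooth; apply: smoothE_aff; exact: bbox_smooth.
have [r hr] := obox_cub a b; have [s hs] := in_cub c; exists (s%:R + r) => y ny.
apply: bbox_out => /hr h; apply: ny.
have -> : y = e *: ((c + e *: y) - c).
  by rewrite addrAC subrr add0r scalerA; case: e1 => ->; rewrite ?mulr1 ?mulrNN ?mulr1 scale1r.
have h2 : cub (s%:R + r) ((c + e *: y) - c).
  by rewrite addrC; apply: cubD => //; apply/cubN.
move: (c + e *: y - c) h2 => z h2.
by case: e1 => ->; [rewrite scale1r|rewrite scaleN1r; apply/cubN].
Qed.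

Definition oboxes : set (set EB) := [set A | exists a b : E, A = obox a b].

Lemma oboxI (a b c d : E) : obox a b `&` obox c d =
  obox (Num.max a.1.1 c.1.1, Num.max a.1.2 c.1.2, Num.max a.2 c.2)
       (Num.min b.1.1 d.1.1, Num.min b.1.2 d.1.2, Num.min b.2 d.2).
Proof.
apply/seteqP; split => y /=; rewrite /obox /= !gt_max !lt_min.
  by move=> [[/andP[-> ->] /andP[-> ->] /andP[-> ->]] [/andP[-> ->] /andP[-> ->] /andP[-> ->]]].
move=> [/andP[/andP[? ?] /andP[? ?]] /andP[/andP[? ?] /andP[? ?]] /andP[/andP[? ?] /andP[? ?]]].
by split; split; apply/andP.
Qed.

Lemma obox_bigcup (f : nat -> E) (h : nat -> E) (P : set E) :
  (forall y, P y <-> exists n, obox (f n) (h n) y) -> <<s oboxes >> P.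
Proof.
move=> hP; have -> : P = \bigcup_n obox (f n) (h n).
  by apply/seteqP; split => y; [move=> /hP[n hn]; exists n|move=> [n _ hn]; apply/hP; exists n].
apply: sigma_algebra_bigcup => n.
by apply: sub_sigma_algebra; exists (f n), (h n).
Qed.

(** An open slab is a countable union of boxes, so the coordinates are measurable for the
    sigma-algebra generated by boxes, and hence so is the identity into the product [EB]. *)
Lemma measurable_oboxes : @measurable _ EB = <<s oboxes >>.
Proof.
apply/seteqP; split; last first.
  apply: smallest_sub; first exact: sigma_algebra_measurable.
  by move=> _ [a [b ->]]; exact: measurable_obox.
pose GT := g_sigma_algebraType oboxes.
have bnd (x : R) : exists n : nat, - n%:R < x < n%:R.
  exists (Num.bound `|x|); have := unstable.ltr_bound `|x|.
  by rewrite ltr_norml.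
have mI (h : EB -> R) (f : R -> nat -> E) (k : R -> nat -> E) :
   (forall c d y, (c < h y < d) <-> exists n, obox (f c n) (k d n) y) ->
   measurable_fun [set: GT] (h : GT -> measurableTypeR R).
  move=> hP; apply: (measurability _ (RGenOpens.measurableE R)).
  move=> _ [_ [c [d ->] <-]]; rewrite setTI.
  apply: (@obox_bigcup (f c) (k d)) => y; rewrite -hP /=.
  by rewrite in_itv.
have m1 : measurable_fun [set: GT] (fun y : GT => (y : EB).1.1 : measurableTypeR R).
  apply: (mI _ (fun c n => (c, - n%:R, - n%:R)) (fun d n => (d, n%:R, n%:R))) => c d y.
  split=> [h|[n []] //].
  have [n1 h1] := bnd y.1.2; have [n2 h2] := bnd y.2; exists (n1 + n2)%N.
  by split => //=; rewrite natrD; have := ler0n R n1; have := ler0n R n2; lra.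
have m2 : measurable_fun [set: GT] (fun y : GT => (y : EB).1.2 : measurableTypeR R).
  apply: (mI _ (fun c n => (- n%:R, c, - n%:R)) (fun d n => (n%:R, d, n%:R))) => c d y.
  split=> [h|[n []] //].
  have [n1 h1] := bnd y.1.1; have [n2 h2] := bnd y.2; exists (n1 + n2)%N.
  by split => //=; rewrite natrD; have := ler0n R n1; have := ler0n R n2; lra.
have m3 : measurable_fun [set: GT] (fun y : GT => (y : EB).2 : measurableTypeR R).
  apply: (mI _ (fun c n => (- n%:R, - n%:R, c)) (fun d n => (n%:R, n%:R, d))) => c d y.
  split=> [h|[n []] //].
  have [n1 h1] := bnd y.1.1; have [n2 h2] := bnd y.1.2; exists (n1 + n2)%N.
  by split => //=; rewrite natrD; have := ler0n R n1; have := ler0n R n2; lra.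
have mid : measurable_fun [set: GT] (fun y : GT => ((y : EB).1.1, (y : EB).1.2, (y : EB).2) : EB).
  by apply: measurable_fun_pair => //; apply: measurable_fun_pair.
move=> A mA; have := mid measurableT A mA; rewrite setTI.
by congr (<<s oboxes >> _); apply/seteqP; split => -[[y1 y2] y3].
Qed.

(** Dynkin's lemma: boxes are stable under intersection, and the sets on which [f] has integral zero
    form a Dynkin class. The whole space enters as the limit of growing boxes. *)
Lemma Rintegral_oboxes_eq0 (f : E -> R) : mu.-integrable setT (EFin \o f) ->
  (forall a b, \int[mu]_(y in obox a b) f y = 0) -> {ae mu, forall y, f y = 0}.
Proof.
move=> fi f0; have mf := measurable_int _ fi.
have iS (A : set EB) : measurable A -> mu.-integrable A (EFin \o f).
  by move=> mA; exact: (integrableS measurableT mA (subsetT _) fi).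
have toE (A : set EB) : measurable A -> \int[mu]_(y in A) f y = 0 ->
    (\int[mu]_(y in A) (f y)%:E = 0)%E.
  by move=> mA h; rewrite -[LHS]fineK ?integrable_fin_num ?iS // -[fine _]/(\int[mu]_(y in A) f y) h.
have setT0 : \int[mu]_y f y = 0.
  pose c (n : nat) : E := (n%:R, n%:R, n%:R).
  have L : \int[mu]_y (f y * \1_(obox (- c n) (c n)) y) @[n --> \oo] --> \int[mu]_y f y.
    have mf' : measurable_fun [set: EB] f by apply/measurable_EFinP.
    apply: (@Rintegral_dominated _ _ _ _ (fun y => `|f y|)) => //.
    - by move=> n; apply: measurable_funM => //; apply: measurable_indic; exact: measurable_obox.
    - exact: integrable_norm.
    - move=> n y _; rewrite normrM -[leRHS]mulr1; apply: ler_pM => //.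
      by rewrite indicE; case: (_ \in _); rewrite ?normr1 ?normr0.
    - move=> y _; apply: cvg_near_cst; have [N [h1 h2 h3]] := in_cub y.
      exists N.+1 => // n /= Nn; rewrite indicE mem_set ?mulr1 //.
      have Nn' : N%:R < n%:R :> R by rewrite ltr_nat.
      move: h1 h2 h3; rewrite !ler_norml => h1 h2 h3.
      by split; rewrite /c /=; lra.
  have L0 : \int[mu]_y (f y * \1_(obox (- c n) (c n)) y) @[n --> \oo] --> (0 : R).
    have -> : (fun n => \int[mu]_y (f y * \1_(obox (- c n) (c n)) y)) = fun=> 0.
      apply/funext => n; rewrite -[RHS](f0 (- c n) (c n)) [RHS]Rintegral_mkcond.
      apply: eq_Rintegral => y _; rewrite /patch indicE.
      by case: ifP => _; rewrite ?mulr1 ?mulr0.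
    exact: cvg_cst.
  by rewrite -(cvg_lim (@Rhausdorff R) L) (cvg_lim (@Rhausdorff R) L0).
have all0 (A : set EB) : measurable A -> \int[mu]_(y in A) f y = 0.
  move=> mA; have : <<s oboxes >> A by rewrite -measurable_oboxes.
  move: A {mA}; apply: (@dynkin_induction _ EB oboxes
    (fun A : set EB => \int[mu]_(y in A) f y = 0) measurable_oboxes).
  - move=> _ _ [a [b ->]] [c [d ->]]; rewrite oboxI.
    by eexists; eexists.
  - exact: setT0.
  - by move=> _ [a [b ->]].
  - move=> S mS S0.
    have := @Rintegral_setU _ _ _ mu S (~` S) f mS (measurableC mS).
    by rewrite setUCr setT0 S0 add0r => <- //; apply/disj_setPLR; rewrite setCK.
  - move=> F mF tF F0; rewrite /Rintegral integral_bigcup //; last first.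
      by apply: iS; exact: bigcup_measurable.
    by rewrite eseries0 // => n _ _; exact: toE.
have h : ae_eq mu setT (EFin \o f) (cst 0%E).
  apply: integral_ae_eq => // A _ mA.
  by rewrite integral0; apply: toE => //; exact: all0.
by move: h; apply: aeS => y /(_ Logic.I) [].
Qed.

(** The bumps of a box converge boundedly to its indicator, which replaces mollification. The
    confinement to one box allows applications to functions that are integrable only locally. *)
Lemma test_orthogonal_eq0 (f : E -> R) (a b : E) : mu.-integrable setT (EFin \o f) ->
  (forall y, ~ obox a b y -> f y = 0) ->
  (forall psi, test_fun psi -> (forall y, ~ obox a b y -> psi y = 0) ->
     \int[mu]_y (f y * psi y) = 0) -> {ae mu, forall y, f y = 0}.
Proof.
move=> fi f0 fpsi; apply: Rintegral_oboxes_eq0 => // c d.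
have mf : measurable_fun [set: EB] f by apply/measurable_EFinP; exact: measurable_int fi.
set a' := (Num.max a.1.1 c.1.1, Num.max a.1.2 c.1.2, Num.max a.2 c.2) : E.
set b' := (Num.min b.1.1 d.1.1, Num.min b.1.2 d.1.2, Num.min b.2 d.2) : E.
have bE := oboxI a b c d; rewrite -/a' -/b' in bE.
have -> : \int[mu]_(y in obox c d) f y = \int[mu]_y (f y * \1_(obox a' b') y).
  rewrite [LHS]Rintegral_mkcond; apply: eq_Rintegral => y _.
  rewrite /patch indicE -bE in_setI.
  have [hy|ny] := pselect (obox a b y).
    by rewrite (mem_set hy) /=; case: ifP => _; rewrite ?mulr1 ?mulr0.
  by rewrite f0 // mul0r; case: ifP.
have L : \int[mu]_y (f y * bbox a' b' n y) @[n --> \oo] --> \int[mu]_y (f y * \1_(obox a' b') y).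
  apply: (@Rintegral_dominated _ _ _ _ (fun y => `|f y|)) => //.
  - by move=> n; apply: measurable_funM => //; apply: test_measurable; exact: bbox_test.
  - by apply: measurable_funM => //; apply: measurable_indic; exact: measurable_obox.
  - exact: integrable_norm.
  - move=> n y _; rewrite normrM -[leRHS]mulr1; apply: ler_pM => //.
    by rewrite ger0_norm ?bbox_ge0 ?bbox_le1.
  - move=> y _; rewrite indicE; have [hy|ny] := pselect (obox a' b' y).
      by rewrite mem_set //; apply: cvgMr; exact: bbox_cvg.
    rewrite memNset // mulr0.
    have -> : (fun n => f y * bbox a' b' n y) = fun=> 0.
      by apply/funext => n; rewrite bbox_out ?mulr0.
    exact: cvg_cst.
rewrite -(cvg_lim (@Rhausdorff R) L).
have -> : (fun n => \int[mu]_y (f y * bbox a' b' n y)) = fun=> 0.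
  apply/funext => n; apply: fpsi; first exact: bbox_test.
  by move=> y ny; apply: bbox_out; rewrite -bE => -[]; exact: (fun h _ => ny h).
by rewrite lim_cst.
Qed.

End density.

(** * Correlations and div-grad orthogonality *)

Section correlation.
Variable R : realType.
Local Notation E := (R * R * R)%type.
Local Notation EB :=
  (measurableTypeR R * measurableTypeR R * measurableTypeR R)%type.
Local Notation mu := (leb3 R).

Lemma L2on_integrable (D : set EB) (f : E -> R) : measurable D -> (mu D < +oo)%E ->
  L2on mu D f -> mu.-integrable D (EFin \o f).
Proof.
move=> mD Dfin [mf f2].
have i1 : mu.-integrable D (EFin \o (fun=> 1 : R)).
  apply: measurable_bounded_integrable => //.
  by exists 1; split; rewrite ?num_real // => x /ltW h y _ /=; rewrite normr1.
apply: (integrable_le mD mf (integrable_addR mD i1 f2)) => y _.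
rewrite ler_norml; have := sqr_ge0 (f y - 1); have := sqr_ge0 (f y + 1).
rewrite !expr2 => *; apply/andP; split; nra.
Qed.

(** Density by duality: the residual of the Hilbert projection on the test functions of the box is
    orthogonal to all of them, hence vanishes almost everywhere. *)
Lemma test_dense (a b : E) (f : E -> R) : L2on mu (obox a b) f ->
  forall e : R, 0 < e -> exists w, [/\ test_fun w, forall y, ~ obox a b y -> w y = 0 &
    ipL2 mu (obox a b) ((w : EB -> R) - f) ((w : EB -> R) - f) <= e].
Proof.
move=> Lf e e0; set D : set EB := obox a b.
have mD : measurable D by exact: measurable_obox.
have Dfin : (mu D < +oo)%E by exact: leb3_obox_lty.
pose W (w : EB -> R) := test_fun (w : E -> R) /\ forall y, ~ obox a b y -> w y = 0.
have WL w : W w -> L2on mu D w.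
  move=> [tw _]; have [r hr] := obox_cub a b; have [M hM] := test_bounded tw.
  have [_ h] := L2l_bounded (test_measurable tw) hM.
  split; first exact: test_measurable.
  by have [_] := h r; apply: integrableS => //; exact: measurable_cub.
have H := L2on_prehilbert mu mD.
have W0 : W 0 by split => //; exact: test0.
have WD w1 w2 : W w1 -> W w2 -> W (w1 + w2).
  move=> [t1 h1] [t2 h2]; split; first exact: test_add.
  by move=> y ny; rewrite -[LHS]/(w1 y + w2 y) h1 // h2 // addr0.
have WZ c w : W w -> W (c *: w).
  move=> [t1 h1]; split; first exact: test_scale.
  by move=> y ny; rewrite -[LHS]/(c * w y) h1 // mulr0.
have [w [p [Ww Lp wp fp]]] := hilbert_proj H (L2on_complete mD) WL W0 WD WZ Lf.
have Lfp : L2on mu D (f - p) by exact: (phB H).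
have [mfp _] := Lfp.
pose q : E -> R := fun y => (f - p) y * \1_D y.
have mq : measurable_fun [set: EB] q.
  by apply: measurable_funM => //; exact: measurable_indic.
have qE (h : E -> R) : \int[mu]_y (q y * h y) = \int[mu]_(y in D) ((f - p) y * h y).
  rewrite [RHS]Rintegral_mkcond; apply: eq_Rintegral => y _.
  by rewrite /q /patch indicE; case: ifP => _; rewrite ?mulr1 ?mulr0 ?mul0r.
have q0 : {ae mu, forall y, q y = 0}.
  apply: (@test_orthogonal_eq0 _ q a b).
  - have := L2on_integrable mD Dfin Lfp; rewrite (integrable_mkcond _ mD).
    apply: eq_integrable => // y _; rewrite /patch /q /= indicE.
    by case: ifP => _; rewrite ?mulr1 ?mulr0.
  - by move=> y ny; rewrite /q indicE memNset ?mulr0.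
  - by move=> psi tp hp; rewrite qE; exact: fp.
have aefp : {ae mu, forall y, D y -> f y = p y}.
  move: q0; apply: aeS => y; rewrite /q => h Dy; apply/eqP; rewrite -subr_eq0; apply/eqP.
  by move: h; rewrite indicE mem_set // mulr1.
have [N _ HN] : \forall n \near \oo, ipL2 mu D (w n - p) (w n - p) <= e.
  exact: (cvgr_le _ wp).
exists (w N); have [tw hw] := Ww N; split => //.
apply: le_trans (HN N (leqnn N)); rewrite le_eqVlt; apply/orP; left; apply/eqP.
have mw := test_measurable tw; have [mf _] := Lf; have [mp _] := Lp.
have aeh : {ae mu, forall y, D y -> ((w N : EB -> R) - f) y = ((w N : EB -> R) - p) y}.
  by move: aefp; apply: aeS => y h Dy; rewrite -[LHS]/(w N y - f y) h.
by apply: ae_ipL2 => //; exact: measurable_funB.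
Qed.

Lemma test_lip (w : E -> R) : test_fun w -> exists2 L : R, 0 <= L &
  forall (y t : E) (d : R), cub d t -> `|w (y + t) - w y| <= L * d.
Proof.
move=> tw.
have [M0 h0] := test_bounded (test_partial (@Ordinal 3 0 isT) tw).
have [M1 h1] := test_bounded (test_partial (@Ordinal 3 1 isT) tw).
have [M2 h2] := test_bounded (test_partial (@Ordinal 3 2 isT) tw).
have p0 : 0 <= M0 by exact: le_trans (h0 0).
have p1 : 0 <= M1 by exact: le_trans (h1 0).
have p2 : 0 <= M2 by exact: le_trans (h2 0).
exists (M0 + M1 + M2); first by rewrite !addr_ge0.
move=> y t d [d0 d1 d2].
set e0 := dirv R (@Ordinal 3 0 isT); set e1 := dirv R (@Ordinal 3 1 isT).
set e2 := dirv R (@Ordinal 3 2 isT).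
have tE : t = t.1.1 *: e0 + t.1.2 *: e1 + t.2 *: e2.
  case: t {d0 d1 d2} => [[t0 t1] t2].
  have sE (u v : R) : u *: v = u * v by [].
  by congr (_, _, _); rewrite /e0 /e1 /e2 /dirv /= !sE; ring.
have -> : w (y + t) - w y = (w (y + t.1.1 *: e0) - w y) +
   (w (y + t.1.1 *: e0 + t.1.2 *: e1) - w (y + t.1.1 *: e0)) +
   (w (y + t.1.1 *: e0 + t.1.2 *: e1 + t.2 *: e2) - w (y + t.1.1 *: e0 + t.1.2 *: e1)).
  by rewrite {1}tE !addrA; ring.
rewrite !mulrDl; apply: le_trans (ler_normD _ _) _; apply: lerD.
  apply: le_trans (ler_normD _ _) _; apply: lerD.
    by apply: le_trans (smooth_lip y t.1.1 tw.1 h0) _; exact: ler_wpM2l.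
  by apply: le_trans (smooth_lip _ t.1.2 tw.1 h1) _; exact: ler_wpM2l.
by apply: le_trans (smooth_lip _ t.2 tw.1 h2) _; exact: ler_wpM2l.
Qed.

Lemma L2l_on (D : set EB) (r : R) f : measurable D -> D `<=` cub r -> L2l f -> L2on mu D f.
Proof.
move=> mD Dr [mf h]; split => //; have [_] := h r.
by apply: integrableS => //; exact: measurable_cub.
Qed.

Lemma ipL2_mono (D1 D2 : set EB) (f : E -> R) : measurable D1 -> measurable D2 -> D1 `<=` D2 ->
  L2on mu D2 f -> ipL2 mu D1 f f <= ipL2 mu D2 f f.
Proof.
move=> m1 m2 D12 Lf; have [mf f2] := Lf.
have Lf1 : L2on mu D1 f by split => //; exact: (integrableS m2 m1 D12 f2).
rewrite -lee_fin !ipL2_EFin //; apply: ge0_subset_integral => //.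
- by apply/measurable_EFinP/measurable_funTS; exact: measurable_funX.
- by move=> y _; rewrite lee_fin sqr_ge0.
Qed.

Section lattice.
Variable g : 'I_3 -> E.
Hypothesis g_free : free [seq g i | i : 'I_3].

Definition corr (f h : E -> R) (t : E) : R := \int[mu]_(y in cell g) (f y * h (y + t)).

(** Continuity of translations in L^2: the restriction of [f] to the cell is replaced by a test
    function [w], the error being controlled by Cauchy-Schwarz; the shift is then moved from [h] to
    [w], which is Lipschitz. *)
Lemma corr_continuous f h : L2l f -> L2l h -> forall e : R, 0 < e ->
  exists2 d : R, 0 < d & forall t, cub d t -> `|corr f h t - corr f h 0| <= e.
Proof.
move=> Lf Lh e e0; have [r0 hr0] := cell_cub g_free.
pose a : E := (- (r0 + 1), - (r0 + 1), - (r0 + 1)).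
pose b : E := (r0 + 1, r0 + 1, r0 + 1).
set D : set EB := obox a b; pose rr := r0 + 2.
have mD : measurable D by exact: measurable_obox.
have cD : cell g `<=` D.
  by move=> y /hr0 [h0 h1 h2]; move: h0 h1 h2; rewrite !ler_norml => *; split; rewrite /a /b /=; lra.
have Dr : D `<=` cub (r0 + 1).
  move=> y [h0 h1 h2]; move: h0 h1 h2; rewrite /a /b /= => *.
  by split; rewrite ler_norml; lra.
have Drr : D `<=` cub rr by move=> y /Dr; apply: cubS; rewrite lerD2l; lra.
have mc := measurable_cell g_free.
have [mf _] := Lf; have [mh _] := Lh.
pose f1 : E -> R := fun y => f y * \1_(cell g) y.
have mf1 : measurable_fun [set: EB] f1.
  by apply: measurable_funM => //; exact: measurable_indic.
have Lf1 : L2on mu D f1.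
  split => //; have [_ f2] := L2l_on mD Drr Lf.
  apply: (integrable_le mD _ f2); first exact: measurable_funX.
  move=> y _; rewrite ger0_norm ?sqr_ge0 // /f1 indicE.
  by case: (_ \in _); rewrite ?mulr1 // mulr0 expr0n sqr_ge0.
have H := L2on_prehilbert mu mD.
pose A := ipL2 mu (cub rr) h h.
have mcr := measurable_cub rr.
have A0 : 0 <= A by apply: (ph_ge0 (L2on_prehilbert mu mcr)); exact: Lh.2.
(* [4 * A] bounds the squared norm of [h (y + t) - h y], so Cauchy-Schwarz leaves at most [e / 2];
   the added 1 covers [A = 0]. *)
pose e1 := (e / 2) ^+ 2 / (4 * A + 1).
have A1 : 0 < 4 * A + 1 by lra.
have e10 : 0 < e1 by rewrite divr_gt0 // exprn_gt0 // divr_gt0.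
have [w [tw w0 wle]] := test_dense Lf1 e10.
have mw := test_measurable tw.
have [L L0 hL] := test_lip tw.
have ih : mu.-integrable (cub rr) (EFin \o (fun y => `|h y|)).
  by apply: integrable_norm; exact: (L2l_loc_int Lh).2.
pose B := \int[mu]_(y in cub rr) `|h y|.
have B0 : 0 <= B by apply: Rintegral_ge0.
(* The bound 1 keeps the shifted box inside [cub rr]; the other one makes [L * d * B] at most
   [e / 2]. *)
pose d := Num.min 1 (e / (2 * (L * B + 1))).
have LB1 : 0 < L * B + 1 by rewrite ltr_wpDl // mulr_ge0.
have d0 : 0 < d by rewrite lt_min ltr01 /= divr_gt0 // mulr_gt0.
exists d => // t ct.
have d1 : d <= 1 by rewrite ge_min lexx.
have Lht : L2l (fun y => h (y + t)) by exact: L2l_shift.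
have mht := Lht.1.
have corrE s : corr f h s = \int[mu]_(y in D) (f1 y * h (y + s)).
  rewrite /corr [LHS]Rintegral_mkcond [RHS]Rintegral_mkcond; apply: eq_Rintegral => y _.
  rewrite /patch /f1 indicE; have [cy|cy] := boolP (y \in cell g).
    by rewrite mulr1 mem_set //; apply: cD; exact: set_mem.
  by rewrite mulr0 mul0r; case: ifP.
pose k : EB -> R := fun y => h (y + t) - h y.
have Lk : L2on mu D k.
  by apply: (phB H); [exact: (L2l_on mD Drr Lht)|exact: (L2l_on mD Drr Lh)].
have Lw : L2on mu D w.
  have [M hM] := test_bounded tw.
  exact: (L2l_on mD Drr (L2l_bounded mw hM)).
have Lwf : L2on mu D ((w : EB -> R) - f1) by exact: (phB H).
have E1 : corr f h t - corr f h 0 = ipL2 mu D w k - ipL2 mu D ((w : EB -> R) - f1) k.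
  rewrite (phBl H) // opprB addrCA subrr addr0 !corrE.
  rewrite -RintegralB //; last 2 first.
  - exact: (L2on_mul mD Lf1 (L2l_on mD Drr Lht)).
  - have := L2on_mul mD Lf1 (L2l_on mD Drr Lh); apply: eq_integrable => // y _ /=.
    by rewrite addr0.
  by apply: eq_Rintegral => y _; rewrite addr0 -mulrBr.
have kA : ipL2 mu D k k <= 4 * A.
  have := ph_tri2 H (L2l_on mD Drr Lht) (phN H (L2l_on mD Drr Lh)).
  have -> : ipL2 mu D (- (h : EB -> R)) (- (h : EB -> R)) = ipL2 mu D h h.
    by apply: eq_Rintegral => y _; rewrite -[(- (h : EB -> R)) y]/(- h y) mulrNN.
  move=> hk; apply: le_trans hk _.
  have h1 : ipL2 mu D h h <= A by apply: ipL2_mono => //; exact: Lh.2.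
  have h2 : ipL2 mu D (fun y => h (y + t)) (fun y => h (y + t)) <= A.
    have -> : A = \int[mu]_y ((h y) ^+ 2 * \1_(cub rr) y).
      rewrite /A /ipL2 [LHS]Rintegral_mkcond; apply: eq_Rintegral => y _.
      by rewrite /patch indicE -expr2; case: ifP => _; rewrite ?mulr1 ?mulr0.
    have mi : measurable_fun [set: EB] (fun y => h y ^+ 2 * \1_(cub rr) y).
      by apply: measurable_funM; [exact: measurable_funX|exact: measurable_indic].
    have ii : mu.-integrable setT (EFin \o (fun y => h y ^+ 2 * \1_(cub rr) y)).
      have [_] := Lh.2 rr; rewrite (integrable_mkcond _ mcr); apply: eq_integrable => // y _.
      by rewrite /patch /= indicE; case: ifP => _; rewrite ?mulr1 ?mulr0.
    have ii2 := mpres_integrable (leb3_shift t) mi ii.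
    rewrite -(mpres_Rintegral (leb3_shift t) mi) /ipL2 [leLHS]Rintegral_mkcond.
    apply: le_Rintegral => //.
      have := L2on_mul mD (L2l_on mD Drr Lht) (L2l_on mD Drr Lht).
      rewrite (integrable_mkcond _ mD); apply: eq_integrable => // y _.
      by rewrite /patch /=; case: ifP.
    move=> y _; rewrite /patch; case: ifPn => [/set_mem Dy|_].
      rewrite indicE mem_set ?mulr1 ?expr2 //.
      have -> : rr = (r0 + 1) + 1 by rewrite /rr; ring.
      by apply: cubD; [exact: Dr|exact: cubS ct].
    by rewrite mulr_ge0 ?sqr_ge0 // indicE; case: (_ \in _).
  lra.
have b1 : `|ipL2 mu D ((w : EB -> R) - f1) k| <= e / 2.
  have e2 : 0 <= e / 2 by lra.
  rewrite -ler_sqr ?nnegrE ?normr_ge0 // real_normK ?num_real //.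
  apply: le_trans (ph_csq H Lwf Lk) _.
  apply: (@le_trans _ _ (e1 * (4 * A))).
    by apply: ler_pM => //; [exact: (ph_ge0 H)|exact: (ph_ge0 H)].
  rewrite /e1 mulrAC ler_pdivrMr //; apply: ler_wpM2l; first exact: sqr_ge0.
  lra.
have b2 : `|ipL2 mu D w k| <= e / 2.
  have Lhw : ipL2 mu D w k = \int[mu]_(y in cub rr) (h y * (w (y - t) - w y)).
    have [M hM] := test_bounded tw.
    have [rD hrD] := obox_cub a b.
    have bw : bsupp (r0 + 1) w by move=> y ny; apply: w0 => /Dr.
    have mws : measurable_fun [set: EB] (fun y : E => w (y - t)) by exact: measurable_lat.
    have bws : bsupp rr (fun y : E => w (y - t)).
      move=> y ny; apply: bw => h1; apply: ny; rewrite -[y](subrK t).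
      have -> : rr = (r0 + 1) + 1 by rewrite /rr; ring.
      by apply: cubD => //; exact: cubS ct.
    have i1 : mu.-integrable setT (EFin \o (fun y => h y * w y)).
      exact: (loc_int_mul (L2l_loc_int Lh) mw hM bw).
    have i2 : mu.-integrable setT (EFin \o (fun y => h y * w (y - t))).
      exact: (loc_int_mul (L2l_loc_int Lh) mws (fun y => hM _) bws).
    have mhw : measurable_fun [set: EB] (fun y : E => h y * w (y - t)).
      exact: measurable_funM.
    have i3 := mpres_integrable (leb3_shift t) mhw i2.
    have -> : ipL2 mu D w k = \int[mu]_y (h (y + t) * w y - h y * w y).
      rewrite /ipL2 [LHS]Rintegral_mkcond; apply: eq_Rintegral => y _.
      rewrite /patch; case: ifPn => [_|]; first by rewrite /k; ring.
      by rewrite notin_setE => /w0 ->; rewrite !mulr0 subr0.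
    rewrite RintegralB //; last first.
      by move: i3; apply: eq_integrable => // y _ /=; rewrite addrK.
    have -> : \int[mu]_y (h (y + t) * w y) = \int[mu]_y (h y * w (y - t)).
      rewrite -[RHS](mpres_Rintegral (leb3_shift t) mhw).
      by apply: eq_Rintegral => y _; rewrite addrK.
    rewrite -RintegralB // (bsupp_Rintegral (r := rr)); last 2 first.
    - by apply: measurable_funB => //; exact: measurable_funM.
    - move=> y ny; rewrite bws // (bsuppS _ bw ny) ?mulr0 ?subrr //.
      by rewrite /rr lerD2l; lra.
    by apply: eq_Rintegral => y _; rewrite mulrBr.
  have mdif : measurable_fun [set: EB] (fun y : E => w (y - t) - w y).
    by apply: measurable_funB => //; exact: measurable_lat.
  have bdif (y : E) : `|w (y - t) - w y| <= L * d by apply: hL; apply/cubN.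
  rewrite Lhw.
  have ihw : mu.-integrable (cub rr) (EFin \o (fun y => h y * (w (y - t) - w y))).
    exact: (loc_int_mul_bounded (L2l_loc_int Lh) mdif bdif).2.
  apply: le_trans (le_normr_Rintegral mcr ihw) _.
  apply: (@le_trans _ _ (\int[mu]_(y in cub rr) (L * d * `|h y|))).
    apply: le_Rintegral => //.
    - exact: integrable_norm.
    - exact: integrable_scaleR.
    - by move=> y _; rewrite normrM mulrC; apply: ler_wpM2r.
  rewrite RintegralZl // -/B.
  have -> : L * d * B = d * (L * B) by ring.
  apply: (@le_trans _ _ (d * (L * B + 1))).
    by apply: ler_wpM2l; [exact: ltW|rewrite lerDl].
  rewrite -ler_pdivlMr // /d; apply: (@le_trans _ _ (e / (2 * (L * B + 1)))).
    by rewrite ge_min lexx orbT.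
  by rewrite invfM mulrA.
rewrite E1; apply: le_trans (ler_normB _ _) _.
by rewrite (splitr e); apply: lerD.
Qed.

End lattice.
End correlation.

(** * Fubini's theorem for correlations *)

Section fubini.
Variable R : realType.
Local Notation E := (R * R * R)%type.
Local Notation EB :=
  (measurableTypeR R * measurableTypeR R * measurableTypeR R)%type.
Local Notation mu := (leb3 R).
Local Notation mus := (leb3s R).

Lemma leb3_obox (a b : E) : a.1.1 < b.1.1 -> a.1.2 < b.1.2 -> a.2 < b.2 ->
  mu (obox a b) = ((b.1.1 - a.1.1) * (b.1.2 - a.1.2) * (b.2 - a.2))%:E.
Proof.
move=> h1 h2 h3; rewrite oboxE.
set I1 : set (measurableTypeR R) := [set` `]a.1.1, b.1.1[%R].
set I2 : set (measurableTypeR R) := [set` `]a.1.2, b.1.2[%R].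
set I3 : set (measurableTypeR R) := [set` `]a.2, b.2[%R].
have m1 : measurable I1 by exact: measurable_itv.
have m2 : measurable I2 by exact: measurable_itv.
have m3 : measurable I3 by exact: measurable_itv.
have E1 := @product_measure1E _ _ _ _ R
  (prod_sfm (@lebesgue_measure R) (@lebesgue_measure R)) (@lebesgue_measure R) _ _ (measurableX m1 m2) m3.
have E2 := @product_measure1E _ _ _ _ R (@lebesgue_measure R) (@lebesgue_measure R) _ _ m1 m2.
have -> : mu (I1 `*` I2 `*` I3) =
  (@lebesgue_measure R I1 * @lebesgue_measure R I2 * @lebesgue_measure R I3)%E.
  by rewrite -E2; exact: E1.
by rewrite !lebesgue_measure_itv /= !lte_fin h1 h2 h3 -!EFinD -!EFinM.
Qed.

(** Real-valued integrals send infinite values to 0; integrability of every section makes the inner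
    real integrals agree with the extended ones at each point. *)
Lemma Rfubini (c : EB * EB -> R) :
  (mus \x mus)%E.-integrable setT (EFin \o c) ->
  (forall x, mu.-integrable setT (EFin \o (fun y => c (x, y)))) ->
  (forall y, mu.-integrable setT (EFin \o (fun x => c (x, y)))) ->
  [/\ mu.-integrable setT (EFin \o (fun x => \int[mu]_y c (x, y))),
      mu.-integrable setT (EFin \o (fun y => \int[mu]_x c (x, y))) &
      \int[mu]_x (\int[mu]_y c (x, y)) = \int[mu]_y (\int[mu]_x c (x, y))].
Proof.
move=> ic ix iy.
have Fx x : (\int[mu]_y c (x, y))%:E = (\int[mus]_y (c (x, y))%:E)%E.
  by rewrite /Rintegral fineK //; exact: (integrable_fin_num measurableT (ix x)).
have Fy y : (\int[mu]_x c (x, y))%:E = (\int[mus]_x (c (x, y))%:E)%E.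
  by rewrite /Rintegral fineK //; exact: (integrable_fin_num measurableT (iy y)).
have I1 := @integrable_fubini_F _ _ _ _ _ mus mus _ ic.
have I2 : mus.-integrable setT (fubini_G mus (EFin \o c)).
  have mc := measurable_int _ ic.
  have mG := @measurable_fubini_G _ _ _ _ _ mus mus _ ic.
  apply/integrableP; split => //.
  apply: le_lt_trans ((@integrable21ltyP _ _ _ _ _ mus mus _ mc).1 ic).
  apply: ge0_le_integral => //.
  - exact: measurableT_comp.
  - apply: (@measurable_fun_fubini_tonelli_G _ _ _ _ _ mus (fun p => `|(c p)%:E|%E)) => //.
    exact: measurableT_comp.
  - move=> y _; apply: le_abse_integral => //.
    exact: (measurable_int _ (iy y)).
split.
- by move: I1; apply: eq_integrable => // x _; rewrite /= Fx.
- by move: I2; apply: eq_integrable => // y _; rewrite /= Fy.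
have Fub := @Fubini _ _ _ _ _ mus mus _ ic.
rewrite /Rintegral; congr fine.
transitivity (\int[mus]_x \int[mus]_y ((EFin \o c) (x, y)))%E.
  by apply: eq_integral => x _; exact: Fx.
by rewrite Fub; apply: eq_integral => y _; exact/esym/Fy.
Qed.

Lemma measurable_affine2 (e : R) :
  measurable_fun [set: EB * EB] (fun p : EB * EB => (p.1 : E) + e *: (p.2 : E) : EB).
Proof.
have m1 : measurable_fun [set: EB * EB] (fun p : EB * EB => p.1.1.1).
  by apply: measurableT_comp => //; apply: measurableT_comp.
have m2 : measurable_fun [set: EB * EB] (fun p : EB * EB => p.1.1.2).
  by apply: measurableT_comp => //; apply: measurableT_comp.
have m3 : measurable_fun [set: EB * EB] (fun p : EB * EB => p.1.2).
  by apply: measurableT_comp.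
have n1 : measurable_fun [set: EB * EB] (fun p : EB * EB => p.2.1.1).
  by apply: measurableT_comp => //; apply: measurableT_comp.
have n2 : measurable_fun [set: EB * EB] (fun p : EB * EB => p.2.1.2).
  by apply: measurableT_comp => //; apply: measurableT_comp.
have n3 : measurable_fun [set: EB * EB] (fun p : EB * EB => p.2.2).
  by apply: measurableT_comp.
apply: (measurable_fun_pair (f := fun p : EB * EB =>
   (p.1.1.1 + e * p.2.1.1, p.1.1.2 + e * p.2.1.2) : measurableTypeR R * measurableTypeR R)
   (g := fun p : EB * EB => p.1.2 + e * p.2.2 : measurableTypeR R)).
  apply: (measurable_fun_pair (f := fun p : EB * EB => p.1.1.1 + e * p.2.1.1 : measurableTypeR R)
    (g := fun p : EB * EB => p.1.1.2 + e * p.2.1.2 : measurableTypeR R)).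
    by apply: measurable_funD => //; apply: measurable_funM.
  by apply: measurable_funD => //; apply: measurable_funM.
by apply: measurable_funD => //; apply: measurable_funM.
Qed.

Section lattice.
Variable g : 'I_3 -> E.
Hypothesis g_free : free [seq g i | i : 'I_3].
Local Notation Y := (cell g).

(** The sign [e] serves the correlation and, after [corr_swap], the correlation with exchanged
    factors at the opposite shift. *)
Lemma corr_fubini (k f h : E -> R) (r M e : R) : e = 1 \/ e = -1 ->
  measurable_fun [set: EB] k -> (forall t, `|k t| <= M) -> bsupp r k ->
  L2l f -> L2l h ->
  [/\ mu.-integrable setT (EFin \o (fun t => k t * corr g f h (e *: t))),
      mu.-integrable Y (EFin \o (fun y => f y * \int[mu]_t (k t * h (y + e *: t)))) &
      \int[mu]_t (k t * corr g f h (e *: t)) =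
      \int[mu]_(y in Y) (f y * \int[mu]_t (k t * h (y + e *: t)))].
Proof.
move=> e1 mk kM bk Lf Lh; have mY := measurable_cell g_free.
have [r0 hr0] := cell_cub g_free.
have [mf _] := Lf; have [mh _] := Lh.
have M0 : 0 <= M by exact: le_trans (kM 0).
pose f1 : E -> R := fun y => f y * \1_Y y.
have mf1 : measurable_fun [set: EB] f1.
  by apply: measurable_funM => //; exact: measurable_indic.
have if1 : mu.-integrable setT (EFin \o f1).
  have := integrable_cell g_free (L2l_loc_int Lf); rewrite (integrable_mkcond _ mY).
  apply: eq_integrable => // y _; rewrite /patch /f1 /= indicE.
  by case: ifP => _; rewrite ?mulr1 ?mulr0.
pose c (p : EB * EB) : R := f1 p.1 * (k p.2 * h ((p.1 : E) + e *: (p.2 : E))).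
have mc : measurable_fun [set: EB * EB] c.
  apply: measurable_funM; first by apply: (measurableT_comp mf1).
  apply: measurable_funM; first by apply: (measurableT_comp mk).
  by apply: (measurableT_comp mh); exact: measurable_affine2.
have Lhy y : L2l (fun t => h (y + e *: t)) by exact: L2l_affine.
have iy y : mu.-integrable setT (EFin \o (fun t => k t * h (y + e *: t))).
  have := loc_int_mul (L2l_loc_int (Lhy y)) mk kM bk.
  by apply: eq_integrable => // t _ /=; rewrite mulrC.
have ix y : mu.-integrable setT (EFin \o (fun t => c (y, t))).
  by have := integrable_scaleR measurableT (f1 y) (iy y).
have it t : mu.-integrable setT (EFin \o (fun y => c (y, t))).
  have := L2l_mul Lf (L2l_shift (e *: t) Lh).
  move=> /(integrable_cell g_free) /(integrable_scaleR mY (k t)).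
  rewrite (integrable_mkcond _ mY); apply: eq_integrable => // y _.
  rewrite /patch /c /f1 /= indicE; case: ifP => _; last by rewrite mulr0 mul0r.
  by congr EFin; rewrite mulr1; ring.
(* For [y] in the cell and [t] in the support of [k], the argument of [h] stays in this cube; [C]
   thus bounds the inner integrals uniformly and gives joint integrability. *)
pose C := M * \int[mu]_(y in cub (r0 + r)) `|h y|.
have ih : mu.-integrable (cub (r0 + r)) (EFin \o (fun y => `|h y|)).
  by apply: integrable_norm; exact: (L2l_loc_int Lh).2.
have hC y : Y y -> \int[mu]_t `|k t * h (y + e *: t)| <= C.
  move=> Yy; pose H z := `|h z| * \1_(cub (r0 + r)) z.
  have mH : measurable_fun [set: EB] H.
    apply: measurable_funM; first exact: measurableT_comp.
    by apply: measurable_indic; exact: measurable_cub.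
  have iH : mu.-integrable setT (EFin \o H).
    move: ih; rewrite (integrable_mkcond _ (measurable_cub _)); apply: eq_integrable => // z _.
    by rewrite /patch /H /= indicE; case: ifP => _; rewrite ?mulr1 ?mulr0.
  have H0 z : 0 <= H z by apply: mulr_ge0 => //; rewrite indicE; case: (_ \in _).
  have mp := leb3_mpres y e1.
  have -> : C = \int[mu]_t (M * H (y + e *: t)).
    have iH2 := mpres_integrable mp mH iH.
    rewrite RintegralZl // (mpres_Rintegral mp mH); congr (_ * _).
    rewrite [LHS]Rintegral_mkcond; apply: eq_Rintegral => z _.
    by rewrite /patch /H indicE; case: ifP => _; rewrite ?mulr1 ?mulr0.
  apply: le_Rintegral => //.
  - exact: integrable_norm.
  - apply: integrable_scaleR => //; exact: (mpres_integrable mp mH iH).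
  move=> t _; rewrite normrM.
  have [ct|nt] := pselect (cub r t); last first.
    by rewrite bk // normr0 mul0r mulr_ge0.
  have cz : cub (r0 + r) (y + e *: t).
    apply: cubD; first exact: hr0.
    by case: e1 => ->; [rewrite scale1r|rewrite scaleN1r; apply/cubN].
  by rewrite /H indicE (mem_set cz) mulr1; apply: ler_wpM2r.
have C0 : 0 <= C by rewrite mulr_ge0 // Rintegral_ge0.
have ic : (mus \x mus)%E.-integrable setT (EFin \o c).
  apply/integrable12ltyP; first exact/measurable_EFinP.
  apply: (@le_lt_trans _ _ (\int[mus]_y (`|f1 y| * C)%:E)%E).
    apply: ge0_le_integral => //.
    - by move=> y _; exact: integral_ge0.
    - apply: (@measurable_fun_fubini_tonelli_F _ _ _ _ _ mus (fun p => `|(c p)%:E|%E)) => //.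
      by apply: measurableT_comp => //; exact/measurable_EFinP.
    - apply/measurable_EFinP; apply: measurable_funM => //.
      exact: measurableT_comp.
    move=> y _.
    have -> : (\int[mus]_t `|(EFin \o c) (y, t)|)%E = (`|f1 y| * \int[mu]_t `|k t * h (y + e *: t)|)%:E.
      have iyn := integrable_norm (iy y).
      rewrite -RintegralZl // /Rintegral fineK; last first.
        by apply: integrable_fin_num => //; exact: integrable_scaleR.
      by apply: eq_integral => t _; rewrite /= /c normrM.
    rewrite lee_fin; have [Yy|nY] := pselect (Y y).
      by apply: ler_wpM2l => //; exact: hC.
    by rewrite /f1 indicE memNset // mulr0 normr0 !mul0r.
  have := integrable_scaleR measurableT C (integrable_norm if1).
  move=> /(integrable_lty measurableT); apply: le_lt_trans.
  rewrite le_eqVlt; apply/orP; left; apply/eqP; apply: eq_integral => y _ /=.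
  by rewrite mulrC.
have [I1 I2 I3] := Rfubini ic ix it.
have E1 t : \int[mu]_y c (y, t) = k t * corr g f h (e *: t).
  have := integrable_cell g_free (L2l_mul Lf (L2l_shift (e *: t) Lh)) => i1.
  rewrite /corr -(RintegralZl _ mY i1) [RHS]Rintegral_mkcond; apply: eq_Rintegral => y _.
  rewrite /patch /c /f1 /= indicE; case: ifP => _; last by rewrite mulr0 mul0r.
  by rewrite mulr1; ring.
have E2 y : \int[mu]_t c (y, t) = (fun y => f y * \int[mu]_t (k t * h (y + e *: t))) y * \1_Y y.
  transitivity (f1 y * \int[mu]_t (k t * h (y + e *: t))).
    exact: (RintegralZl (f1 y) measurableT (iy y)).
  by rewrite /f1 /=; ring.
split.
- by move: I2; apply: (eq_integrable measurableT) => t _; rewrite /= E1.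
- rewrite (integrable_mkcond _ mY); move: I1; apply: (eq_integrable measurableT) => y _.
  by rewrite /= E2 /patch indicE; case: ifP => _; rewrite ?mulr1 ?mulr0.
have -> : \int[mu]_t (k t * corr g f h (e *: t)) = \int[mu]_t \int[mu]_y c (y, t).
  by apply: eq_Rintegral => t _; rewrite E1.
rewrite -I3 [RHS]Rintegral_mkcond; apply: eq_Rintegral => y _.
by rewrite E2 /patch indicE; case: ifP => _; rewrite ?mulr1 ?mulr0.
Qed.

Lemma corr_swap f h t : L2l f -> L2l h -> Defs.periodic g f -> Defs.periodic g h ->
  corr g f h t = corr g h f (- t).
Proof.
move=> Lf Lh pf ph; rewrite /corr.
have L := L2l_mul Lf (L2l_shift t Lh).
rewrite -(shift_cell g_free (- t) L); last first.
  move=> s ls; have := ph s ls => /(mpres_ae (leb3_shift t)).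
  move: (pf s ls); apply: aeS2 => y h1 h2; rewrite h1; congr (_ * _).
  by rewrite -h2 addrAC.
by apply: eq_Rintegral => y _; rewrite subrK mulrC.
Qed.

End lattice.
End fubini.

(** * Divergence-free fields against periodic gradients *)

Section orthogonality.
Variable R : realType.
Local Notation E := (R * R * R)%type.
Local Notation EB :=
  (measurableTypeR R * measurableTypeR R * measurableTypeR R)%type.
Local Notation mu := (leb3 R).
Variable g : 'I_3 -> E.
Hypothesis g_free : free [seq g i | i : 'I_3].
Local Notation Y := (cell g).
Variables (m : 'I_3 -> 'I_3 -> E -> R) (v : 'I_3 -> E -> R) (G : 'I_3 -> 'I_3 -> E -> R).
Hypotheses (Lm : forall i j, L2l (m i j)) (Lv : forall i, L2l (v i))
  (LG : forall i j, L2l (G i j)).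
Hypotheses (pm : forall i j, Defs.periodic g (m i j)) (pv : forall i, Defs.periodic g (v i)).
Hypothesis div_m : forall psi, test_fun psi -> forall i, \sum_j dpartial j (m i j) psi = 0.
Hypothesis grad_v : forall psi, test_fun psi -> forall i j,
  dpartial j (v i) psi = \int[mu]_y (G i j y * psi y).

Lemma derive_bbox_affine a b n (c z : E) (e : R) j :
  'D_(dirv R j) (fun y => bbox a b n (c + e *: y)) z =
  e * 'D_(dirv R j) (bbox a b n) (c + e *: z).
Proof.
have [f' _ D] := smoothE_derive j (bbox_smooth a b n).
have [_ ->] := D (c + e *: z).
by have [_ ->] := is_derive_affine (D (c + e *: z)).
Qed.

(* The inner integral is the derivative of the translate [bbox (c + e *: y)]. *)
Lemma corr_bbox_zero a b n : \int[mu]_t (bbox a b n t * \sum_i \sum_j corr g (m i j) (G i j) t) = 0.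
Proof.
pose rho := bbox a b n; have trho : test_fun rho by exact: bbox_test.
have [Mr hMr] := test_bounded trho; have [r br] := test_bsupp trho.
have mrho := test_measurable trho.
pose k j : E -> R := 'D_(dirv R j) rho.
have tk j : test_fun (k j) by exact: test_partial.
have n1 : (1 : R) = 1 \/ (1 : R) = -1 by left.
have nN1 : (-1 : R) = 1 \/ (-1 : R) = -1 by right.
have F1 i j := corr_fubini g_free n1 mrho hMr br (Lm i j) (LG i j).
have bk j : bsupp r (k j) by exact: bsupp_partial.
(* The weak gradient of [v] is tested against the translate of [rho] by [y]. *)
have inner i j y : \int[mu]_t (rho t * G i j (y + 1 *: t)) =
    - \int[mu]_t (k j t * v i (y + 1 *: t)).
  have tr : test_fun (fun z => rho (- y + 1 *: z)) by exact: test_affine.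
  have -> : \int[mu]_t (rho t * G i j (y + 1 *: t)) =
      \int[mu]_z (G i j z * rho (- y + 1 *: z)).
    rewrite -[RHS](mpres_Rintegral (leb3_shift y)); last first.
      by apply: measurable_funM; [exact: (LG i j).1|exact: test_measurable].
    by apply: eq_Rintegral => t _; rewrite !scale1r [t + y]addrC addKr mulrC.
  rewrite -grad_v // /dpartial; congr (- _).
  rewrite -[LHS](mpres_Rintegral (leb3_shift y)); last first.
    apply: measurable_funM; first exact: (Lv i).1.
    by apply: test_measurable; exact: test_partial.
  apply: eq_Rintegral => t _; rewrite derive_bbox_affine mul1r.
  by rewrite !scale1r [t + y]addrC addKr mulrC.
(* The divergence of [m] is tested against [rho] reflected through [y]; the reflection only changes
   the sign of the derivatives. *)
have inner2 i y : \sum_j \int[mu]_t (k j t * m i j (y + (-1) *: t)) = 0.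
  have tr : test_fun (fun z => rho (y + (-1) *: z)) by exact: test_affine.
  rewrite -[RHS](div_m tr i); apply: eq_bigr => j _; rewrite /dpartial.
  have mp := leb3_refl y.
  have mmk : measurable_fun [set: EB] (fun z => m i j z * 'D_(dirv R j) (fun z => rho (y + (-1) *: z)) z).
    apply: measurable_funM; first exact: (Lm i j).1.
    by apply: test_measurable; exact: test_partial.
  rewrite -(mpres_Rintegral mp mmk) -[RHS]mulN1r -[RHS]RintegralZl //; last first.
    apply: (mpres_integrable mp mmk).
    have [r2 b2] := test_bsupp (test_partial j tr).
    have [M2 h2] := test_bounded (test_partial j tr).
    exact: (loc_int_mul (L2l_loc_int (Lm i j)) (test_measurable (test_partial j tr)) h2 b2).
  apply: eq_Rintegral => t _; rewrite derive_bbox_affine !scaleN1r opprB addrCA subrr addr0.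
  by rewrite /k; ring.
have H2 i j : exists Mk : R, forall t : E, `|k j t| <= Mk by exact: test_bounded.
have F2 i j : \int[mu]_t (k j t * corr g (m i j) (v i) (1 *: t)) =
    \int[mu]_(y in Y) (m i j y * \int[mu]_t (k j t * v i (y + 1 *: t))).
  have [Mk hk] := test_bounded (tk j).
  by have [] := corr_fubini g_free n1 (test_measurable (tk j)) hk (bk j) (Lm i j) (Lv i).
(* Exchanging the factors of the correlation puts [m] inside the integral over [t], so that the
   derivative of the bump finally falls on [m]. *)
have F3 i j : \int[mu]_t (k j t * corr g (m i j) (v i) (1 *: t)) =
    \int[mu]_(y in Y) (v i y * \int[mu]_t (k j t * m i j (y + (-1) *: t))).
  have [Mk hk] := test_bounded (tk j).
  have [_ _ <-] := corr_fubini g_free nN1 (test_measurable (tk j)) hk (bk j) (Lv i) (Lm i j).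
  by apply: eq_Rintegral => t _; rewrite (corr_swap g_free) // scale1r scaleN1r.
have i3 i j : mu.-integrable Y (EFin \o (fun y => v i y * \int[mu]_t (k j t * m i j (y + (-1) *: t)))).
  have [Mk hk] := test_bounded (tk j).
  by have [] := corr_fubini g_free nN1 (test_measurable (tk j)) hk (bk j) (Lv i) (Lm i j).
have mY := measurable_cell g_free.
have i1 i j : mu.-integrable setT (EFin \o (fun t => rho t * corr g (m i j) (G i j) t)).
  have [h _ _] := F1 i j; move: h; apply: eq_integrable => // t _ /=.
  by rewrite scale1r.
have i2 i j : mu.-integrable Y (EFin \o (fun y => m i j y * \int[mu]_t (k j t * v i (y + 1 *: t)))).
  have [Mk hk] := test_bounded (tk j).
  by have [] := corr_fubini g_free n1 (test_measurable (tk j)) hk (bk j) (Lm i j) (Lv i).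
transitivity (\sum_i \sum_j \int[mu]_t (rho t * corr g (m i j) (G i j) t)).
  have is_ i : mu.-integrable setT (EFin \o (fun t => \sum_j rho t * corr g (m i j) (G i j) t)).
    have := integrable_sum measurableT (index_enum 'I_3) (P := xpredT) (fun j _ => i1 i j).
    by apply: eq_integrable => // t _; rewrite /= sumEFin.
  rewrite (eq_bigr (fun i => \int[mu]_t (\sum_j rho t * corr g (m i j) (G i j) t))); last first.
    by move=> i _; rewrite (Rintegral_sum _ measurableT (i1 i)).
  rewrite -(Rintegral_sum _ measurableT is_); apply: eq_Rintegral => t _.
  by rewrite big_distrr /=; apply: eq_bigr => i _; rewrite big_distrr.
rewrite big1 // => i _.
transitivity (\sum_j - \int[mu]_(y in Y) (v i y * \int[mu]_t (k j t * m i j (y + (-1) *: t)))).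
  apply: eq_bigr => j _; have [_ _ h] := F1 i j.
  transitivity (\int[mu]_t (rho t * corr g (m i j) (G i j) (1 *: t))).
    by apply: eq_Rintegral => t _; rewrite scale1r.
  rewrite h -F3 F2 -[RHS]mulN1r -(RintegralZl (-1) mY (i2 i j)).
  by apply: eq_Rintegral => y _; rewrite inner; ring.
rewrite sumrN -(Rintegral_sum _ mY (i3 i)).
rewrite (_ : \int[mu]_(y in Y) _ = \int[mu]_(y in Y) (0 : R)).
  by rewrite Rintegral_cst // mul0r oppr0.
by apply: eq_Rintegral => y _; rewrite -big_distrr /= inner2 mulr0.
Qed.

Lemma div_grad_orthogonal : \sum_i \sum_j \int[mu]_(y in Y) (m i j y * G i j y) = 0.
Proof.
pose F t := \sum_i \sum_j corr g (m i j) (G i j) t.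
have F0E : \sum_i \sum_j \int[mu]_(y in Y) (m i j y * G i j y) = F 0.
  by do 2 (apply: eq_bigr => ? _); rewrite /corr; apply: eq_Rintegral => y _; rewrite addr0.
rewrite F0E; apply/eqP; apply: contraT => F0.
have e0 : 0 < `|F 0| / 2 by rewrite divr_gt0 ?normr_gt0.
(* Nine is the number of pairs [(i, j)] in the sum [F]. *)
have e9 : 0 < `|F 0| / 2 / 9 by rewrite divr_gt0.
have /choice [dd hdd] : forall ij : 'I_3 * 'I_3, exists d : R, 0 < d /\
    forall t, cub d t -> `|corr g (m ij.1 ij.2) (G ij.1 ij.2) t - corr g (m ij.1 ij.2) (G ij.1 ij.2) 0|
       <= `|F 0| / 2 / 9.
  move=> [i j] /=; have [d d0 hd] := corr_continuous g_free (Lm i j) (LG i j) e9.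
  by exists d.
pose d : R := \big[Num.min/(1 : R)]_(ij : 'I_3 * 'I_3) dd ij.
have d0 : 0 < d.
  apply: (big_ind (fun x : R => 0 < x)); first exact: ltr01.
  - by move=> x y x0 y0; rewrite lt_min x0.
  - by move=> ij _; case: (hdd ij).
have dle ij : d <= dd ij by exact: bigmin_le_cond.
have Fd t : cub d t -> `|F t - F 0| <= `|F 0| / 2.
  move=> ct; rewrite /F -sumrB.
  under eq_bigr do rewrite -sumrB.
  rewrite pair_big /=; apply: le_trans (ler_norm_sum _ _ _) _.
  apply: (@le_trans _ _ (\sum_(ij : 'I_3 * 'I_3) (`|F 0| / 2 / 9))).
    apply: ler_sum => ij _; have [_] := hdd ij; apply.
    exact: cubS (dle ij) _ ct.
  rewrite sumr_const card_prod card_ord -mulr_natr.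
  by rewrite le_eqVlt; apply/orP; left; apply/eqP; field.
(* Every bump of the sequence is positive on its whole box. On this box [F] differs from [F 0] by at
   most half of its absolute value, so a nonzero [F 0] would make the integral of [rho * F]
   nonzero. *)
pose rho := bbox (- d, - d, - d) (d, d, d) 0.
have trho : test_fun rho by exact: bbox_test.
have ocub : obox (- d, - d, - d) (d, d, d) `<=` cub d.
  by move=> t [h1 h2 h3]; move: h1 h2 h3 => /= *; split; rewrite ler_norml; lra.
have [M hM] := test_bounded trho; have [r br] := test_bsupp trho.
have n1 : (1 : R) = 1 \/ (1 : R) = -1 by left.
have irF : mu.-integrable setT (EFin \o (fun t => rho t * F t)).
  have i1 i j : mu.-integrable setT (EFin \o (fun t => rho t * corr g (m i j) (G i j) t)).
    have [h _ _] := corr_fubini g_free n1 (test_measurable trho) hM br (Lm i j) (LG i j).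
    by move: h; apply: eq_integrable => // t _ /=; rewrite scale1r.
  have is_ i : mu.-integrable setT (EFin \o (fun t => \sum_j rho t * corr g (m i j) (G i j) t)).
    have := integrable_sum measurableT (index_enum 'I_3) (P := xpredT) (fun j _ => i1 i j).
    by apply: eq_integrable => // t _; rewrite /= sumEFin.
  have := integrable_sum measurableT (index_enum 'I_3) (P := xpredT) (fun i _ => is_ i).
  apply: eq_integrable => // t _; rewrite /= sumEFin; congr EFin.
  by rewrite big_distrr /=; apply: eq_bigr => i _; rewrite big_distrr.
have ir : mu.-integrable setT (EFin \o rho).
  have := loc_int_mul (L2l_loc_int (L2l_cst 1)) (test_measurable trho) hM br.
  by apply: eq_integrable => // t _ /=; rewrite mul1r.
have rF0 : \int[mu]_t (rho t * F t) = 0 by exact: corr_bbox_zero.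
pose I := \int[mu]_t rho t.
have I0 : 0 < I.
  rewrite lt_neqAle eq_sym; apply/andP; split; last first.
    by apply: Rintegral_ge0 => t _; exact: bbox_ge0.
  apply/eqP => I0.
  have : (\int[mu]_t `|(EFin \o rho) t| = 0)%E.
    rewrite -[RHS]/((0 : R)%:E) -I0 /I /Rintegral fineK; last first.
      exact: (integrable_fin_num measurableT ir).
    by apply: eq_integral => t _; rewrite /= ger0_norm ?bbox_ge0.
  move=> /(ae_eq_integral_abs mu measurableT (measurable_int _ ir)) [N [mN N0 hN]].
  pose ob : set EB := obox (- d, - d, - d) (d, d, d).
  have : Order.le (mu ob) (mu N).
    apply: le_measure; rewrite ?inE //; first exact: measurable_obox.
    move=> t ot; apply: hN => /= h; have := h Logic.I => -[] h0.
    by have := bbox_gt0 0 ot; rewrite -/rho h0 ltxx.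
  rewrite N0 /ob leb3_obox /=; [|lra|lra|lra].
  rewrite lee_fin leNgt; move=> /negP; apply.
  by rewrite !mulr_gt0 //; lra.
have irF' : mu.-integrable setT (EFin \o (fun t => rho t * (F 0 - F t))).
  have := integrableB measurableT (integrable_scaleR measurableT (F 0) ir) irF.
  by apply: eq_integrable => // t _ /=; rewrite -EFinB; congr EFin; ring.
have E1 : F 0 * I = \int[mu]_t (rho t * (F 0 - F t)).
  rewrite /I -RintegralZl // -[LHS]subr0 -rF0 -RintegralB //.
    by apply: eq_Rintegral => t _; ring.
  exact: integrable_scaleR.
have : `|F 0| * I <= `|F 0| / 2 * I.
  rewrite -{1}(ger0_norm (ltW I0)) -normrM E1.
  apply: le_trans (le_normr_Rintegral measurableT irF') _.
  rewrite /I -RintegralZl //; apply: le_Rintegral => //.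
  - exact: integrable_norm.
  - exact: integrable_scaleR.
  - move=> t _; rewrite normrM (ger0_norm (bbox_ge0 _ _ _ _)) mulrC.
    have [ot|nt] := pselect (obox (- d, - d, - d) (d, d, d) t); last first.
      by rewrite /rho bbox_out // !mulr0.
    by apply: ler_wpM2r; [exact: bbox_ge0|rewrite distrC; apply: Fd; exact: ocub].
rewrite ler_pM2r //; have : 0 < `|F 0| by rewrite normr_gt0.
lra.
Qed.

End orthogonality.

(** * Korn and Poincare inequalities *)

Section periodic_estimates.
Variable R : realType.
Local Notation E := (R * R * R)%type.
Local Notation EB :=
  (measurableTypeR R * measurableTypeR R * measurableTypeR R)%type.
Local Notation mu := (leb3 R).
Variable g : 'I_3 -> E.
Hypothesis g_free : free [seq g i | i : 'I_3].
Local Notation Y := (cell g).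

Lemma cvg_sum_seq (I : Type) (s : seq I) (F : I -> nat -> R) (l : I -> R) :
  (forall i, F i n @[n --> \oo] --> l i) ->
  \sum_(i <- s) F i n @[n --> \oo] --> \sum_(i <- s) l i.
Proof.
move=> h; elim: s => [|i s IH].
  by under eq_fun do rewrite big_nil; rewrite big_nil; exact: cvg_cst.
by under eq_fun do rewrite big_cons; rewrite big_cons; exact: cvgD.
Qed.

(** On a bounded set, enlarged by 1 to leave room for the steps, the lattice sum has a fixed finite
    set of terms; bounds and limits of the quotients pass through it term by term. *)
Lemma Per_dqlim psi j : test_fun psi -> dqlim j (Per g psi) (Per g ('D_(dirv R j) psi)).
Proof.
move=> tp; have tp' := test_partial j tp.
have [r bp] := test_bsupp tp; have [M hM] := test_bounded tp.
have bp' : bsupp r ('D_(dirv R j) psi) by exact: bsupp_partial.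
have [Mq hMq] := test_dq_bounded j tp.
have fin rho : exists N : nat, forall n y, (N <= n)%N -> cub rho y ->
    Per g ('D_(dirv R j) psi) y = \sum_(k <- boxK n) 'D_(dirv R j) psi (y + lat g k) /\
    forall h, `|h| <= 1 -> dq j h (Per g psi) y = \sum_(k <- boxK n) dq j h psi (y + lat g k).
  have [N1 h1] := Per_fin g_free (rho + 1) bp.
  have [N2 h2] := Per_fin g_free rho bp'.
  exists (maxn N1 N2) => n y; rewrite geq_max => /andP[n1 n2] cy; split; first exact: h2.
  move=> h hh; rewrite /dq (h1 n) //; last by apply: cubD => //; exact: cub_dirv.
  rewrite (h1 n) //; last by apply: cubS cy; rewrite lerDl.
  rewrite -sumrB big_distrr /=; apply: eq_bigr => k _.
  by rewrite addrAC.
split.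
- exact: (measurable_Per g_free (test_measurable tp) bp).
- exact: (measurable_Per g_free (test_measurable tp') bp').
- move=> rho; have [M1 hM1] := Per_bounded g_free hM bp.
  have [N hN] := fin rho.
  exists (Num.max M1 (\sum_(k <- boxK N) Mq)) => y h cy /andP[_ h1]; split.
    by rewrite le_max hM1.
  have [_ -> //] := hN N y (leqnn N) cy.
  rewrite le_max; apply/orP; right.
  by apply: le_trans (ler_norm_sum _ _ _) _; apply: ler_sum.
move=> y u u0 ul; have [rho hr] := in_cub y; have [N hN] := fin rho%:R.
have [-> hdq] := hN N y (leqnn N) hr.
have L : \sum_(k <- boxK N) dq j (u n) psi (y + lat g k) @[n --> \oo] -->
    \sum_(k <- boxK N) 'D_(dirv R j) psi (y + lat g k).
  apply: cvg_sum_seq => k; apply: smooth_dq_cvg => //; exact: tp.1.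
apply: cvg_trans L; apply: near_eq_cvg.
have [N1 _ hN1] : \forall n \near \oo, `|0 - u n| <= 1.
  by have /cvgrPdist_le /(_ 1 ltr01) := ul.
exists N1 => // n /= Nn; apply/esym/hdq.
by have := hN1 n Nn; rewrite sub0r normrN.
Qed.

Lemma dqlim_L2l j (f f' : E -> R) : dqlim j f f' -> L2l f /\ L2l f'.
Proof.
move=> df; have [mf mf' _ _] := df.
split; apply: L2l_loc_bounded => // r; have [M hM] := dqlim_bound df r;
  by exists M => y /hM [].
Qed.

(** Only the difference of the two shifts matters, so an integral of a product of difference
    quotients is a combination of values of one correlation. *)
Lemma cell_corr (f h : E -> R) (a b : E) : L2l f -> L2l h -> Defs.periodic g f -> Defs.periodic g h ->
  \int[mu]_(y in Y) (f (y + a) * h (y + b)) = corr g f h (b - a).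
Proof.
move=> Lf Lh pf ph.
have L := L2l_mul (L2l_shift a Lf) (L2l_shift b Lh).
rewrite -(shift_cell g_free (- a) L); last first.
  move=> s ls; have h1 := mpres_ae (leb3_shift a) (pf s ls).
  have h2 := mpres_ae (leb3_shift b) (ph s ls).
  move: h1 h2; apply: aeS2 => y e1 e2; congr (_ * _).
    by rewrite -e1 addrAC.
  by rewrite -e2 addrAC.
by apply: eq_Rintegral => y _; rewrite subrK -addrA [- a + b]addrC.
Qed.

Lemma dq_cvg_cell i j (f fj h hi : E -> R) (e : R) : `|e| = 1 -> dqlim j f fj -> dqlim i h hi ->
  \int[mu]_(y in Y) (dq j (hseq e n) f y * dq i (hseq e n) h y) @[n --> \oo] -->
  \int[mu]_(y in Y) (fj y * hi y).
Proof.
move=> e1 df dh; have [mf mfj bf cf] := df; have [mh mhi bh ch] := dh.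
have mY := measurable_cell g_free; have [r hr] := cell_cub g_free.
have [M1 h1] := bf r; have [M2 h2] := bh r.
apply: (@Rintegral_dominated _ _ _ _ (fun=> M1 * M2)) => //.
- by move=> n; apply: measurable_funM; exact: measurable_dq.
- exact: measurable_funM.
- exact: (integrable_cell g_free (L2l_loc_int (L2l_cst (M1 * M2)))).
- move=> n y /hr cy; rewrite normrM; apply: ler_pM => //.
    by have [] := h1 y _ cy (hseq_le1 n e1).
  by have [] := h2 y _ cy (hseq_le1 n e1).
- move=> y _; apply: cvgM.
    by apply: cf; [move=> n; exact: hseq_neq0|exact: hseq_cvg].
  by apply: ch; [move=> n; exact: hseq_neq0|exact: hseq_cvg].
Qed.

(* Both sides are limits of the same finite-difference expression: shifting
   [f] forward in direction [j] and [h] forward in direction [i] is the same,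
   by invariance, as shifting [f] backward in direction [i] and [h] backward in
   direction [j]. *)
Lemma mixed_partials i j (f fi fj h hi hj : E -> R) : Defs.periodic g f -> Defs.periodic g h ->
  dqlim i f fi -> dqlim j f fj -> dqlim i h hi -> dqlim j h hj ->
  \int[mu]_(y in Y) (fj y * hi y) = \int[mu]_(y in Y) (fi y * hj y).
Proof.
move=> pf ph dfi dfj dhi dhj.
have n1 : `|1| = 1 :> R by rewrite normr1.
have nN1 : `|-1| = 1 :> R by rewrite normrN normr1.
have mY := measurable_cell g_free.
have [Lf _] := dqlim_L2l dfi; have [Lh _] := dqlim_L2l dhi.
have L1 := dq_cvg_cell n1 dfj dhi.
have L2 := dq_cvg_cell nN1 dfi dhj.
rewrite -(cvg_lim (@Rhausdorff R) L1) -(cvg_lim (@Rhausdorff R) L2).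
congr (lim (_ @ \oo)); apply/funext => n.
(* Passing from [(s, a, b)] to [(- s, b, a)] exchanges the two middle terms and fixes the others. *)
have EX (s : R) a b : \int[mu]_(y in Y) (dq a s f y * dq b s h y) =
    s^-1 ^+ 2 * (corr g f h (s *: dirv R b - s *: dirv R a) - corr g f h (- (s *: dirv R a))
      - corr g f h (s *: dirv R b) + corr g f h 0).
  set u := s *: dirv R a; set w := s *: dirv R b.
  have c1 := cell_corr u w Lf Lh pf ph.
  have c2 := cell_corr u 0 Lf Lh pf ph; rewrite sub0r in c2.
  have c3 := cell_corr 0 w Lf Lh pf ph; rewrite subr0 in c3.
  have c4 := cell_corr 0 0 Lf Lh pf ph; rewrite subr0 in c4.
  have Lz z : L2l (fun y : E => f (y + z)) by exact: L2l_shift.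
  have Hz z : L2l (fun y : E => h (y + z)) by exact: L2l_shift.
  have I z z' := integrable_cell g_free (L2l_mul (Lz z) (Hz z')).
  rewrite -c1 -c2 -c3 -c4.
  have I12 : mu.-integrable Y (EFin \o (fun y : E => f (y + u) * h (y + w) - f (y + u) * h (y + 0))).
    by have := integrableB mY (I u w) (I u 0); apply: eq_integrable.
  have I123 : mu.-integrable Y (EFin \o (fun y : E => f (y + u) * h (y + w) - f (y + u) * h (y + 0)
      - f (y + 0) * h (y + w))).
    by have := integrableB mY I12 (I 0 w); apply: eq_integrable.
  have I1234 : mu.-integrable Y (EFin \o (fun y : E => f (y + u) * h (y + w) - f (y + u) * h (y + 0)
      - f (y + 0) * h (y + w) + f (y + 0) * h (y + 0))).
    exact: integrable_addR.
  rewrite -RintegralB // -RintegralB // -RintegralD // -RintegralZl //.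
  by apply: eq_Rintegral => y _; rewrite /dq -/u -/w !addr0; ring.
rewrite !EX; have -> : hseq (-1) n = - hseq 1 n :> R by rewrite /hseq mulN1r mul1r.
set s := hseq 1 n; rewrite !scaleNr invrN sqrrN !opprK.
congr (_ * _); rewrite [- (s *: dirv R j) + _]addrC; ring.
Qed.

(** The triangle inequality for [k] equal steps, squared. The induction is sharp with the weights 1
    + 1/k and 1 + k in Young's inequality, because (1 + 1/k) k^2 + (1 + k) = (k + 1)^2. *)
Lemma telescope_shift (f : E -> R) (z : E) (k : nat) : L2l f -> Defs.periodic g f ->
  \int[mu]_(y in Y) (f (y + k%:R *: z) - f y) ^+ 2 <=
  k%:R ^+ 2 * \int[mu]_(y in Y) (f (y + z) - f y) ^+ 2.
Proof.
move=> Lf pf; have mY := measurable_cell g_free.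
have Lz t : L2l (fun y : E => f (y + t)) by exact: L2l_shift.
have Ld t s : mu.-integrable Y (EFin \o (fun y : E => (f (y + t) - f (y + s)) ^+ 2)).
  by have := integrable_cell g_free (L2l_mul (L2l_sub (Lz t) (Lz s)) (L2l_sub (Lz t) (Lz s))).
have Ld0 t : mu.-integrable Y (EFin \o (fun y : E => (f (y + t) - f y) ^+ 2)).
  by have := Ld t 0; apply: eq_integrable => // y _ /=; rewrite addr0.
elim: k => [|k IH].
  rewrite scale0r expr0n /= mul0r le_eqVlt; apply/orP; left; apply/eqP.
  under eq_Rintegral do rewrite addr0 subrr expr0n /=.
  by rewrite Rintegral_cst // mul0r.
have [->|k0] := eqVneq k 0%N; first by rewrite scale1r expr1n mul1r.
have kp : 0 < k%:R :> R by rewrite ltr0n lt0n.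
set D1 := \int[mu]_(y in Y) (f (y + z) - f y) ^+ 2.
have step : \int[mu]_(y in Y) (f (y + k.+1%:R *: z) - f (y + k%:R *: z)) ^+ 2 = D1.
  have Li : loc_int (fun y : E => (f (y + z) - f y) ^+ 2).
    have := L2l_mul (L2l_sub (Lz z) (Lz 0)) (L2l_sub (Lz z) (Lz 0)).
    by congr loc_int; apply/funext => y; rewrite addr0 expr2.
  rewrite /D1 -(shift_cell g_free (k%:R *: z) Li).
    apply: eq_Rintegral => y _; congr ((f _ - _) ^+ 2).
    by rewrite -natr1 scalerDl scale1r addrA.
  move=> t lt; have h1 := pf t lt; have := mpres_ae (leb3_shift z) h1.
  move: h1; apply: aeS2 => y e1 e2; rewrite e1; congr ((_ - _) ^+ 2).
  by rewrite -e2 addrAC.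
apply: (@le_trans _ _ (\int[mu]_(y in Y) ((1 + k%:R^-1) * (f (y + k%:R *: z) - f y) ^+ 2 +
   (1 + k%:R) * (f (y + k.+1%:R *: z) - f (y + k%:R *: z)) ^+ 2))).
  apply: le_Rintegral => //.
    by apply: integrable_addR => //; apply: integrable_scaleR.
  move=> y _; set a := f (y + k%:R *: z) - f y.
  set b := f (y + k.+1%:R *: z) - f (y + k%:R *: z).
  have -> : f (y + k.+1%:R *: z) - f y = a + b by rewrite /a /b; ring.
  rewrite -(ler_pM2l kp).
  have -> : k%:R * ((1 + k%:R^-1) * a ^+ 2 + (1 + k%:R) * b ^+ 2) =
     (k%:R + 1) * a ^+ 2 + k%:R * (1 + k%:R) * b ^+ 2.
    by field; rewrite gt_eqF.
  have := sqr_ge0 (a - k%:R * b); move: (k%:R : R) kp => q q0 h.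
  rewrite -subr_ge0; apply: le_trans h _; rewrite le_eqVlt; apply/orP; left; apply/eqP.
  ring.
rewrite RintegralD //; try exact: integrable_scaleR.
rewrite !RintegralZl // step.
apply: (@le_trans _ _ ((1 + k%:R^-1) * (k%:R ^+ 2 * D1) + (1 + k%:R) * D1)).
  by rewrite lerD2r; apply: ler_wpM2l => //; rewrite addr_ge0 // invr_ge0 ltW.
rewrite -natr1 le_eqVlt; apply/orP; left; apply/eqP; field.
by rewrite gt_eqF.
Qed.

(** Cut the shift into equal steps [u n]: telescoping bounds the left side by [t ^+ 2] times the
    mean square of a difference quotient, which tends to that of [fj]. The offset [N0] keeps the
    steps of length at most 1, where [dqlim] provides domination. *)
Lemma shift_dirv_le j (f fj : E -> R) (t : R) : Defs.periodic g f -> dqlim j f fj ->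
  \int[mu]_(y in Y) (f (y + t *: dirv R j) - f y) ^+ 2 <=
  t ^+ 2 * \int[mu]_(y in Y) fj y ^+ 2.
Proof.
move=> pf df; have mY := measurable_cell g_free.
have [Lf Lfj] := dqlim_L2l df; have [mf mfj bf cf] := df.
have [->|t0] := eqVneq t 0.
  rewrite expr0n /= mul0r le_eqVlt; apply/orP; left; apply/eqP.
  under eq_Rintegral do rewrite scale0r addr0 subrr expr0n /=.
  by rewrite Rintegral_cst // mul0r.
pose N0 := Num.bound `|t|.
have hN0 : `|t| < N0%:R by exact: unstable.ltr_bound.
pose u (n : nat) : R := t / (n + N0).+1%:R.
have nz n : (n + N0).+1%:R != 0 :> R by rewrite pnatr_eq0.
have u0 n : u n != 0 by rewrite mulf_neq0 ?invr_eq0.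
have u1 n : 0 < `|u n| <= 1.
  rewrite normr_gt0 u0 /= normrM normfV ler_pdivrMr ?normr_gt0 // mul1r.
  rewrite [leRHS]ger0_norm ?ler0n //; apply: le_trans (ltW hN0) _.
  by rewrite ler_nat; lia.
have ul : u n @[n --> \oo] --> (0 : R).
  rewrite -(mulr0 t); apply: cvgMr.
  have := @cvg_harmonic R; rewrite -(cvg_shiftn N0); exact.
have [r hr] := cell_cub g_free; have [M hM] := bf r.
have L : \int[mu]_(y in Y) (dq j (u n) f y) ^+ 2 @[n --> \oo] --> \int[mu]_(y in Y) fj y ^+ 2.
  apply: (@Rintegral_dominated _ _ _ _ (fun=> M ^+ 2)) => //.
  - by move=> n; apply: measurable_funX; exact: measurable_dq.
  - exact: measurable_funX.
  - exact: (integrable_cell g_free (L2l_loc_int (L2l_cst (M ^+ 2)))).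
  - move=> n y /hr cy; have [_ h] := hM y _ cy (u1 n).
    by rewrite normrX lerXn2r ?nnegrE //; apply: le_trans h.
  - by move=> y _; rewrite expr2; under eq_fun do rewrite expr2; apply: cvgM; exact: cf.
have L2 : (t ^+ 2 * \int[mu]_(y in Y) (dq j (u n) f y) ^+ 2) @[n --> \oo] -->
   t ^+ 2 * \int[mu]_(y in Y) fj y ^+ 2 by exact: cvgMr.
apply: (ler_cvg_to (cvg_cst _) L2); apply: nearW => n.
have E1 : (n + N0).+1%:R * u n = t by rewrite /u mulrC divfK.
have := telescope_shift (u n *: dirv R j) (n + N0).+1 Lf pf.
rewrite scalerA E1 => h; apply: le_trans h _.
have Ld : mu.-integrable Y (EFin \o (fun y : E => (f (y + u n *: dirv R j) - f y) ^+ 2)).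
  have Lz : L2l (fun y : E => f (y + u n *: dirv R j)) by exact: L2l_shift.
  by have := integrable_cell g_free (L2l_mul (L2l_sub Lz Lf) (L2l_sub Lz Lf)).
have -> : \int[mu]_(y in Y) (dq j (u n) f y) ^+ 2 =
    (u n)^-1 ^+ 2 * \int[mu]_(y in Y) (f (y + u n *: dirv R j) - f y) ^+ 2.
  by rewrite -RintegralZl //; apply: eq_Rintegral => y _; rewrite /dq exprMn.
rewrite mulrA -exprMn le_eqVlt; apply/orP; left; apply/eqP; congr (_ ^+ 2 * _).
by rewrite -E1 mulfK.
Qed.

(** Three successive shifts along the axes; the factor 3 comes from (a + b + c)^2 <= 3 (a^2 + b^2 +
    c^2). *)
Lemma shift_le (f : E -> R) (fj : 'I_3 -> E -> R) (h : E) (r0 : R) :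
  Defs.periodic g f -> (forall j, dqlim j f (fj j)) -> cub r0 h ->
  \int[mu]_(y in Y) (f (y + h) - f y) ^+ 2 <=
  3 * r0 ^+ 2 * \sum_j \int[mu]_(y in Y) fj j y ^+ 2.
Proof.
move=> pf df [c0 c1 c2]; have mY := measurable_cell g_free.
have [Lf _] := dqlim_L2l (df 0).
have Lz t : L2l (fun y : E => f (y + t)) by exact: L2l_shift.
have Li t s : loc_int (fun y : E => (f (y + t) - f (y + s)) ^+ 2).
  by have := L2l_mul (L2l_sub (Lz t) (Lz s)) (L2l_sub (Lz t) (Lz s)).
have Ld t s : mu.-integrable Y (EFin \o (fun y : E => (f (y + t) - f (y + s)) ^+ 2)).
  exact: (integrable_cell g_free (Li t s)).
pose d0 : E := h.1.1 *: dirv R 0; pose d1 : E := h.1.2 *: dirv R 1.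
pose d2 : E := h.2 *: dirv R 2%:R.
have hE : h = d2 + d1 + d0.
  have pairE (p : E) : p = (p.1.1, p.1.2, p.2) by case: p => [[]].
  rewrite [LHS]pairE [RHS]pairE /d0 /d1 /d2 /dirv.
  by congr (_, _, _); rewrite /= /GRing.scale /= ?mulr0 ?mulr1 ?add0r ?addr0.
have step j (t s : E) (c : R) : `|c| <= r0 ->
    \int[mu]_(y in Y) (f (y + (t + c *: dirv R j)) - f (y + t)) ^+ 2 <=
    r0 ^+ 2 * \int[mu]_(y in Y) fj j y ^+ 2.
  move=> cr.
  have -> : \int[mu]_(y in Y) (f (y + (t + c *: dirv R j)) - f (y + t)) ^+ 2 =
      \int[mu]_(y in Y) (f (y + c *: dirv R j) - f y) ^+ 2.
    have L : loc_int (fun y : E => (f (y + c *: dirv R j) - f y) ^+ 2).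
      by have := Li (c *: dirv R j) 0; congr loc_int; apply/funext => y; rewrite addr0.
    rewrite -(shift_cell g_free t L).
      by apply: eq_Rintegral => y _; rewrite addrA.
    move=> u lu; have h1 := pf u lu; have := mpres_ae (leb3_shift (c *: dirv R j)) h1.
    move: h1; apply: aeS2 => y e1 e2; rewrite e1; congr ((_ - _) ^+ 2).
    by rewrite -e2 addrAC.
  apply: le_trans (shift_dirv_le c pf (df j)) _.
  apply: ler_wpM2r; first by apply: Rintegral_ge0 => y _; exact: sqr_ge0.
  by rewrite -real_normK ?num_real // lerXn2r ?nnegrE // (le_trans _ cr).
apply: (@le_trans _ _ (\int[mu]_(y in Y) (3 * (f (y + (0 + d2)) - f (y + 0)) ^+ 2 +
    3 * (f (y + (d2 + d1)) - f (y + d2)) ^+ 2 +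
    3 * (f (y + (d2 + d1 + d0)) - f (y + (d2 + d1))) ^+ 2))).
  apply: le_Rintegral => //.
  - by have := Ld h 0; apply: eq_integrable => // y _ /=; rewrite addr0.
  - by apply: integrable_addR => //; [apply: integrable_addR => //|]; exact: integrable_scaleR.
  - move=> y _; rewrite -hE add0r addr0.
    move: (f (y + h)) (f (y + (d2 + d1))) (f (y + d2)) (f y) => a b c d.
    have h1 := sqr_ge0 ((a - b) - (b - c)); have h2 := sqr_ge0 ((a - b) - (c - d)).
    have h3 := sqr_ge0 ((b - c) - (c - d)); nra.
rewrite RintegralD //; last 2 first.
- by apply: integrable_addR => //; exact: integrable_scaleR.
- exact: integrable_scaleR.
rewrite RintegralD //; last 2 first.
- exact: integrable_scaleR.
- exact: integrable_scaleR.
rewrite !RintegralZl // !big_ord_recl big_ord0 addr0.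
have s2 := step 2%:R 0 0 _ c2; have s1 := step 1 d2 0 _ c1; have s0 := step 0 (d2 + d1) 0 _ c0.
have -> : lift ord0 ord0 = 1 :> 'I_3 by apply/val_inj.
have -> : lift ord0 (lift ord0 ord0) = 2%:R :> 'I_3 by apply/val_inj.
move: s0 s1 s2; rewrite /d0 /d1 /d2 => s0 s1 s2; nra.
Qed.

(* Averaging [shift_le] over [h] in [Y]: since
   [int_Y (f (y + h) - f y)^2 = 2 int_Y f^2 - 2 int_Y f (y + h) f y], the mean
   over [h] of the left-hand side is twice the variance of [f]. *)
Lemma poincare (f : E -> R) (fj : 'I_3 -> E -> R) (r0 : R) :
  Y `<=` cub r0 -> Defs.periodic g f -> (forall j, dqlim j f (fj j)) ->
  \int[mu]_(y in Y) f y = 0 ->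
  \int[mu]_(y in Y) f y ^+ 2 <= 3 * r0 ^+ 2 * \sum_j \int[mu]_(y in Y) fj j y ^+ 2.
Proof.
move=> hr pf df f0; have mY := measurable_cell g_free.
have [Lf _] := dqlim_L2l (df 0).
set K := 3 * r0 ^+ 2 * _; set Q := \int[mu]_(y in Y) f y ^+ 2.
have Y0 := leb3_cell_gt0 g_free.
have K0 : 0 <= K.
  apply: mulr_ge0; first by rewrite mulr_ge0 ?sqr_ge0.
  by apply: sumr_ge0 => j _; apply: Rintegral_ge0 => y _; exact: sqr_ge0.
have iQ : mu.-integrable Y (EFin \o (fun y : E => f y ^+ 2)).
  exact: (integrable_cell g_free (L2l_mul Lf Lf)).
have fin (c : E -> R) : (forall h, Y h -> 2 * Q - 2 * c h <= K) ->
    mu.-integrable Y (EFin \o c) -> \int[mu]_(h in Y) c h = 0 -> Q <= K.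
  move=> key ic Z.
  have V : \int[mu]_(h in Y) (2 * Q) <= \int[mu]_(h in Y) (K + 2 * c h).
    apply: le_Rintegral => //.
    - exact: (integrable_cell g_free (L2l_loc_int (L2l_cst (2 * Q)))).
    - apply: integrable_addR => //; last exact: integrable_scaleR.
      exact: (integrable_cell g_free (L2l_loc_int (L2l_cst K))).
    - by move=> h /key; move: (c h) => ch; lra.
  rewrite RintegralD // in V; last 2 first.
  - exact: (integrable_cell g_free (L2l_loc_int (L2l_cst K))).
  - exact: integrable_scaleR.
  rewrite RintegralZl // Z mulr0 addr0 !(Rintegral_cst _ mY) in V.
  rewrite ler_pM2r // in V; have Q0 : 0 <= Q by apply: Rintegral_ge0 => y _; exact: sqr_ge0.
  lra.
have key h : Y h -> 2 * Q - 2 * corr g f f h <= K.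
  move=> /hr ch; apply: le_trans (shift_le pf df ch).
  have Lz : L2l (fun y : E => f (y + h)) by exact: L2l_shift.
  have i1 := integrable_cell g_free (L2l_mul Lf Lz).
  have i2 := integrable_cell g_free (L2l_mul Lz Lz).
  have -> : \int[mu]_(y in Y) (f (y + h) - f y) ^+ 2 =
     \int[mu]_(y in Y) ((f (y + h) * f (y + h) + (-2) * (f y * f (y + h))) + f y ^+ 2).
    by apply: eq_Rintegral => y _; ring.
  have i3 := integrable_scaleR mY (-2) i1.
  rewrite RintegralD // ?RintegralD //; last exact: integrable_addR.
  rewrite RintegralZl // -/(corr g f f h) -/Q.
  have -> : \int[mu]_(y in Y) (f (y + h) * f (y + h)) = Q.
    by rewrite (cell_corr h h Lf Lf pf pf) subrr /corr /Q; apply: eq_Rintegral => y _; rewrite addr0 expr2.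
  lra.
have b1 : bsupp r0 (\1_Y : E -> R).
  by move=> y ny; rewrite indicE; case: (boolP (_ \in _)) => // /set_mem /hr.
have [j1 j2 j3] := corr_fubini g_free (r := r0) (M := 1) (e := 1) (or_introl erefl)
   (measurable_indic mY) (fun t => ltac:(by rewrite indicE; case: (_ \in _); rewrite ?normr1 ?normr0 ?ler01)) b1 Lf Lf.
(* By Fubini the inner integral is that of [f] over a translate of the cell, that is, the integral
   of [f] over the cell, which is zero. *)
have Z : \int[mu]_(h in Y) corr g f f h = 0.
  have -> : \int[mu]_(h in Y) corr g f f h = \int[mu]_t (\1_Y t * corr g f f (1 *: t)).
    rewrite [LHS]Rintegral_mkcond; apply: eq_Rintegral => t _; rewrite scale1r patchE indicE.
    by case: (_ \in _); rewrite ?mul1r ?mul0r.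
  rewrite j3; transitivity (\int[mu]_(y in Y) (0 : R)); last first.
    by rewrite (Rintegral_cst _ mY) mul0r.
  apply: eq_Rintegral => y _.
    have -> : \int[mu]_t (\1_Y t * f (y + 1 *: t)) = 0.
      transitivity (\int[mu]_(t in Y) f (t + y)).
        rewrite [RHS]Rintegral_mkcond; apply: eq_Rintegral => t _.
        rewrite scale1r patchE indicE addrC.
        by case: (_ \in _); rewrite ?mul1r ?mul0r.
      by rewrite (shift_cell g_free y (L2l_loc_int Lf) pf).
    by rewrite mulr0.
have ic : mu.-integrable Y (EFin \o corr g f f).
  rewrite (integrable_mkcond _ mY); move: j1; clear; apply: eq_integrable => // t _.
  by rewrite /= patchE indicE scale1r; case: (_ \in _); rewrite ?mul1r ?mul0r.
exact: (fin (corr g f f) key ic Z).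
Qed.

End periodic_estimates.

(** * Finite families and limits in inner product spaces *)

Section prehilbert_family.
Variables (R : realType) (V : lmodType R) (P : V -> Prop) (ip : V -> V -> R).
Hypothesis H : prehilbert P ip.
Variable I : finType.

Lemma prehilbert_family : prehilbert (V := I -> V) (fun u => forall i, P (u i))
  (fun u v => \sum_i ip (u i) (v i)).
Proof.
split.
- by move=> i; exact: (ph0 H).
- by move=> x y Px Py i; exact: (phD H).
- by move=> a x Px i; exact: (phZ H).
- by move=> x y Px Py; apply: eq_bigr => i _; exact: (phC H).
- by move=> x y z Px Py Pz; rewrite -big_split /=; apply: eq_bigr => i _; exact: (phDl H).
- by move=> a x y Px Py; rewrite big_distrr /=; apply: eq_bigr => i _; exact: (phZl H).
- by move=> x Px; apply: sumr_ge0 => i _; exact: (ph_ge0 H).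
Qed.

Lemma complete_family :
  (forall u : nat -> V, (forall n, P (u n)) -> cauchy_for ip u ->
     exists2 p, P p & ip (u n - p) (u n - p) @[n --> \oo] --> 0) ->
  forall u : nat -> I -> V, (forall n i, P (u n i)) ->
    cauchy_for (V := I -> V) (fun u v => \sum_i ip (u i) (v i)) u ->
    exists2 p : I -> V, (forall i, P (p i)) &
      \sum_i ip ((u n - p) i) ((u n - p) i) @[n --> \oo] --> 0.
Proof.
move=> cP u Pu cu.
have /choice [p hp] : forall i, exists p, P p /\
    ip (u n i - p) (u n i - p) @[n --> \oo] --> 0.
  move=> i; have [|p Pp up] := cP (fun n => u n i) (fun n => Pu n i); last by exists p.
  move=> e e0; have [N hN] := cu e e0; exists N => m n Nm Nn; apply: le_trans (hN m n Nm Nn).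
  rewrite [leRHS](bigD1 i) //= lerDl; apply: sumr_ge0 => k _.
  by apply: (ph_ge0 H); exact: (phB H).
exists p; first by move=> i; have [] := hp i.
have := cvg_sum_seq (s := index_enum I) (fun i => (hp i).2).
by rewrite [X in _ --> X]big1.
Qed.

End prehilbert_family.

Section prehilbert_limits.
Variables (R : realType) (V : lmodType R) (P : V -> Prop) (ip : V -> V -> R).
Hypothesis H : prehilbert P ip.

Lemma ip_cvg (u : nat -> V) (p q : V) : (forall n, P (u n)) -> P p -> P q ->
  ip (u n - p) (u n - p) @[n --> \oo] --> 0 -> ip (u n) q @[n --> \oo] --> ip p q.
Proof.
move=> Pu Pp Pq up; have PB n : P (u n - p) by exact: (phB H).
have h : (fun n => ip (u n - p) q ^+ 2) @ \oo --> (0 : R).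
  have L : ip (u n - p) (u n - p) * ip q q @[n --> \oo] --> (0 : R).
    by rewrite -(mul0r (ip q q)); exact: cvgMl.
  apply: (squeeze_cvgr _ (cvg_cst (0 : R)) L).
  by apply: nearW => n; rewrite sqr_ge0 /= (ph_csq H).
have h0 : ip (u n - p) q @[n --> \oo] --> (0 : R).
  apply/cvgrPdist_le => e e0; have /cvgrPdist_le /(_ (e ^+ 2)) := h.
  rewrite exprn_gt0 // => /(_ isT); apply: filterS => n.
  by rewrite !sub0r !normrN normrX ler_pXn2r ?nnegrE // ltW.
have L : ip (u n - p) q + ip p q @[n --> \oo] --> ip p q.
  by rewrite -[X in _ --> X]add0r; apply: cvgD => //; exact: cvg_cst.
by apply: cvg_trans L; apply: near_eq_cvg; apply: nearW => n; rewrite (phBl H) // subrK.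
Qed.

Lemma cvg_cauchy_for (u : nat -> V) (p : V) : (forall n, P (u n)) -> P p ->
  ip (u n - p) (u n - p) @[n --> \oo] --> 0 -> cauchy_for ip u.
Proof.
move=> Pu Pp up e e0; have e4 : 0 < e / 4 by rewrite divr_gt0.
have /cvgrPdist_le /(_ _ e4) [N _ hN] := up.
have PB n : P (u n - p) by exact: (phB H).
have hN' n : (N <= n)%N -> ip (u n - p) (u n - p) <= e / 4.
  by move=> /hN /=; rewrite sub0r normrN => /(le_trans (ler_norm _)).
exists N => m n /hN' hm /hN' hn.
have -> : u m - u n = (u m - p) + (- (u n - p)) by rewrite opprB addrA subrK.
have PN := phN H (PB n).
apply: le_trans (ph_tri2 H (PB m) PN) _.
have -> : ip (- (u n - p)) (- (u n - p)) = ip (u n - p) (u n - p).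
  by rewrite (phNl H) // (phC H) // (phNl H) // opprK.
lra.
Qed.

Lemma ip_cvg_uniq (u : nat -> V) (p q : V) : (forall n, P (u n)) -> P p -> P q ->
  ip (u n - p) (u n - p) @[n --> \oo] --> 0 ->
  ip (u n - q) (u n - q) @[n --> \oo] --> 0 -> ip (p - q) (p - q) = 0.
Proof.
move=> Pu Pp Pq up uq; have Pz : P (p - q) by exact: (phB H).
have L1 := ip_cvg Pu Pp Pz up; have L2 := ip_cvg Pu Pq Pz uq.
by rewrite (phBl H) // -(cvg_lim (@Rhausdorff R) L1) -(cvg_lim (@Rhausdorff R) L2) subrr.
Qed.

End prehilbert_limits.

(** * Periodized test functions and periodic extension *)

Section periodization.
Variable R : realType.
Local Notation E := (R * R * R)%type.
Local Notation EB :=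
  (measurableTypeR R * measurableTypeR R * measurableTypeR R)%type.
Local Notation mu := (leb3 R).
Variable g : 'I_3 -> E.
Hypothesis g_free : free [seq g i | i : 'I_3].
Local Notation Y := (cell g).

Lemma Per_lin (a : R) (f h : E -> R) r s : bsupp r f -> bsupp s h ->
  Per g (fun y => a * f y + h y) = (fun y => a * Per g f y + Per g h y).
Proof.
move=> bf bh; apply/funext => y.
have baf : bsupp r (fun y : E => a * f y) by move=> z /bf ->; rewrite mulr0.
have [rho hr] := in_cub y.
have [N1 h1] := Per_fin g_free rho%:R bf; have [N2 h2] := Per_fin g_free rho%:R bh.
have [N3 h3] := Per_fin g_free rho%:R (bsupp_add baf bh).
pose N := maxn N1 (maxn N2 N3).
rewrite (h3 N) ?(h1 N) ?(h2 N) //; last 3 first.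
- by rewrite /N !leq_max leqnn orbT.
- by rewrite /N !leq_max leqnn.
- by rewrite /N !leq_max leqnn !orbT.
by rewrite big_split /= big_distrr.
Qed.

Lemma Per_test_bounded psi : test_fun psi ->
  measurable_fun [set: EB] (Per g psi) /\ exists M : R, forall y : E, `|Per g psi y| <= M.
Proof.
move=> tp; have [r bp] := test_bsupp tp; have [M hM] := test_bounded tp.
split; first exact: (measurable_Per g_free (test_measurable tp) bp).
exact: (Per_bounded g_free hM bp).
Qed.

Lemma L2l_Per psi : test_fun psi -> L2l (Per g psi).
Proof. by move=> /Per_test_bounded [mp [M hM]]; exact: (L2l_bounded mp hM). Qed.

Lemma unfold_test (f psi : E -> R) : L2l f -> Defs.periodic g f -> test_fun psi ->
  \int[mu]_y (f y * psi y) = ipL2 mu Y f (Per g psi).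
Proof.
move=> Lf pf tp; have [r bp] := test_bsupp tp; have [M hM] := test_bounded tp.
exact: (unfold_Per g_free (L2l_loc_int Lf) pf (test_measurable tp) hM bp).
Qed.

Lemma derive_lin (a : R) psi1 psi2 j : test_fun psi1 -> test_fun psi2 ->
  'D_(dirv R j) (fun y : E => a * psi1 y + psi2 y) =
  (fun y => a * 'D_(dirv R j) psi1 y + 'D_(dirv R j) psi2 y).
Proof.
move=> [s1 _] [s2 _]; apply/funext => y.
have d1 := @smooth_derivable _ psi1 j y s1; have d2 := @smooth_derivable _ psi2 j y s2.
have := @deriveD _ _ _ (a *: psi1) psi2 y (dirv R j).
move=> ->; [|exact: derivableZ|by []].
by rewrite deriveZ.
Qed.

(** Completeness of L^2(Y) gives limits that mean something on the cell only; the lattice sum of the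
    restriction to the half-open cell turns them into fields on R^3. *)
Lemma periodic_extension (f : EB -> R) : L2on mu Y f ->
  exists F : E -> R, [/\ L2l F, Defs.periodic g F & {ae mu, forall y : E, Y y -> F y = f y}].
Proof.
move=> Lf; have mY := measurable_cell g_free; have mc0 := measurable_cell0 g.
have [r hr] := cell_cub g_free.
pose f1 : E -> R := fun y => f y * \1_(cell0 g) y.
have mf1 : measurable_fun [set: EB] f1.
  by apply: measurable_funM; [exact: Lf.1|exact: measurable_indic].
have b1 : bsupp r f1.
  move=> y ny; rewrite /f1 indicE; case: (boolP (_ \in _)); rewrite ?mulr0 //.
  by move=> /set_mem /(cell0_cell g_free) /hr.
have l0 : lat g 0 = 0 by rewrite latE big1 // => i _; rewrite ffunE scale0r.
have F0 y : cell0 g y -> Per g f1 y = f y.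
  rewrite -{1}[y]subr0 -l0 => cy; rewrite /Per (fsbigE [:: 0]) //; last first.
    move=> k _; rewrite inE => /eqP nk; rewrite /f1 indicE.
    case: (boolP (_ \in _)); rewrite ?mulr0 //.
    rewrite -[lat g k]opprK -latN => /set_mem /(cell0P g_free) h; case: nk.
    by rewrite -[k]opprK h -((cell0P g_free y 0).1 cy) oppr0.
  rewrite big_mkcond big_seq1 in_setT l0 addr0 /f1 indicE mem_set ?mulr1 //.
  by rewrite -[y]subr0 -l0.
have aeF : {ae mu, forall y : E, Y y -> Per g f1 y = f y}.
  by apply: aeS (ae_cell0 g_free) => y h Yy; apply: F0; exact: h.
have mF := measurable_Per g_free mf1 b1.
have pF : Defs.periodic g (Per g f1) by exact: periodic_Per.
exists (Per g f1); split => //; apply: (periodic_L2l g_free) => //.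
apply: (L2on_lty mY) => //.
have [_ /integrableP[_]] := Lf; apply: le_lt_trans.
rewrite le_eqVlt; apply/orP; left; apply/eqP.
apply: ge0_ae_eq_integral => //.
- by apply/measurable_EFinP/measurable_funTS; exact: measurable_funX.
- apply: measurableT_comp => //.
  by apply/measurable_EFinP/measurable_funTS; apply: measurable_funX; exact: Lf.1.
- by move=> y _; rewrite lee_fin sqr_ge0.
- by move: aeF; apply: aeS => y h Yy; rewrite /= h // ger0_norm ?sqr_ge0.
Qed.

End periodization.

(** * Strains of periodized test functions *)

Section strains.
Variable R : realType.
Local Notation E := (R * R * R)%type.
Local Notation EB :=
  (measurableTypeR R * measurableTypeR R * measurableTypeR R)%type.
Local Notation mu := (leb3 R).
Variable g : 'I_3 -> E.
Hypothesis g_free : free [seq g i | i : 'I_3].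
Local Notation Y := (cell g).
Local Notation V := ('I_3 -> 'I_3 -> EB -> R).
Implicit Types (ps : 'I_3 -> E -> R) (u v : V).

Definition L2sq u : Prop := forall i j, L2on mu Y (u i j).

Definition ipsq u v : R := \sum_i \sum_j ipL2 mu Y (u i j) (v i j).

Definition pgrad ps : V := fun i j => Per g ('D_(dirv R j) (ps i)).

Definition symf u : V := fun i j y => 2^-1 * (u i j y + u j i y).

Let LH := L2on_prehilbert mu (measurable_cell g_free).

Lemma prehilbert_sq : prehilbert (V := V) L2sq ipsq.
Proof. exact: (prehilbert_family (prehilbert_family LH 'I_3) 'I_3). Qed.

Let VH := prehilbert_sq.

Lemma L2sq_complete (u : nat -> V) : (forall n, L2sq (u n)) -> cauchy_for ipsq u ->
  exists2 p : V, L2sq p & ipsq (u n - p) (u n - p) @[n --> \oo] --> 0.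
Proof.
apply: (complete_family (prehilbert_family LH 'I_3)); apply: (complete_family LH).
exact: L2on_complete (measurable_cell g_free).
Qed.

Lemma L2sq_pgrad ps : (forall i, test_fun (ps i)) -> L2sq (pgrad ps).
Proof. by move=> tp i j; apply: L2l_cell => //; apply: L2l_Per => //; exact: test_partial. Qed.

Lemma symfE u i j : symf u i j = 2^-1 *: (u i j + u j i). Proof. by []. Qed.

Lemma L2sq_symf u : L2sq u -> L2sq (symf u).
Proof. by move=> Lu i j; rewrite symfE; apply: (phZ LH); exact: (phD LH). Qed.

Lemma test_lin (a : R) ps ps' : (forall i, test_fun (ps i)) -> (forall i, test_fun (ps' i)) ->
  forall i, test_fun (fun y => a * ps i y + ps' i y).
Proof. by move=> t1 t2 i; apply: test_add => //; exact: test_scale. Qed.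

Lemma pgrad_lin (a : R) ps ps' : (forall i, test_fun (ps i)) -> (forall i, test_fun (ps' i)) ->
  pgrad (fun i y => a * ps i y + ps' i y) = a *: pgrad ps + pgrad ps'.
Proof.
move=> t1 t2; apply/funext => i; apply/funext => j; rewrite /pgrad derive_lin //.
have [r1 b1] := test_bsupp (test_partial j (t1 i)).
have [r2 b2] := test_bsupp (test_partial j (t2 i)).
by rewrite (Per_lin g_free a b1 b2).
Qed.

Lemma symf_lin (a : R) u v : symf (a *: u + v) = a *: symf u + symf v.
Proof.
apply/funext => i; apply/funext => j; apply/funext => y.
rewrite /symf; change (2^-1 * (a * u i j y + v i j y + (a * u j i y + v j i y)) =
  a * (2^-1 * (u i j y + u j i y)) + 2^-1 * (v i j y + v j i y)); ring.
Qed.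

Lemma ipL2_half (a b : EB -> R) : L2on mu Y a -> L2on mu Y b ->
  ipL2 mu Y (2^-1 *: (a + b)) (2^-1 *: (a + b)) =
  4^-1 * ipL2 mu Y a a + 4^-1 * ipL2 mu Y b b + 2^-1 * ipL2 mu Y a b.
Proof.
move=> La Lb; have Lab := phD LH La Lb.
rewrite (phZl LH) //; last exact: (phZ LH).
rewrite (phZr LH) // (phDl LH) // (phC LH La Lab) (phC LH Lb Lab) !(phDl LH) //.
by rewrite (phC LH Lb La); field.
Qed.

(** Isolates the pairing of [u] with its transpose, whose sign decides Korn's inequality. *)
Lemma ipsq_symf u : L2sq u ->
  ipsq (symf u) (symf u) = 2^-1 * ipsq u u + 2^-1 * \sum_i \sum_j ipL2 mu Y (u i j) (u j i).
Proof.
move=> Lu; rewrite /ipsq.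
under eq_bigr => i _.
  under eq_bigr => j _ do rewrite symfE ipL2_half //.
  rewrite !big_split /= -!big_distrr /=; over.
rewrite !big_split /= -!big_distrr /=; congr (_ + _).
rewrite [X in _ + _ * X]exchange_big /= -mulrDl; congr (_ * _); by field.
Qed.

Lemma ipsq_symf_le u : L2sq u -> ipsq (symf u) (symf u) <= ipsq u u.
Proof.
move=> Lu; rewrite ipsq_symf //.
suff : \sum_i \sum_j ipL2 mu Y (u i j) (u j i) <= ipsq u u by lra.
have -> : ipsq u u = \sum_i \sum_j (2^-1 * ipL2 mu Y (u i j) (u i j) + 2^-1 * ipL2 mu Y (u j i) (u j i)).
  under eq_bigr => i _ do rewrite big_split /= -!big_distrr /=.
  rewrite big_split /= -!big_distrr /= [X in _ = _ + _ * X]exchange_big /= -mulrDl.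
  have -> : (2^-1 + 2^-1 : R) = 1 by field.
  by rewrite mul1r.
apply: ler_sum => i _; apply: ler_sum => j _.
have := ph_ge0 LH (phB LH (Lu i j) (Lu j i)).
rewrite (phBl LH) ?(phBr LH) //; last exact: (phB LH).
rewrite (phC LH (Lu j i) (Lu i j)); lra.
Qed.

(* The cross terms are [int (D_j phi_i) (D_i phi_j) = int (D_i phi_i) (D_j phi_j)],
   which add up to the integral of the squared divergence. *)
Lemma korn ps : (forall i, test_fun (ps i)) ->
  ipsq (pgrad ps) (pgrad ps) <= 2 * ipsq (symf (pgrad ps)) (symf (pgrad ps)).
Proof.
move=> tp; have Lu := L2sq_pgrad tp; rewrite ipsq_symf //; set u := pgrad ps in Lu *.
suff : 0 <= \sum_i \sum_j ipL2 mu Y (u i j) (u j i) by lra.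
have -> : \sum_i \sum_j ipL2 mu Y (u i j) (u j i) = \sum_i \sum_j ipL2 mu Y (u i i) (u j j).
  apply: eq_bigr => i _; apply: eq_bigr => j _.
  apply: (mixed_partials g_free (f := Per g (ps i)) (h := Per g (ps j)));
    by [exact: periodic_Per|exact: Per_dqlim].
have mY := measurable_cell g_free.
have -> : \sum_i \sum_j ipL2 mu Y (u i i) (u j j) = \int[mu]_(y in Y) (\sum_i u i i y) ^+ 2.
  under [RHS]eq_Rintegral => y _ do rewrite expr2 big_distrlr /=.
  have I i j : mu.-integrable Y (EFin \o (fun y => u i i y * u j j y)).
    by apply: L2on_mul.
  have J i : mu.-integrable Y (EFin \o (fun y => \sum_j u i i y * u j j y)).
    elim: (index_enum _) => [|j s IH].
      have := integrable_cell g_free (L2l_loc_int (L2l_cst (0 : R))).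
      by apply: eq_integrable => // y _ /=; rewrite big_nil.
    have := integrable_addR mY (I i j) IH; apply: eq_integrable => // y _ /=.
    by rewrite big_cons.
  rewrite (Rintegral_sum _ mY J); apply: eq_bigr => i _.
  by rewrite (Rintegral_sum _ mY (I i)).
by apply: Rintegral_ge0 => y _; exact: sqr_ge0.
Qed.

Definition meanY (f : EB -> R) : R := (fine (mu Y))^-1 * \int[mu]_(y in Y) f y.

(** Normalized to mean zero for Poincare's inequality; the gradient is still [pgrad ps]. *)
Definition pphi ps (i : 'I_3) : EB -> R := fun y => Per g (ps i) y - meanY (Per g (ps i)).

Lemma dqlim_subC j (f f' : E -> R) (c : R) : dqlim j f f' -> dqlim j (fun y => f y - c) f'.
Proof.
move=> [mf mf' hb hc].
have E1 h : dq j h (fun y => f y - c) = dq j h f.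
  by apply/funext => y; rewrite /dq; congr (_ * _); ring.
split=> //.
- exact: measurable_funB.
- move=> r; have [M hM] := hb r; exists (M + `|c|) => y h cy h1.
  have [h2 h3] := hM y h cy h1; rewrite E1; split.
    by apply: le_trans (ler_normB _ _) _; rewrite lerD2r.
  by apply: le_trans h3 _; rewrite lerDl.
- by move=> y s s0 sl; under eq_fun do rewrite E1; exact: hc.
Qed.

Lemma pphi_dqlim ps i j : test_fun (ps i) -> dqlim j (pphi ps i) (pgrad ps i j).
Proof. by move=> tp; apply: dqlim_subC; exact: Per_dqlim. Qed.

Lemma pphi_L2l ps i : test_fun (ps i) -> L2l (pphi ps i).
Proof. by move=> tp; have [] := dqlim_L2l (pphi_dqlim 0 tp). Qed.

Lemma pphi_periodic ps i : Defs.periodic g (pphi ps i).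
Proof. by move=> t /latticeP[k ->]; apply/aeW => y; rewrite /pphi Per_lat. Qed.

Lemma pphi_lin (a : R) ps ps' i : (forall i, test_fun (ps i)) -> (forall i, test_fun (ps' i)) ->
  pphi (fun i y => a * ps i y + ps' i y) i = a *: pphi ps i + pphi ps' i.
Proof.
move=> t1 t2; have [r1 b1] := test_bsupp (t1 i); have [r2 b2] := test_bsupp (t2 i).
apply/funext => y; rewrite /pphi (Per_lin g_free a b1 b2).
have i1 := integrable_cell g_free (L2l_loc_int (L2l_Per g_free (t1 i))).
have i2 := integrable_cell g_free (L2l_loc_int (L2l_Per g_free (t2 i))).
have mY := measurable_cell g_free.
have -> : meanY (fun y => a * Per g (ps i) y + Per g (ps' i) y) =
    a * meanY (Per g (ps i)) + meanY (Per g (ps' i)).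
  rewrite /meanY RintegralD // ?RintegralZl //; last exact: integrable_scaleR.
  by rewrite mulrDr mulrCA.
change (a * Per g (ps i) y + Per g (ps' i) y - (a * meanY (Per g (ps i)) + meanY (Per g (ps' i))) =
  a * (Per g (ps i) y - meanY (Per g (ps i))) + (Per g (ps' i) y - meanY (Per g (ps' i)))); ring.
Qed.

Lemma pphi_mean0 ps i : test_fun (ps i) -> \int[mu]_(y in Y) pphi ps i y = 0.
Proof.
move=> tp; have mY := measurable_cell g_free.
have i1 := integrable_cell g_free (L2l_loc_int (L2l_Per g_free tp)).
rewrite RintegralB //; last exact: (integrable_cell g_free (L2l_loc_int (L2l_cst _))).
rewrite (Rintegral_cst _ mY) /meanY mulrC mulrA divff ?mul1r ?subrr //.
by rewrite gt_eqF // leb3_cell_gt0.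
Qed.

Lemma pphi_poincare : exists K : R, 0 <= K /\ forall ps i, (forall i, test_fun (ps i)) ->
  ipL2 mu Y (pphi ps i) (pphi ps i) <= K * ipsq (pgrad ps) (pgrad ps).
Proof.
have mY := measurable_cell g_free.
have [r0 hr] := cell_cub g_free; exists (3 * r0 ^+ 2); split.
  by rewrite mulr_ge0 ?sqr_ge0.
move=> ps i tp.
have := poincare g_free hr (@pphi_periodic ps i) (fun j => pphi_dqlim j (tp i)).
move=> h; apply: le_trans (h _) _; first exact: pphi_mean0.
apply: ler_wpM2l; first by rewrite mulr_ge0 ?sqr_ge0.
have Lu := L2sq_pgrad tp.
have -> : \sum_j \int[mu]_(y in Y) pgrad ps i j y ^+ 2 =
    \sum_j ipL2 mu Y (pgrad ps i j) (pgrad ps i j) by [].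
rewrite /ipsq [leRHS](bigD1 i) //= lerDl; apply: sumr_ge0 => k _; apply: sumr_ge0 => l _.
exact: (ph_ge0 LH (Lu k l)).
Qed.

End strains.

(** * Projection on the closure of the strains *)

Section projection.
Variable R : realType.
Local Notation E := (R * R * R)%type.
Local Notation EB :=
  (measurableTypeR R * measurableTypeR R * measurableTypeR R)%type.
Local Notation mu := (leb3 R).
Variable g : 'I_3 -> E.
Hypothesis g_free : free [seq g i | i : 'I_3].
Local Notation Y := (cell g).
Local Notation V := ('I_3 -> 'I_3 -> EB -> R).

Let mY := measurable_cell g_free.
Let LH := L2on_prehilbert mu mY.
Let VH := prehilbert_sq g_free.

Lemma ipL2_le_ipsq (u : V) i j : L2sq g u -> ipL2 mu Y (u i j) (u i j) <= ipsq g u u.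
Proof.
move=> Lu; rewrite /ipsq [leRHS](bigD1 i) //= (bigD1 j) //= -addrA lerDl addr_ge0 //.
  by apply: sumr_ge0 => l _; exact: (ph_ge0 LH (Lu i l)).
by apply: sumr_ge0 => k _; apply: sumr_ge0 => l _; exact: (ph_ge0 LH (Lu k l)).
Qed.

Lemma dqlim_cst j (c : R) : dqlim j (fun=> c : R) (fun=> 0).
Proof.
have E1 h : dq j h (fun=> c) = fun=> 0 by apply/funext => y; rewrite /dq subrr mulr0.
split=> //.
- by move=> r; exists `|c| => y h _ _; rewrite E1 normr0.
- by move=> y u _ _; under eq_fun do rewrite E1; exact: cvg_cst.
Qed.

Lemma Rintegral_partial psi j : test_fun psi -> \int[mu]_y ('D_(dirv R j) psi y) = 0.
Proof.
move=> tp; have := integral_by_parts (dqlim_cst j 1) tp.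
have -> : \int[mu]_y (0 * psi y) = 0.
  under eq_Rintegral do rewrite mul0r.
  by rewrite /Rintegral integral0.
move=> /esym /eqP; rewrite oppr_eq0 => /eqP <-.
by apply: eq_Rintegral => y _; rewrite mul1r.
Qed.

(** Unfolded, this is the integral over R^3 of a derivative with bounded support. It makes constants
    orthogonal to strains and gives the limiting gradients mean zero. *)
Lemma ipL2_cst_partial (c : R) psi j : test_fun psi -> ipL2 mu Y (fun=> c) (Per g ('D_(dirv R j) psi)) = 0.
Proof.
move=> tp; have tp' := test_partial j tp.
have pc : Defs.periodic g (fun=> c : R) by move=> t _; exact: aeW.
rewrite -(unfold_test g_free (L2l_cst c) pc tp').
have [r bp] := test_bsupp tp'; have [M hM] := test_bounded tp'.
have i1 : mu.-integrable setT (EFin \o 'D_(dirv R j) psi).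
  have := loc_int_mul (L2l_loc_int (L2l_cst 1)) (test_measurable tp') hM bp.
  by apply: eq_integrable => // y _ /=; rewrite mul1r.
by rewrite RintegralZl // Rintegral_partial // mulr0.
Qed.

(* [symf G] is the projection of [e] on the closure of the strains of periodized
   test functions; by Korn's inequality, the full gradients of a minimizing
   sequence also converge, and by Poincare's inequality so do the functions. *)
Lemma strain_projection (e : V) : L2sq g e ->
  exists (phi : 'I_3 -> E -> R) (G : 'I_3 -> 'I_3 -> E -> R),
  [/\ forall i, L2l (phi i) /\ Defs.periodic g (phi i),
      forall i j, L2l (G i j) /\ Defs.periodic g (G i j),
      forall psi, test_fun psi -> forall i j,
        dpartial j (phi i) psi = \int[mu]_y (G i j y * psi y),
      forall i j, \int[mu]_(y in Y) G i j y = 0 &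
      forall ps, (forall i, test_fun (ps i)) ->
        ipsq g (e - symf G) (symf (pgrad g ps)) = 0].
Proof.
move=> Le.
pose W (u : V) := exists ps, (forall i, test_fun (ps i)) /\ u = symf (pgrad g ps).
have WP u : W u -> L2sq g u.
  by move=> [ps [tp ->]]; apply: L2sq_symf => //; exact: L2sq_pgrad.
have Wlin a u v : W u -> W v -> W (a *: u + v).
  move=> [p1 [t1 ->]] [p2 [t2 ->]]; exists (fun i y => a * p1 i y + p2 i y).
  by split; [exact: test_lin|rewrite pgrad_lin // symf_lin].
have W0 : W 0.
  have tz (i : 'I_3) := @test0 R; exists (fun _ _ => 0); split => //.
  (* Linearity applied to zero families yields a zero gradient without computing any derivative. *)
  have Z : pgrad g (fun=> fun=> 0) = -1 *: pgrad g (fun=> fun=> 0 : R) + pgrad g (fun=> fun=> 0).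
    rewrite -pgrad_lin //; congr pgrad; apply/funext => i; apply/funext => y.
    by rewrite mulr0 add0r.
  have Z' : pgrad g (fun=> fun=> 0) = 0 by rewrite Z scaleN1r addNr.
  rewrite Z'; apply/funext => i; apply/funext => j; apply/funext => y.
  by rewrite /symf addr0 mulr0.
have WD u v : W u -> W v -> W (u + v) by move=> u1 v1; rewrite -[u]scale1r; exact: Wlin.
have WZ a u : W u -> W (a *: u) by move=> u1; rewrite -[_ *: _]addr0; exact: Wlin.
have [w [p [Ww Lp wp ort]]] := hilbert_proj VH (L2sq_complete g_free) WP W0 WD WZ Le.
have /choice [ps hps] := Ww.
pose H n := pgrad g (ps n).
have tps n i : test_fun (ps n i) by have [] := hps n.
have LHn n : L2sq g (H n) by exact: L2sq_pgrad.
have wE n : w n = symf (H n) by have [_] := hps n.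
have Lw n : L2sq g (w n) by exact: WP.
have Hsub m n : H m - H n = pgrad g (fun i y => -1 * ps n i y + ps m i y).
  by rewrite pgrad_lin // scaleN1r addrC.
have LHmn m n : L2sq g (H m - H n) by exact: (phB VH).
have HC : cauchy_for (ipsq g) H.
  move=> d d0; have d2 : 0 < d / 2 by rewrite divr_gt0.
  have [N hN] := cvg_cauchy_for VH Lw Lp wp d2; exists N => m n Nm Nn.
  have := hN m n Nm Nn.
  have -> : w m - w n = symf (H m - H n).
    have -> : H m - H n = -1 *: H n + H m by rewrite scaleN1r addrC.
    by rewrite symf_lin !wE scaleN1r addrC.
  have := korn g_free (test_lin (-1) (tps n) (tps m)); rewrite -Hsub; lra.
have [G0 LG0 HG0] := L2sq_complete g_free LHn HC.
have LsG0 := L2sq_symf g_free LG0.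
have LHG n : L2sq g (H n - G0) by exact: (phB VH).
(* Symmetrization does not increase the norm, so the strains also converge to [symf G0], which
   therefore coincides with the projection [p] up to length zero. *)
have wG0 : ipsq g (w n - symf G0) (w n - symf G0) @[n --> \oo] --> 0.
  apply: (squeeze_cvgr _ (cvg_cst (0 : R)) HG0); apply: nearW => n.
  have LwG : L2sq g (w n - symf G0) by exact: (phB VH).
  rewrite (ph_ge0 VH LwG) /=.
  have -> : w n - symf G0 = symf (H n - G0).
    have -> : H n - G0 = -1 *: G0 + H n by rewrite scaleN1r addrC.
    by rewrite symf_lin wE scaleN1r addrC.
  exact: ipsq_symf_le.
have pG0 := ip_cvg_uniq VH Lw Lp LsG0 wp wG0.
have [K [K0 hK]] := pphi_poincare g_free.
have /choice [phi0 hphi0] : forall i, exists f, L2on mu Y f /\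
    ipL2 mu Y (pphi g (ps n) i - f) (pphi g (ps n) i - f) @[n --> \oo] --> 0.
  move=> i.
  have Lphi n : L2on mu Y (pphi g (ps n) i) by apply: L2l_cell => //; exact: pphi_L2l.
  have [|f Lf cf] := L2on_complete (u := fun n => pphi g (ps n) i) mY Lphi; last by exists f.
  move=> d d0; have K1 : 0 < K + 1 by rewrite ltr_wpDl.
  have dK : 0 < d / (K + 1) by rewrite divr_gt0.
  have [N hN] := HC _ dK; exists N => m n Nm Nn.
  have := hK _ i (test_lin (-1) (tps n) (tps m)); rewrite -Hsub pphi_lin // scaleN1r addrC.
  move=> /le_trans; apply; apply: (@le_trans _ _ (K * (d / (K + 1)))).
    by apply: ler_wpM2l => //; exact: hN.
  by rewrite mulrA ler_pdivrMr // mulrC ler_pM2l // lerDl.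
have /choice [phi hphi] : forall i, exists F : E -> R,
    [/\ L2l F, Defs.periodic g F & {ae mu, forall y : E, Y y -> F y = phi0 i y}].
  by move=> i; apply: periodic_extension => //; have [] := hphi0 i.
have /choice [GG hGG] : forall ij : 'I_3 * 'I_3, exists F : E -> R,
    [/\ L2l F, Defs.periodic g F & {ae mu, forall y : E, Y y -> F y = G0 ij.1 ij.2 y}].
  by move=> ij; apply: periodic_extension => //; exact: LG0.
pose G i j := GG (i, j).
have hG i j : [/\ L2l (G i j), Defs.periodic g (G i j) &
    {ae mu, forall y : E, Y y -> G i j y = G0 i j y}] by exact: hGG (i, j).
have LG i j : L2l (G i j) by have [] := hG i j.
have pG i j : Defs.periodic g (G i j) by have [] := hG i j.
have Lphi i : L2l (phi i) by have [] := hphi i.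
have pphi' i : Defs.periodic g (phi i) by have [] := hphi i.
(* Convergence against a fixed function is all that the weak formulation asks for, and it does not
   distinguish the limit from its periodic extension. *)
have toG i j q : L2on mu Y q -> ipL2 mu Y (H n i j) q @[n --> \oo] --> ipL2 mu Y (G i j) q.
  move=> Lq; have L1 := LG0 i j.
  have c1 : ipL2 mu Y (H n i j - G0 i j) (H n i j - G0 i j) @[n --> \oo] --> 0.
    apply: (squeeze_cvgr _ (cvg_cst (0 : R)) HG0); apply: nearW => n.
    by rewrite (ph_ge0 LH (LHG n i j)) /= (ipL2_le_ipsq i j (LHG n)).
  have -> : ipL2 mu Y (G i j) q = ipL2 mu Y (G0 i j) q.
    have [[m1 _] _ h1] := hG i j; have [m2 _] := L1; have [m3 _] := Lq.
    by apply: ae_ipL2 => //; exact: aeW.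
  exact: (ip_cvg LH (fun n => LHn n i j) L1 Lq c1).
have toP i q : L2on mu Y q -> ipL2 mu Y (pphi g (ps n) i) q @[n --> \oo] --> ipL2 mu Y (phi i) q.
  move=> Lq; have [L1 c1] := hphi0 i.
  have -> : ipL2 mu Y (phi i) q = ipL2 mu Y (phi0 i) q.
    have [[m1 _] _ h1] := hphi i; have [m2 _] := L1; have [m3 _] := Lq.
    by apply: ae_ipL2 => //; exact: aeW.
  apply: (ip_cvg LH _ L1 Lq c1) => n.
  by apply: L2l_cell => //; exact: pphi_L2l.
have LP psi : test_fun psi -> L2on mu Y (Per g psi).
  by move=> tp; apply: L2l_cell => //; exact: L2l_Per.
exists phi, G; split => //.
- move=> psi tp i j; rewrite /dpartial (unfold_test g_free (Lphi i) (pphi' i) (test_partial j tp)).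
  rewrite (unfold_test g_free (LG i j) (pG i j) tp).
  have c1 := toG i j _ (LP _ tp); have c2 := toP i _ (LP _ (test_partial j tp)).
  rewrite -(cvg_lim (@Rhausdorff R) c1); apply/esym/(cvg_lim (@Rhausdorff R)).
  apply: cvg_trans (cvgN c2); apply: near_eq_cvg; apply: nearW => n /=.
  have Lpn := pphi_L2l g_free (tps n i).
  have LH1 : L2l (H n i j) by apply: L2l_Per => //; exact: test_partial.
  rewrite fctE -(unfold_test g_free Lpn (@pphi_periodic R g (ps n) i) (test_partial j tp)).
  rewrite -(unfold_test g_free LH1 (@periodic_Per R g _) tp).
  by rewrite (integral_by_parts (pphi_dqlim g_free j (tps n i)) tp).
- move=> i j; have L1 : L2on mu Y (fun=> 1) by apply: L2l_cell => //; exact: L2l_cst.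
  have := toG i j _ L1.
  have -> : (fun n => ipL2 mu Y (H n i j) (fun=> 1)) = fun=> 0.
    apply/funext => n; by rewrite (phC LH (LHn n i j) L1) /H /pgrad ipL2_cst_partial.
  move=> /(cvg_lim (@Rhausdorff R)); rewrite lim_cst; last exact: Rhausdorff.
  by move=> ->; apply: eq_Rintegral => y _; rewrite mulr1.
- move=> q tq; have Lz : L2sq g (symf (pgrad g q)) by apply: WP; exists q.
  have LsG : L2sq g (symf G) by apply: L2sq_symf => // i j; apply: L2l_cell.
  have -> : ipsq g (e - symf G) (symf (pgrad g q)) = ipsq g (e - symf G0) (symf (pgrad g q)).
    apply: eq_bigr => i _; apply: eq_bigr => j _.
    apply: ae_ipL2 => //; last exact: aeW.
    + by have [] := phB VH Le LsG i j.
    + by have [] := phB VH Le LsG0 i j.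
    + by have [] := Lz i j.
    + by have [] := Lz i j.
    + have [_ _ h1] := hG i j; have [_ _ h2] := hG j i.
      move: h1 h2; apply: aeS2 => y h1 h2 Yy.
      change (e i j y - 2^-1 * (G i j y + G j i y) = e i j y - 2^-1 * (G0 i j y + G0 j i y)).
      by rewrite h1 // h2.
  have -> : e - symf G0 = (e - p) + (p - symf G0) by rewrite addrA subrK.
  have L1 : L2sq g (e - p) by exact: (phB VH).
  have L2 : L2sq g (p - symf G0) by exact: (phB VH).
  rewrite (phDl VH) // ort ?add0r; last by exists q.
  have := ph_csq VH L2 Lz; rewrite pG0 mul0r => h.
  by apply/eqP; rewrite -sqrf_eq0 eq_le h sqr_ge0.
Qed.

End projection.

(** * Matrix fields *)

Section matrix_fields.
Variable R : realType.
Local Notation E := (R * R * R)%type.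
Local Notation EB :=
  (measurableTypeR R * measurableTypeR R * measurableTypeR R)%type.
Local Notation mu := (leb3 R).

(** Makes the chosen representative [grad v] comparable with any explicit weak gradient. *)
Lemma weak_grad_unique (v : E -> 'cV[R]_3) (G G' : E -> 'M[R]_3) :
  is_weak_grad v G -> is_weak_grad v G' -> {ae mu, forall y : E, G y = G' y}.
Proof.
move=> [LG hG] [LG' hG'].
suff h i j : {ae mu, forall y : E, G y i j = G' y i j}.
  have := ae_forall (fun ij : 'I_3 * 'I_3 => h ij.1 ij.2).
  by apply: aeS => y hy; apply/matrixP => i j; exact: (hy (i, j)).
have L1 := (L2l_L2loc _).2 (LG i j); have L2 := (L2l_L2loc _).2 (LG' i j).
have Lf := L2l_sub L1 L2; set f := (fun y : E => _) in Lf.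
have f0 psi : test_fun psi -> \int[mu]_y (f y * psi y) = 0.
  move=> tp; have [r bp] := test_bsupp tp; have [M hM] := test_bounded tp.
  have mp := test_measurable tp.
  have := hG psi tp i j; rewrite hG' // => /esym/eqP; rewrite -subr_eq0 => /eqP <-.
  rewrite -RintegralB //; [|exact: (loc_int_mul (L2l_loc_int L1) mp hM bp)
    |exact: (loc_int_mul (L2l_loc_int L2) mp hM bp)].
  by apply: eq_Rintegral => y _; rewrite mulrBl.
(* The difference is integrable only locally, so each box is treated separately and the countably
   many null sets are collected. *)
pose bx (n : nat) : set E := obox (- n%:R, - n%:R, - n%:R) (n%:R, n%:R, n%:R).
have bn n : {ae mu, forall y : E, f y * \1_(bx n) y = 0}.
  have mb : measurable (bx n : set EB) by exact: measurable_obox.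
  apply: (@test_orthogonal_eq0 R _ (- n%:R, - n%:R, - n%:R) (n%:R, n%:R, n%:R)).
  - have bb : bsupp n%:R (\1_(bx n) : E -> R).
      move=> y ny; rewrite indicE; case: (boolP (_ \in _)) => // /set_mem [/=].
      move=> h1 h2 h3; case: ny; split; rewrite ler_norml; lra.
    apply: (loc_int_mul (M := 1) (L2l_loc_int Lf) (measurable_indic mb) _ bb) => y.
    by rewrite indicE; case: (_ \in _); rewrite ?normr1 ?normr0.
  - by move=> y ny; rewrite indicE memNset // mulr0.
  - move=> psi tp p0; rewrite -[RHS](f0 psi tp); apply: eq_Rintegral => y _.
    rewrite indicE; case: (boolP (_ \in _)); first by rewrite mulr1.
    by move=> /negP ny; rewrite p0 ?mulr0 // => h; apply: ny; rewrite inE.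
have := ae_foralln bn; apply: aeS => y hy.
have [n hn] := in_cub y; have := hy n.+1; rewrite indicE mem_set ?mulr1.
  by move=> /eqP; rewrite subr_eq0 => /eqP.
have n1 : n%:R < n.+1%:R :> R by rewrite ltr_nat.
case: hn => h1 h2 h3; move: h1 h2 h3; rewrite !ler_norml.
by move: n1; move: (n.+1%:R : R) => N *; split; rewrite /=; lra.
Qed.

Lemma grad_weak (v : E -> 'cV[R]_3) : H1loc v -> is_weak_grad v (grad v).
Proof. by move=> [_ [G hG]]; apply: (@xgetPex _ (fun=> 0) [set G | is_weak_grad v G]); exists G. Qed.

Lemma grads_ae (v : E -> 'cV[R]_3) (G : E -> 'M[R]_3) : L2locM v -> is_weak_grad v G ->
  {ae mu, forall y : E, grads v y = 2^-1 *: (G y + (G y)^T)}.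
Proof.
move=> Lv hG; have hv : H1loc v by split => //; exists G.
by apply: aeS (weak_grad_unique (grad_weak hv) hG) => y h; rewrite /grads h.
Qed.

Lemma L2l_entry m n (F : E -> 'M[R]_(m, n)) : L2locM F -> forall i j, L2l (fun y => F y i j).
Proof. by move=> LF i j; apply/L2l_L2loc; exact: LF. Qed.

Lemma L2locM_entry m n (F : E -> 'M[R]_(m, n)) : (forall i j, L2l (fun y => F y i j)) -> L2locM F.
Proof. by move=> LF i j; apply/L2l_L2loc; exact: LF. Qed.

Lemma loc_int_sum (I : Type) (s : seq I) (F : I -> E -> R) :
  (forall i, loc_int (F i)) -> loc_int (fun y => \sum_(i <- s) F i y).
Proof.
move=> lF; elim: s => [|i s IH].
  have := L2l_loc_int (@L2l_cst R 0); congr loc_int; apply/funext => y; by rewrite big_nil.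
have [m1 i1] := lF i; have [m2 i2] := IH.
rewrite (_ : (fun y => _) = (fun y => F i y + \sum_(j <- s) F j y)); last first.
  by apply/funext => y; rewrite big_cons.
split; first exact: measurable_funD.
by move=> r; exact: (integrable_addR (measurable_cub r) (i1 r) (i2 r)).
Qed.

Lemma loc_int_frob (A B : E -> 'M[R]_3) : L2locM A -> L2locM B ->
  loc_int (fun y => frob (A y) (B y)).
Proof.
move=> /L2l_entry LA /L2l_entry LB; apply: loc_int_sum => i; apply: loc_int_sum => j.
exact: L2l_mul.
Qed.

Lemma frobC (A B : 'M[R]_3) : frob A B = frob B A.
Proof. by apply: eq_bigr => i _; apply: eq_bigr => j _; rewrite mulrC. Qed.

Lemma frobDl (A B C : 'M[R]_3) : frob (A + B) C = frob A C + frob B C.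
Proof.
rewrite /frob -big_split; apply: eq_bigr => i _; rewrite -big_split.
by apply: eq_bigr => j _; rewrite mxE mulrDl.
Qed.

Lemma frobDr (A B C : 'M[R]_3) : frob C (A + B) = frob C A + frob C B.
Proof. by rewrite frobC frobDl !(frobC C). Qed.

Lemma frobZl (a : R) (A B : 'M[R]_3) : frob (a *: A) B = a * frob A B.
Proof.
rewrite /frob big_distrr /=; apply: eq_bigr => i _; rewrite big_distrr /=.
by apply: eq_bigr => j _; rewrite mxE mulrA.
Qed.

Lemma frobZr (a : R) (A B : 'M[R]_3) : frob A (a *: B) = a * frob A B.
Proof. by rewrite frobC frobZl frobC. Qed.

Lemma frob_tr (A B : 'M[R]_3) : symM A -> frob A B^T = frob A B.
Proof.
move=> sA; rewrite /frob exchange_big; apply: eq_bigr => i _; apply: eq_bigr => j _.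
by rewrite mxE -[in RHS]sA mxE.
Qed.

Lemma frob_sym (A G : 'M[R]_3) : symM A -> frob A (2^-1 *: (G + G^T)) = frob A G.
Proof. by move=> sA; rewrite frobZr frobDr frob_tr //; field. Qed.

Lemma symM_sym (G : 'M[R]_3) : symM (2^-1 *: (G + G^T)).
Proof. by rewrite /symM /= linearZ /= linearD /= trmxK addrC. Qed.

Lemma frob_eq0 (A : 'M[R]_3) : frob A A = 0 -> A = 0.
Proof.
move=> h; apply/matrixP => i j; rewrite mxE; apply/eqP.
have p k : 0 <= \sum_l A k l * A k l by apply: sumr_ge0 => l _; rewrite -expr2 sqr_ge0.
move: h; rewrite /frob => /eqP; rewrite psumr_eq0 // => /allP /(_ i).
rewrite mem_index_enum /= => /(_ isT); rewrite psumr_eq0; last first.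
  by move=> l _; rewrite -expr2 sqr_ge0.
by move=> /allP /(_ j); rewrite mem_index_enum /= => /(_ isT); rewrite mulf_eq0 orbb.
Qed.

Variable g : 'I_3 -> E.
Hypothesis g_free : free [seq g i | i : 'I_3].
Local Notation Y := (cell g).
Let mY := measurable_cell g_free.

Lemma periodic_entry m n (F : E -> 'M[R]_(m, n)) i j :
  Defs.periodic g F -> Defs.periodic g (fun y => F y i j).
Proof. by move=> pF t lt; apply: aeS (pF t lt) => y ->. Qed.

Lemma entry_periodic m n (F : E -> 'M[R]_(m, n)) :
  (forall i j, Defs.periodic g (fun y => F y i j)) -> Defs.periodic g F.
Proof.
move=> pF t lt; have := ae_forall (fun ij : 'I_m * 'I_n => pF ij.1 ij.2 t lt).
by apply: aeS => y hy; apply/matrixP => i j; exact: (hy (i, j)).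
Qed.

Lemma Rintegral_frob (A B : E -> 'M[R]_3) : L2locM A -> L2locM B ->
  \int[mu]_(y in Y) frob (A y) (B y) = \sum_i \sum_j \int[mu]_(y in Y) (A y i j * B y i j).
Proof.
move=> /L2l_entry LA /L2l_entry LB.
have I i j : loc_int (fun y => A y i j * B y i j) by exact: L2l_mul.
have I1 i j := integrable_cell g_free (I i j).
have J i : mu.-integrable Y (EFin \o (fun y => \sum_j A y i j * B y i j)).
  by apply: (integrable_cell g_free); apply: loc_int_sum => j.
rewrite (Rintegral_sum _ mY J); apply: eq_bigr => i _.
by rewrite (Rintegral_sum _ mY (I1 i)).
Qed.

Lemma stress_orthogonal (m : E -> 'M[R]_3) (v : E -> 'cV[R]_3) (G : E -> 'M[R]_3) :
  L2pers g m -> div_free m -> H1per g v -> is_weak_grad v G ->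
  \int[mu]_(y in Y) frob (m y) (G y) = 0.
Proof.
move=> [Lm pm sm] dm [[Lv _] pv] [LG hG]; rewrite Rintegral_frob //.
apply: (div_grad_orthogonal g_free (m := fun i j y => m y i j) (v := fun i y => v y i 0)
  (G := fun i j y => G y i j)) => //.
- exact: L2l_entry.
- by move=> i; exact: L2l_entry.
- exact: L2l_entry.
- by move=> i j; exact: periodic_entry.
- by move=> i; exact: periodic_entry.
Qed.

End matrix_fields.

(** * The decomposition *)

Section helmholtz.
Variable R : realType.
Local Notation E := (R * R * R)%type.
Local Notation EB :=
  (measurableTypeR R * measurableTypeR R * measurableTypeR R)%type.
Local Notation mu := (leb3 R).
Variable g : 'I_3 -> E.
Hypothesis g_free : free [seq g i | i : 'I_3].
Local Notation Y := (cell g).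
Local Notation V := ('I_3 -> 'I_3 -> EB -> R).
Let mY := measurable_cell g_free.
Let LH := L2on_prehilbert mu mY.
Let VH := prehilbert_sq g_free.

Lemma Per_partial0 j : Per g ('D_(dirv R j) (fun=> 0)) = fun=> 0.
Proof.
apply/funext => y; rewrite /Per; apply: fsbig1 => k _; exact: derive_cst.
Qed.

(** A symmetric field does not see the skew part of [z]: orthogonality to strains becomes
    orthogonality to full gradients, which is the form of [div_free]. *)
Lemma ipsq_symf_r (T z : V) : L2sq g T -> L2sq g z ->
  (forall k l, {ae mu, forall y, T k l y = T l k y}) -> ipsq g T (symf z) = ipsq g T z.
Proof.
move=> LT Lz sT; rewrite /ipsq.
under eq_bigr => k _.
  under eq_bigr => l _.
    rewrite symfE (phZr LH) //; last exact: (phD LH).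
    rewrite (phC LH) //; last exact: (phD LH).
    rewrite (phDl LH) // (phC LH (Lz k l)) // (phC LH (Lz l k)) //.
    have -> : ipL2 mu Y (T k l) (z l k) = ipL2 mu Y (T l k) (z l k).
      have [m1 _] := LT k l; have [m2 _] := LT l k; have [m3 _] := Lz l k.
      apply: ae_ipL2 => //; last exact: aeW.
      by apply: aeS (sT k l) => y h _; exact: h.
    rewrite mulrDr; over.
  rewrite big_split /=; over.
rewrite big_split /= [X in _ + X]exchange_big /= -big_split; apply: eq_bigr => k _.
by rewrite -big_split; apply: eq_bigr => l _ /=; field.
Qed.

Lemma meanM_sym (e : E -> 'M[R]_3) : L2pers g e -> symM (meanM g e).
Proof.
move=> [/L2l_entry Le _ se]; apply/matrixP => i j; rewrite !mxE; congr (_ * _).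
apply: ae_eq_Rintegral => //; [exact: (Le j i).1|exact: (Le i j).1|].
by apply: aeS se => y h; rewrite -[in LHS]h mxE.
Qed.

Lemma helmholtz (e : E -> 'M[R]_3) : L2pers g e ->
  exists (phi : E -> 'cV[R]_3) (G tau : E -> 'M[R]_3),
  [/\ H1per g phi, is_weak_grad phi G, forall i j, \int[mu]_(y in Y) G y i j = 0,
      stress g 0 tau &
      forall y, e y = meanM g e + 2^-1 *: (G y + (G y)^T) + tau y].
Proof.
move=> Le; have sA := meanM_sym Le; have [/L2l_entry Lij pe se] := Le.
set A := meanM g e in sA *.
pose e0 : V := fun i j y => e y i j.
have Le0 : L2sq g e0 by move=> i j; apply: L2l_cell => //; exact: Lij.
have [phi [G [hphi hG wG mG ort]]] := strain_projection g_free Le0.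
have LG i j : L2l (G i j) by have [] := hG i j.
have pG i j : Defs.periodic g (G i j) by have [] := hG i j.
pose phi' (y : E) : 'cV[R]_3 := \col_i phi i y.
pose G' (y : E) : 'M[R]_3 := \matrix_(i, j) G i j y.
have GE i j : (fun y => G' y i j) = G i j by apply/funext => y; rewrite mxE.
have phiE i k : (fun y => phi' y i k) = phi i by apply/funext => y; rewrite mxE.
have wG' : is_weak_grad phi' G'.
  split; first by apply: L2locM_entry => i j; rewrite GE.
  by move=> psi tp i j; rewrite phiE wG //; apply: eq_Rintegral => y _; rewrite mxE.
have Hphi : H1per g phi'.
  split; last by apply: entry_periodic => i j; rewrite phiE; have [] := hphi i.
  split; last by exists G'.
  by apply: L2locM_entry => i j; rewrite phiE; have [] := hphi i.
pose tau (y : E) := e y - A - 2^-1 *: (G' y + (G' y)^T).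
have tauE i j y : tau y i j = e y i j - A i j - 2^-1 * (G i j y + G j i y).
  by rewrite !mxE.
pose T : V := fun i j y => tau y i j.
have TE i j : T i j = (fun y => e y i j - A i j - 2^-1 * (G i j y + G j i y)).
  by apply/funext => y; exact: tauE.
have LTl i j : L2l (T i j).
  rewrite TE; apply: L2l_sub; first by apply: L2l_sub => //; exact: L2l_cst.
  by apply: L2l_scale; exact: L2l_add.
have pT i j : Defs.periodic g (T i j).
  move=> t lt; have h1 := pe t lt; have h2 := pG i j t lt; have h3 := pG j i t lt.
  have h23 := aeS2 (fun y (a : G i j (y + t) = G i j y) (b : G j i (y + t) = G j i y) => conj a b) h2 h3.
  by move: h1 h23; apply: aeS2 => y e1 [e2 e3]; rewrite TE e1 e2 e3.
have LT : L2sq g T by move=> i j; apply: L2l_cell.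
have sT : {ae mu, forall y : E, symM (tau y)}.
  move: se; apply: aeS => y sy; apply/matrixP => i j; rewrite mxE !tauE.
  by rewrite -[in LHS]sy -[in LHS]sA !mxE [G j i y + _]addrC.
have sT' k l : {ae mu, forall y, T k l y = T l k y}.
  by apply: aeS sT => y h; rewrite /T -[in LHS]h mxE.
exists phi', G', tau; split => //.
- by move=> i j; rewrite -(mG i j); apply: eq_Rintegral => y _; rewrite mxE.
- split.
  + split => //; first exact: L2locM_entry.
    exact: entry_periodic.
  + move=> psi tp i.
    pose ps (k : 'I_3) : E -> R := if k == i then psi else (fun=> 0).
    have tps k : test_fun (ps k) by rewrite /ps; case: eqP => // _; exact: test0.
    have Lz := L2sq_pgrad g_free tps; have Lsz := L2sq_symf g_free Lz.
    pose cA : V := fun k l => fun=> A k l.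
    have LcA : L2sq g cA by move=> k l; apply: L2l_cell => //; exact: L2l_cst.
    have LsG : L2sq g (symf G) by apply: L2sq_symf => // k l; exact: L2l_cell.
    have TV : T = (e0 - symf G) - cA.
      apply/funext => k; apply/funext => l; apply/funext => y; rewrite TE.
      change (e y k l - A k l - 2^-1 * (G k l y + G l k y) =
        e y k l - 2^-1 * (G k l y + G l k y) - A k l); ring.
    (* [e0 - symf G] is orthogonal to strains by the projection, the constant [A] because periodized
       derivatives have mean zero. *)
    have z0 : ipsq g T (symf (pgrad g ps)) = 0.
      rewrite TV (phBl VH) //; last exact: (phB VH).
      rewrite ort // sub0r; apply/eqP; rewrite oppr_eq0; apply/eqP.
      rewrite /ipsq big1 // => k _; rewrite big1 // => l _.
      rewrite symfE (phZr LH) //; last exact: (phD LH).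
      rewrite (phC LH) //; last exact: (phD LH).
      rewrite (phDl LH) // (phC LH (Lz k l)) // (phC LH (Lz l k)) //.
      by rewrite !ipL2_cst_partial // addr0 mulr0.
    rewrite ipsq_symf_r // /ipsq (bigD1 i) //= [X in _ + X]big1 ?addr0 in z0; last first.
      move=> k /negPf ki; rewrite big1 // => l _.
      rewrite /pgrad /ps ki Per_partial0 /ipL2.
      under eq_Rintegral do rewrite mulr0.
      by rewrite (Rintegral_cst _ mY) mul0r.
    apply/eqP; rewrite -oppr_eq0 -sumrN; apply/eqP; rewrite -[RHS]z0.
    apply: eq_bigr => j _; rewrite /dpartial opprK.
    rewrite (unfold_test g_free (LTl i j) (pT i j) (test_partial j tp)).
    by rewrite /pgrad /ps eqxx.
  + have V0 : fine (mu Y) != 0 by rewrite gt_eqF // leb3_cell_gt0.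
    apply/matrixP => i j; rewrite !mxE.
    have -> : \int[mu]_(y in Y) tau y i j = \int[mu]_(y in Y) T i j y by [].
    have Ie := integrable_cell g_free (L2l_loc_int (Lij i j)).
    have IA := integrable_cell g_free (L2l_loc_int (L2l_cst (A i j))).
    have I1 := integrable_cell g_free (L2l_loc_int (LG i j)).
    have I2 := integrable_cell g_free (L2l_loc_int (LG j i)).
    have I3 := integrable_addR mY I1 I2.
    rewrite TE RintegralB //; last 2 first.
    * exact: (integrable_cell g_free (L2l_loc_int (L2l_sub (Lij i j) (L2l_cst (A i j))))).
    * exact: integrable_scaleR.
    rewrite RintegralB // RintegralZl // RintegralD // !mG addr0 mulr0 subr0.
    by rewrite (Rintegral_cst _ mY) /A !mxE mulrAC mulVf // mul1r subrr mulr0.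
- by move=> y; rewrite /tau; apply/matrixP => i j; rewrite !mxE; ring.
Qed.

End helmholtz.

(** * The compliance tensor *)

Section nonmeasurable.
Import HBNNSimple.
Local Open Scope ereal_scope.
Context d (T : measurableType d) (R : realType) (mu : {measure set T -> \bar R}).

(* The integrands need not be measurable: a simple function below [f] stays
   below [g] once it is set to [0] on a negligible set. *)
Lemma ge0_ae_le_integral_nonmeas (f g : T -> \bar R) :
  (forall x, 0 <= f x) -> (forall x, 0 <= g x) ->
  {ae mu, forall x, f x <= g x} -> \int[mu]_x f x <= \int[mu]_x g x.
Proof.
move=> f0 g0 [N [mN N0 fgN]]; rewrite !ge0_integralTE //.
apply: ge_ereal_sup => _ [h hf <-]; apply: ereal_sup_ubound.
have mCN : measurable (~` N) by exact: measurableC.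
exists (proj_nnsfun h mCN).
  move=> x /=; rewrite mindicE; case: (boolP (x \in ~` N)) => [/set_mem nN|_].
    rewrite mulr1; apply: le_trans (hf x) _; apply: contrapT => h1; apply: nN; exact: fgN.
  by rewrite mulr0.
rewrite -!integralT_nnsfun; apply: ae_eq_integral => //.
- by apply/measurable_EFinP; exact: measurable_funP.
- by apply/measurable_EFinP; exact: measurable_funP.
exists N; split => // x /= h1; apply: contrapT => nN; apply: h1 => _.
by rewrite mindicE mem_set // mulr1.
Qed.

Lemma ge0_ae_eq_integral_nonmeas (f g : T -> \bar R) :
  (forall x, 0 <= f x) -> (forall x, 0 <= g x) ->
  {ae mu, forall x, f x = g x} -> \int[mu]_x f x = \int[mu]_x g x.
Proof.
move=> f0 g0 fg; apply/eqP; rewrite eq_le; apply/andP; split;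
  apply: ge0_ae_le_integral_nonmeas => //; case: fg => N [mN N0 fgN];
  exists N; split => // x h; apply: fgN => /= e; by case: h => /=; rewrite e.
Qed.

Lemma ae_eq_Rintegral_nonmeas (D : set T) (f g : T -> R) :
  {ae mu, forall x, f x = g x} -> (\int[mu]_(x in D) f x = \int[mu]_(x in D) g x)%R.
Proof.
move=> fg; congr fine; rewrite integralE [RHS]integralE.
congr (_ - _); rewrite integral_mkcond [RHS]integral_mkcond;
  apply: ge0_ae_eq_integral_nonmeas => //;
  try (by move=> x; rewrite patchE; case: ifP => //; rewrite ?funepos_ge0 ?funeneg_ge0);
  case: fg => N [mN N0 fgN]; exists N; split => // x h; apply: fgN => /= e; apply: h;
  by rewrite /= !patchE; case: ifP => // _; rewrite ?funeposE ?funenegE /= e.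
Qed.

End nonmeasurable.

(** The inverse is [x] times the power -1 of its square, a real power function on nonnegative
    arguments; at 0 both sides are 0. *)
Lemma measurable_inv (R : realType) : measurable_fun [set: R] (@GRing.inv R).
Proof.
have -> : @GRing.inv R = (fun x : R => x * (x ^+ 2) `^ (-1)).
  apply/funext => x; rewrite powR_inv1 ?sqr_ge0 //.
  have [->|x0] := eqVneq x 0; first by rewrite invr0 mul0r.
  by field.
apply: measurable_funM => //.
have h := @measurable_powR R (-1).
by apply: (measurableT_comp h); exact: measurable_funX.
Qed.

Section inverse_matrix.
Context d (T : measurableType d) (R : realType).

Lemma measurable_det (k : nat) (F : T -> 'M[R]_k) :
  (forall i j, measurable_fun [set: T] (fun x => F x i j)) ->
  measurable_fun [set: T] (fun x => \det (F x)).
Proof.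
move=> mF; apply: measurable_sum => s; apply: measurable_funM => //.
by apply: measurable_prod => i _; exact: mF.
Qed.

Lemma measurable_adj (k : nat) (F : T -> 'M[R]_k) :
  (forall i j, measurable_fun [set: T] (fun x => F x i j)) ->
  forall i j, measurable_fun [set: T] (fun x => (\adj (F x)) i j).
Proof.
move=> mF i j.
have -> : (fun x => (\adj (F x)) i j) =
    (fun x => (-1) ^+ (j + i) * \det (row' j (col' i (F x)))).
  by apply/funext => x; rewrite mxE.
apply: measurable_funM => //; apply: measurable_det => a b.
have -> : (fun x => row' j (col' i (F x)) a b) = (fun x => F x (lift j a) (lift i b)).
  by apply/funext => x; rewrite !mxE.
exact: mF.
Qed.

End inverse_matrix.

Section tensor_inverse.
Variable R : realType.
Implicit Types (T : tensor4 R) (xi eta sigma : 'M[R]_3).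

Definition symp xi : 'M[R]_3 := 2^-1 *: (xi + xi^T).

Lemma sympE xi : symM xi -> symp xi = xi.
Proof.
by move=> s; rewrite /symp s; apply/matrixP => i j; rewrite !mxE; field.
Qed.

Lemma tapp_linear T : linear (tapp T).
Proof.
move=> a xi eta; apply/matrixP => i j; rewrite !mxE big_distrr -big_split.
apply: eq_bigr => k _ /=; rewrite big_distrr -big_split; apply: eq_bigr => l _ /=.
by rewrite !mxE; ring.
Qed.

HB.instance Definition _ T := GRing.isLinear.Build R 'M[R]_3 'M[R]_3 *:%R (tapp T) (tapp_linear T).

(* [tapp T] on symmetric matrices, the identity on antisymmetric ones. *)
Definition tapp_ext T xi : 'M[R]_3 := tapp T (symp xi) + (xi - symp xi).

Lemma symp_linear : linear symp.
Proof. by move=> a xi eta; apply/matrixP => i j; rewrite !mxE; ring. Qed.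

Lemma tapp_ext_linear T : linear (tapp_ext T).
Proof.
move=> a xi eta; rewrite /tapp_ext symp_linear linearP /=.
by apply/matrixP => i j; rewrite !mxE; ring.
Qed.

HB.instance Definition _ T :=
  GRing.isLinear.Build R 'M[R]_3 'M[R]_3 *:%R (tapp_ext T) (tapp_ext_linear T).

(** Cramer's formula for the inverse of [tapp_ext T]: determinant and adjugate are polynomial in the
    entries of [T], so the inverse depends measurably on the point. *)
Definition tapp_inv T sigma : 'M[R]_3 :=
  vec_mx (mxvec sigma *m ((\det (lin_mx (tapp_ext T)))^-1 *: \adj (lin_mx (tapp_ext T)))).

Variables (T : tensor4 R) (alpha : R).
Hypotheses (alpha0 : 0 < alpha) (T_sym : elastic_sym T)
  (T_coe : forall xi, symM xi -> alpha * frob xi xi <= frob (tapp T xi) xi).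

Lemma tapp_sym_eq0 xi : symM xi -> tapp T xi = 0 -> xi = 0.
Proof.
move=> s t0; apply: frob_eq0; apply/eqP; rewrite eq_le; apply/andP; split; last first.
  by apply: sumr_ge0 => i _; apply: sumr_ge0 => j _; rewrite -expr2 sqr_ge0.
have := T_coe s; rewrite t0; have -> : frob 0 xi = 0.
  by rewrite -(scale0r (0 : 'M[R]_3)) frobZl mul0r.
by rewrite pmulr_rle0.
Qed.

(** [tapp T (symp xi)] is symmetric and [xi - symp xi] is skew; their sum is symmetric only if the
    skew term vanishes. *)
Lemma tapp_ext_sym_part xi sigma : symM sigma -> tapp_ext T xi = sigma ->
  symM xi /\ tapp T xi = sigma.
Proof.
move=> ss h; have sT : symM (tapp T (symp xi)) by apply: T_sym.1; exact: symM_sym.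
have hs : (xi - symp xi) = sigma - tapp T (symp xi) by rewrite -h /tapp_ext addrAC subrr add0r.
have anti : (xi - symp xi)^T = - (xi - symp xi).
  by apply/matrixP => i j; rewrite !mxE; field.
have h0 : xi - symp xi = 0.
  have : (xi - symp xi)^T = xi - symp xi by rewrite hs linearB /= ss sT.
  rewrite anti => /matrixP h1; apply/matrixP => i j; have := h1 i j; rewrite !mxE => h2.
  lra.
have e1 : xi = symp xi by apply/eqP; rewrite -subr_eq0 h0.
split; first by rewrite e1; exact: symM_sym.
by rewrite -h /tapp_ext h0 addr0 -e1.
Qed.

Lemma tapp_ext_unit : lin_mx (tapp_ext T) \in unitmx.
Proof.
rewrite -row_free_unit; apply: inj_row_free => v.
rewrite -[v]vec_mxK mul_vec_lin => /(congr1 vec_mx); rewrite mxvecK linear0 => h.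
have s0 : symM (0 : 'M[R]_3) by rewrite /symM /= trmx0.
by have [s1 t1] := tapp_ext_sym_part s0 h; rewrite (tapp_sym_eq0 s1 t1) linear0.
Qed.

Lemma tapp_invP sigma : symM sigma -> symM (tapp_inv T sigma) /\ tapp T (tapp_inv T sigma) = sigma.
Proof.
move=> ss; apply: tapp_ext_sym_part => //.
apply: (can_inj (@mxvecK _ 3 3)); rewrite -mul_vec_lin /tapp_inv vec_mxK -mulmxA.
have := tapp_ext_unit; rewrite unitmxE unitfE => d0.
by rewrite -scalemxAl mul_adj_mx scale_scalar_mx mulVf // mulmx1.
Qed.

Lemma tapp_sym_inj : {in @symM R &, injective (tapp T)}.
Proof.
move=> x y /set_mem sx /set_mem sy e; apply/eqP; rewrite -subr_eq0; apply/eqP.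
by apply: tapp_sym_eq0; [rewrite /symM /= linearB /= sx sy|rewrite linearB /= e subrr].
Qed.

Lemma compliance_tapp xi : symM xi -> compliance T (tapp T xi) = xi.
Proof.

move=> s; rewrite /compliance; have h := @pinvKV _ _ (fun=> 0 : 'M[R]_3) _ (tapp T) tapp_sym_inj; by apply: h; rewrite inE.
Qed.

Lemma compliance_inv sigma : symM sigma -> compliance T sigma = tapp_inv T sigma.
Proof. by move=> /tapp_invP [s {1}<-]; exact: compliance_tapp. Qed.

(** With x the inverse image, coercivity reads alpha |x|^2 <= (sigma, x); expanding |sigma - alpha
    x|^2 >= 0 gives |sigma|^2 >= 2 alpha (sigma, x) - alpha^2 |x|^2 >= alpha^2 |x|^2. *)
Lemma tapp_inv_bound sigma : symM sigma ->
  frob (tapp_inv T sigma) (tapp_inv T sigma) <= alpha ^- 2 * frob sigma sigma.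
Proof.
move=> ss; have [s e] := tapp_invP ss; set x := tapp_inv T sigma in s e *.
have h := T_coe s; rewrite e in h.
have : 0 <= frob (sigma - alpha *: x) (sigma - alpha *: x).
  by apply: sumr_ge0 => i _; apply: sumr_ge0 => j _; rewrite -expr2 sqr_ge0.
rewrite -scaleNr frobDl !frobDr !frobZl !frobZr (frobC x) => h1.
rewrite mulrC ler_pdivlMr ?exprn_gt0 //.
have h2 := ler_wpM2l (ltW alpha0) h.
move: h1 h2; clear.
move: (frob sigma sigma) (frob sigma x) (frob x x) => a b c h1 h2; nra.
Qed.

End tensor_inverse.

Section constitutive.
Variable R : realType.
Local Notation E := (R * R * R)%type.
Local Notation EB :=
  (measurableTypeR R * measurableTypeR R * measurableTypeR R)%type.
Local Notation mu := (leb3 R).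

Lemma tapp_inv_linear (T : tensor4 R) : linear (tapp_inv T).
Proof.
by move=> a x y; rewrite /tapp_inv linearP mulmxDl -scalemxAl linearP.
Qed.

HB.instance Definition _ (T : tensor4 R) :=
  GRing.isLinear.Build R 'M[R]_3 'M[R]_3 *:%R (tapp_inv T) (tapp_inv_linear T).

HB.instance Definition _ :=
  GRing.isLinear.Build R 'M[R]_3 'M[R]_3 *:%R (@symp R) (@symp_linear R).

Lemma linear_scale (f : 'M[R]_3 -> 'M[R]_3) : linear f -> forall a x, f (a *: x) = a *: f x.
Proof.
move=> h a x; have f0 : f 0 = 0 by have := h (-1) 0 0; rewrite scaler0 addr0 scaleN1r addNr.
by rewrite -[a *: x]addr0 h f0 addr0.
Qed.

(** Separates nine coefficients depending on [T] alone from the entries of [sigma], so that L^2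
    bounds can be read entrywise. The basis matrices are symmetrized since [tapp_inv_bound] concerns
    symmetric arguments. *)
Lemma tapp_inv_sum (T : tensor4 R) (sigma : 'M[R]_3) : symM sigma ->
  tapp_inv T sigma = \sum_i \sum_j sigma i j *: tapp_inv T (symp (delta_mx i j)).
Proof.
move=> ss; rewrite -[in LHS](sympE ss) [in LHS](matrix_sum_delta sigma) linear_sum linear_sum.
apply: eq_bigr => i _; rewrite linear_sum linear_sum; apply: eq_bigr => j _.
change (tapp_inv T (symp (sigma i j *: delta_mx i j)) = sigma i j *: tapp_inv T (symp (delta_mx i j))).
by rewrite (linear_scale (@symp_linear R)) (linear_scale (@tapp_inv_linear T)).
Qed.

Variable C : E -> tensor4 R.
Hypothesis mC : forall i j k l, measurable_fun [set: EB] (fun y => C y i j k l).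

Lemma measurable_tapp (D : 'M[R]_3) i j : measurable_fun [set: EB] (fun y => tapp (C y) D i j).
Proof.
have -> : (fun y => tapp (C y) D i j) = (fun y => \sum_k \sum_l C y i j k l * D k l).
  by apply/funext => y; rewrite mxE.
by apply: measurable_sum => k; apply: measurable_sum => l; exact: measurable_funM.
Qed.

Lemma measurable_tapp_inv (D : 'M[R]_3) i j :
  measurable_fun [set: EB] (fun y => tapp_inv (C y) D i j).
Proof.
pose M (y : E) := lin_mx (tapp_ext (C y)).
have mM p q : measurable_fun [set: EB] (fun y => M y p q).
  case/mxvec_indexP: q => a b.
  pose D' : 'M[R]_3 := vec_mx (delta_mx 0 p).
  have -> : (fun y => M y p (mxvec_index a b)) =
      (fun y => tapp (C y) (symp D') a b + (D' - symp D') a b).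
    by apply/funext => y; rewrite /M mxE /= mxvecE /tapp_ext mxE.
  by apply: measurable_funD => //; exact: measurable_tapp.
have -> : (fun y => tapp_inv (C y) D i j) = (fun y => \sum_p mxvec D 0 p *
    ((\det (M y))^-1 * (\adj (M y)) p (mxvec_index i j))).
  apply/funext => y; rewrite /tapp_inv mxE mxE; apply: eq_bigr => p _.
  by rewrite [in LHS]mxE.
apply: measurable_sum => p; apply: measurable_funM => //; apply: measurable_funM.
  apply: (measurableT_comp (@measurable_inv R)); exact: measurable_det.
exact: (measurable_adj mM).
Qed.

Variable g : 'I_3 -> E.
Hypothesis C_rigid : rigidity g C.

Lemma L2pers_tapp (e : E -> 'M[R]_3) : L2pers g e -> L2pers g (fun y => tapp (C y) (e y)).
Proof.
move=> [/L2l_entry Le pe se]; have [pC _ bC sC _] := C_rigid; split.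
- apply: L2locM_entry => i j.
  have -> : (fun y => tapp (C y) (e y) i j) = (fun y => \sum_k \sum_l C y i j k l * e y k l).
    by apply/funext => y; rewrite mxE.
  apply: L2l_sum => k; apply: L2l_sum => l; have [M hM] := bC i j k l.
  exact: L2l_mul_ae_bounded hM (Le k l).
- by move=> t lt; move: (pC t lt) (pe t lt); apply: aeS2 => y -> ->.
- by move: sC se; apply: aeS2 => y [h _] h2; exact: h.
Qed.

(* [compliance (C y)] is arbitrary on the negligible set where [C y] is not
   elastic, so that the left-hand side of the first equality need not be
   measurable. *)
Lemma compliance_field (sigma : E -> 'M[R]_3) : L2pers g sigma ->
  exists2 e : E -> 'M[R]_3, L2pers g e &
    {ae mu, forall y : E, compliance (C y) (sigma y) = e y /\ tapp (C y) (e y) = sigma y}.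
Proof.
move=> [/L2l_entry Ls ps ss]; have [pC _ bC sC [alpha a0 cC]] := C_rigid.
have good := aeS2 (fun y (a : elastic_sym (C y))
  (b : forall xi, symM xi -> alpha * frob xi xi <= frob (tapp (C y) xi) xi) => conj a b) sC cC.
(* The explicit formula is measurable on the whole space, including the null set where [C y] is not
   elastic. *)
pose e (y : E) : 'M[R]_3 := \sum_i \sum_j sigma y i j *: tapp_inv (C y) (symp (delta_mx i j)).
have eE : {ae mu, forall y : E, [/\ symM (e y), compliance (C y) (sigma y) = e y &
    tapp (C y) (e y) = sigma y]}.
  move: good ss; apply: aeS2 => y [h1 h2] h3.
  have [i1 i2] := tapp_invP a0 h1 h2 h3.
  have e1 : e y = tapp_inv (C y) (sigma y) by rewrite tapp_inv_sum.
  by rewrite e1; split => //; exact: (compliance_inv a0 h1 h2 h3).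
exists e; last by apply: aeS eE => y [].
split; last by apply: aeS eE => y [].
- apply: L2locM_entry => k l.
  have -> : (fun y => e y k l) =
      (fun y => \sum_i \sum_j tapp_inv (C y) (symp (delta_mx i j)) k l * sigma y i j).
    apply/funext => y; rewrite /e summxE; apply: eq_bigr => i _.
    by rewrite summxE; apply: eq_bigr => j _; rewrite mxE mulrC.
  apply: L2l_sum => i; apply: L2l_sum => j.
  set D := symp _; pose c := alpha ^- 2 * frob D D.
  (* From a square at most [c], hence at most [(c + 1) ^+ 2], the bound [c + 1] follows without a
     square root. *)
  apply: (@L2l_mul_ae_bounded _ _ _ (c + 1)) (Ls i j); first exact: measurable_tapp_inv.
  move: good; apply: aeS => y [h1 h2].
  have := tapp_inv_bound a0 h1 h2 (symM_sym (delta_mx i j)); rewrite -/D -/c => hc.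
  have hx : tapp_inv (C y) D k l ^+ 2 <= c.
    apply: le_trans hc; rewrite /frob (bigD1 k) //= (bigD1 l) //= -addrA expr2 lerDl.
    apply: addr_ge0; first by apply: sumr_ge0 => b _; rewrite -expr2 sqr_ge0.
    by apply: sumr_ge0 => a _; apply: sumr_ge0 => b _; rewrite -expr2 sqr_ge0.
  have c0 : 0 <= c by apply: le_trans hx; exact: sqr_ge0.
  rewrite -(@ler_pXn2r _ 2) ?nnegrE ?addr_ge0 // -normrX ger0_norm ?sqr_ge0 //.
  apply: le_trans hx _; nra.
- move=> t lt; move: (pC t lt) (ps t lt); apply: aeS2 => y e1 e2.
  by rewrite /e e1 e2.
Qed.

End constitutive.

(** * Periodic weak gradients *)

Section periodic_gradients.
Variable R : realType.
Local Notation E := (R * R * R)%type.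
Local Notation EB :=
  (measurableTypeR R * measurableTypeR R * measurableTypeR R)%type.
Local Notation mu := (leb3 R).

Lemma derive_translate (f : E -> R) (t v : E) :
  'D_v (fun y => f (y + t)) = (fun y => 'D_v f (y + t)).
Proof.
apply/funext => z; rewrite /derive /=.
by under [in RHS]eq_fun do rewrite addrA.
Qed.

Lemma test_translate (psi : E -> R) (t : E) : test_fun psi -> test_fun (fun y => psi (y + t)).
Proof.
move=> /test_funP [sp [r bp]]; apply/test_funP; split.
  move=> s; have -> : iter_partial s (fun y : E => psi (y + t)) =
      (fun y => iter_partial s psi (y + t)).
    by elim: s => //= j s ->; exact: derive_translate.
  have [c d] := sp s; split.
    move=> y; apply: (@continuous_comp E E R (fun z => z + t) (iter_partial s psi)); last exact: c.
    by apply: (@cvgD _ E E); [exact: cvg_id|exact: cvg_cst].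
  move=> j y; have := d j (y + t); rewrite /derivable /=.
  by under eq_fun do rewrite addrA.
have [r' hr'] := in_cub t; exists (r + r'%:R) => y ny; apply: bp => h; apply: ny.
by rewrite -[y](addrK t); apply: cubD => //; exact/cubN.
Qed.

Variable g : 'I_3 -> E.
Hypothesis g_free : free [seq g i | i : 'I_3].
Local Notation Y := (cell g).
Let mY := measurable_cell g_free.

(** A translate of [G] is a weak gradient of the translate of [v], which is [v] almost everywhere;
    uniqueness concludes. [H1per] itself asks periodicity of [v] alone. *)
Lemma weak_grad_periodic (v : E -> 'cV[R]_3) (G : E -> 'M[R]_3) :
  L2locM v -> Defs.periodic g v -> is_weak_grad v G -> Defs.periodic g G.
Proof.
move=> /L2l_entry Lv pv [/L2l_entry LG hG] t lt.
apply: (@weak_grad_unique R v (fun y => G (y + t)) G); last by split => //; exact: L2locM_entry.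
split; first by apply: L2locM_entry => i j; exact: (L2l_shift t (LG i j)).
move=> psi tp i j; pose psi' (y : E) := psi (y - t).
have tp' : test_fun psi' by exact: test_translate.
have shiftI f : measurable_fun [set: EB] f -> \int[mu]_y f (y + t) = \int[mu]_y f y.
  by move=> mf; exact: (mpres_Rintegral (leb3_shift t) mf).
have -> : \int[mu]_y (G (y + t) i j * psi y) = \int[mu]_y (G y i j * psi' y).
  rewrite -(shiftI (fun y => G y i j * psi' y)); last first.
    by apply: measurable_funM; [exact: (LG i j).1|exact: (test_measurable tp')].
  by apply: eq_Rintegral => y _; rewrite /psi' addrK.
transitivity (dpartial j (fun y => v y i 0) psi'); last exact: hG.
rewrite /dpartial; apply: (congr1 -%R).
have mD f : test_fun f -> measurable_fun [set: EB] ('D_(dirv R j) f).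
  by move=> tf; apply: test_measurable; exact: test_partial.
rewrite -[RHS](shiftI (fun y => v y i 0 * 'D_(dirv R j) psi' y)); last first.
  by apply: measurable_funM; [exact: (Lv i 0).1|exact: (mD _ tp')].
have Lvt : L2l (fun y => v (y + t) i 0) by exact: (L2l_shift t (Lv i 0)).
apply: ae_eq_Rintegral => //.
- by apply: measurable_funM; [exact: (Lv i 0).1|exact: mD].
- apply: measurable_funM; first exact: Lvt.1.
  exact: (measurable_lat t (mD _ tp')).
apply: aeS (pv t lt) => y ->.
have -> : 'D_(dirv R j) psi' (y + t) = 'D_(dirv R j) psi y.
  have /(congr1 (fun f => f (y + t))) := derive_translate psi (- t) (dirv R j).
  by rewrite /= addrK.
by [].
Qed.

Lemma weak_grad_add (u v : E -> 'cV[R]_3) (G H : E -> 'M[R]_3) :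
  L2locM u -> L2locM v -> is_weak_grad u G -> is_weak_grad v H ->
  is_weak_grad (fun y => u y + v y) (fun y => G y + H y).
Proof.
move=> /L2l_entry Lu /L2l_entry Lv [/L2l_entry LG hG] [/L2l_entry LH hH]; split.
  apply: L2locM_entry => i j.
  have -> : (fun y => (G y + H y) i j) = (fun y => G y i j + H y i j).
    by apply/funext => y; rewrite mxE.
  exact: L2l_add.
move=> psi tp i j; have tp' := test_partial j tp.
have mulI (f h : E -> R) : L2l f -> test_fun h -> mu.-integrable setT (EFin \o (fun y => f y * h y)).
  move=> Lf th; have [r b] := test_bsupp th; have [M hM] := test_bounded th.
  exact: (loc_int_mul (L2l_loc_int Lf) (test_measurable th) hM b).
transitivity (dpartial j (fun y => u y i 0) psi + dpartial j (fun y => v y i 0) psi).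
  rewrite /dpartial -opprD -RintegralD //; [|exact: mulI|exact: mulI].
  by congr (- _); apply: eq_Rintegral => y _; rewrite mxE mulrDl.
rewrite hG // hH // -RintegralD //; [|exact: mulI|exact: mulI].
by apply: eq_Rintegral => y _; rewrite mxE mulrDl.
Qed.

Definition aff (A : 'M[R]_3) (c : 'cV[R]_3) (y : E) : 'cV[R]_3 := A *m colv y + c.

Lemma aff_dqlim (A : 'M[R]_3) (c : 'cV[R]_3) i j :
  dqlim j (fun y => aff A c y i 0) (fun=> A i j).
Proof.
have affE y : aff A c y i 0 = A i 0 * y.1.1 + A i 1 * y.1.2 + A i 2%:R * y.2 + c i 0.
  rewrite /aff !mxE !big_ord_recl big_ord0 addr0 !mxE /= addrA.
  congr (_ * _ + _ * _ + _ * _ + _); congr (A i _); exact/val_inj.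
have maff : measurable_fun [set: EB] (fun y => aff A c y i 0).
  have -> : (fun y => aff A c y i 0) =
      (fun y : E => A i 0 * y.1.1 + A i 1 * y.1.2 + A i 2%:R * y.2 + c i 0).
    by apply/funext => y; exact: affE.
  have m1 : measurable_fun [set: EB] (fun y : E => y.1.1 : R).
    exact: (measurableT_comp measurable_fst measurable_fst).
  have m2 : measurable_fun [set: EB] (fun y : E => y.1.2 : R).
    exact: (measurableT_comp measurable_snd measurable_fst).
  have m3 : measurable_fun [set: EB] (fun y : E => y.2 : R) by exact: measurable_snd.
  by repeat (apply: measurable_funD || apply: measurable_funM).
have dqE (h : R) y : h != 0 -> dq j h (fun y => aff A c y i 0) y = A i j.
  move=> h0; rewrite /dq !affE /dirv /=.
  case: j => [[|[|[|//]]] jl]; rewrite /= /GRing.scale /= ?mulr0 ?mulr1 ?addr0;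
    [have -> : Ordinal jl = 0 by exact/val_inj|have -> : Ordinal jl = 1 by exact/val_inj
    |have -> : Ordinal jl = 2%:R by exact/val_inj]; by field.
split => //.
- move=> r; exists (`|A i 0| * r + `|A i 1| * r + `|A i 2%:R| * r + `|c i 0| + `|A i j|).
  move=> y h [h1 h2 h3] /andP[h0 _]; rewrite normr_gt0 in h0; rewrite dqE //.
  have r0 : 0 <= r by exact: le_trans h1.
  split; last by rewrite lerDr !addr_ge0 ?mulr_ge0.
  rewrite affE; apply: le_trans (ler_normD _ _) _; rewrite -[leLHS]addr0.
  apply: lerD => //; apply: lerD => //.
  apply: le_trans (ler_normD _ _) _; apply: lerD; last by rewrite normrM ler_wpM2l.
  apply: le_trans (ler_normD _ _) _; apply: lerD; by rewrite normrM ler_wpM2l.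
- move=> y u u0 _; under eq_fun do rewrite dqE //; exact: cvg_cst.
Qed.

Lemma aff_L2locM (A : 'M[R]_3) (c : 'cV[R]_3) : L2locM (aff A c).
Proof.
apply: L2locM_entry => i j; rewrite [j]ord1.
by have [] := dqlim_L2l (aff_dqlim A c i 0).
Qed.

Lemma aff_weak_grad (A : 'M[R]_3) (c : 'cV[R]_3) : is_weak_grad (aff A c) (fun=> A).
Proof.
split; first by apply: L2locM_entry => i j; exact: L2l_cst.
by move=> psi tp i j; rewrite (integral_by_parts (aff_dqlim A c i j) tp).
Qed.

(** Unfolding the square of [f] against the indicator of each cube carries its vanishing on the cell
    to the whole space. *)
Lemma periodic_ae0 (f : E -> R) : L2l f -> Defs.periodic g f -> ipL2 mu Y f f = 0 ->
  {ae mu, forall y, f y = 0}.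
Proof.
move=> Lf pf f0; have aeY := L2on_ae0 mY (L2l_cell g_free Lf) f0.
have [mf _] := Lf.
have h (n : nat) : {ae mu, forall y : E, cub n%:R y -> f y = 0}.
  have mc := measurable_cub (n%:R : R).
  apply: (L2on_ae0 mc); first by have [_] := Lf; apply.
  have b1 : bsupp n%:R (\1_(cub n%:R) : E -> R).
    by move=> y ny; rewrite indicE memNset.
  have i1 (y : E) : `|\1_(cub n%:R) y| <= (1 : R).
    by rewrite indicE; case: (_ \in _); rewrite ?normr1 ?normr0.
  have pff : Defs.periodic g (fun y => f y * f y) by move=> t lt; apply: aeS (pf t lt) => y ->.
  have := unfold_Per g_free (L2l_mul Lf Lf) pff (measurable_indic mc) i1 b1.
  have mP := measurable_Per g_free (measurable_indic mc) b1.
  have mff : measurable_fun [set: EB] (fun y => f y * f y) by exact: measurable_funM.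
  have -> : \int[mu]_(y in Y) (f y * f y * Per g \1_(cub n%:R) y) = 0.
    rewrite -[LHS]/(ipL2 mu Y (fun y => f y * f y) (Per g \1_(cub n%:R))).
    rewrite (@ae_ipL2 _ _ _ mu _ mY _ (fun=> 0) _ (Per g \1_(cub n%:R))) //.
    - by rewrite /ipL2; under eq_Rintegral do rewrite mul0r; rewrite (Rintegral_cst _ mY) mul0r.
    - by apply: aeS aeY => y hy /hy ->; rewrite mul0r.
    - exact: aeW.
  move=> <-; rewrite /ipL2 [LHS]Rintegral_mkcond; apply: eq_Rintegral => y _.
  by rewrite patchE indicE; case: (_ \in _); rewrite ?mulr1 ?mulr0.
have := ae_foralln h; apply: aeS => y hy; have [n hn] := in_cub y; exact: hy hn.
Qed.

(** The admissible field is the periodization of a test function placed in one component, with its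
    mean removed; unfolding its gradient gives back the distributional divergence. *)
Lemma div_free_pgrad (sigma : E -> 'M[R]_3) : L2pers g sigma ->
  (forall v, H1per0 g v -> forall G, is_weak_grad v G ->
     \int[mu]_(y in Y) frob (sigma y) (G y) = 0) -> div_free sigma.
Proof.
move=> [Ls ps _] h psi tp i; have Lsij := L2l_entry Ls.
pose q (k : 'I_3) : E -> R := if k == i then psi else (fun=> 0).
have tq k : test_fun (q k) by rewrite /q; case: eqP => // _; exact: test0.
pose v (y : E) : 'cV[R]_3 := \col_k pphi g q k y.
pose G (y : E) : 'M[R]_3 := \matrix_(k, l) pgrad g q k l y.
have vE k l : (fun y => v y k l) = pphi g q k by apply/funext => y; rewrite mxE.
have GE k l : (fun y => G y k l) = pgrad g q k l by apply/funext => y; rewrite mxE.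
have LG : L2locM G.
  by apply: L2locM_entry => k l; rewrite GE; apply: L2l_Per => //; exact: test_partial.
have wG : is_weak_grad v G.
  split => // chi tc k l; rewrite vE -[RHS]/(\int[mu]_y ((fun y => G y k l) y * chi y)) GE.
  by rewrite /dpartial (integral_by_parts (pphi_dqlim g_free l (tq k)) tc).
have Hv : H1per0 g v.
  split; last first.
    apply/matrixP => k l; rewrite !mxE.
    transitivity (\int[mu]_(y in Y) pphi g q k y); last exact: pphi_mean0.
    by apply: eq_Rintegral => y _; rewrite mxE.
  split; last by apply: entry_periodic => k l; rewrite vE; exact: pphi_periodic.
  by split; [apply: L2locM_entry => k l; rewrite vE; exact: pphi_L2l|exists G].
have := h v Hv G wG; rewrite Rintegral_frob // (bigD1 i) //= [X in _ + X]big1 ?addr0; last first.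
  move=> k /negPf ki; rewrite big1 // => l _.
  have -> : (fun y => sigma y k l * G y k l) = fun=> 0.
    by apply/funext => y; rewrite mxE /pgrad /q ki Per_partial0 mulr0.
  by rewrite (Rintegral_cst _ mY) mul0r.
move=> z0; apply/eqP; rewrite -oppr_eq0 -sumrN; apply/eqP; rewrite -[RHS]z0.
apply: eq_bigr => j _; rewrite /dpartial opprK.
rewrite (unfold_test g_free (Lsij i j) (periodic_entry i j ps) (test_partial j tp)).
by rewrite /ipL2; apply: eq_Rintegral => y _; rewrite mxE /pgrad /q eqxx.
Qed.

End periodic_gradients.

(** * The equivalence *)

Section equivalence.
Variable R : realType.
Local Notation E := (R * R * R)%type.
Local Notation EB :=
  (measurableTypeR R * measurableTypeR R * measurableTypeR R)%type.
Local Notation mu := (leb3 R).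
Variable g : 'I_3 -> E.
Hypothesis g_free : free [seq g i | i : 'I_3].
Local Notation Y := (cell g).
Let mY := measurable_cell g_free.

Lemma L2pers_sym_grad (v : E -> 'cV[R]_3) (G : E -> 'M[R]_3) :
  L2locM v -> is_weak_grad v G -> Defs.periodic g G -> L2pers g (grads v).
Proof.
move=> Lv hG pG; have Hv : H1loc v by split => //; exists G.
have gE := grads_ae Lv hG; have [/L2l_entry Lg _] := grad_weak Hv; split.
- apply: L2locM_entry => i j.
  have -> : (fun y => grads v y i j) = (fun y => 2^-1 * (grad v y i j + grad v y j i)).
    by apply/funext => y; rewrite !mxE.
  by apply: L2l_scale; exact: L2l_add.
- move=> t lt; have h := mpres_ae (leb3_shift t) gE.
  have h2 := aeS2 (fun y (a : grads v y = 2^-1 *: (G y + (G y)^T))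
    (b : grads v (y + t) = 2^-1 *: (G (y + t) + (G (y + t))^T)) => conj a b) gE h.
  by move: h2 (pG t lt); apply: aeS2 => y [-> ->] ->.
- by apply: aeW => y; exact: symM_sym.
Qed.

(** [A] is symmetric, hence its own strain. The translation [c] is zero for (a) => (b) and
    normalizes the mean for the converse. *)
Lemma affine_grads (A : 'M[R]_3) (c : 'cV[R]_3) (phi w : E -> 'cV[R]_3) (G : E -> 'M[R]_3) :
  symM A -> H1per g phi -> is_weak_grad phi G -> (forall y, w y = aff A c y + phi y) ->
  [/\ L2locM w, is_weak_grad w (fun y => A + G y),
      {ae mu, forall y : E, grads w y = A + 2^-1 *: (G y + (G y)^T)} & L2pers g (grads w)].
Proof.
move=> sA [[Lphi _] pphi] wG wE.
have -> : w = (fun y => aff A c y + phi y) by apply/funext.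
have La := aff_L2locM A c.
have Lw : L2locM (fun y => aff A c y + phi y).
  apply: L2locM_entry => i j.
  have -> : (fun y => (aff A c y + phi y) i j) = (fun y => aff A c y i j + phi y i j).
    by apply/funext => y; rewrite mxE.
  by apply: L2l_add; exact: L2l_entry.
have wW := weak_grad_add La Lphi (aff_weak_grad A c) wG.
have pG := weak_grad_periodic Lphi pphi wG.
split => //.
  apply: aeS (grads_ae Lw wW) => y ->; apply/matrixP => i j.
  have Aij : A j i = A i j by rewrite -[in LHS]sA mxE.
  by rewrite !mxE Aij; field.
by apply: L2pers_sym_grad wW _ => // t lt; apply: aeS (pG t lt) => y ->.
Qed.

Lemma frob_sum_cst (A : 'M[R]_3) (m : E -> 'M[R]_3) : L2locM m -> meanM g m = 0 ->
  \int[mu]_(y in Y) frob A (m y) = 0.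
Proof.
move=> Lm m0.
have LA : L2locM (fun _ : E => A) by apply: L2locM_entry => i j; exact: L2l_cst.
rewrite (Rintegral_frob g_free LA Lm).
rewrite big1 // => i _; rewrite big1 // => j _.
rewrite RintegralZl //; last exact: (integrable_cell g_free (L2l_loc_int (L2l_entry Lm i j))).
have V0 : (fine (mu Y))^-1 != 0 by rewrite invr_eq0 gt_eqF // leb3_cell_gt0.
move: m0 => /matrixP /(_ i j); rewrite !mxE => /eqP; rewrite mulf_eq0 (negPf V0) /=.
by move=> /eqP ->; rewrite mulr0.
Qed.

Lemma Rintegral_frob_sym (m G : E -> 'M[R]_3) (D : set EB) : {ae mu, forall y, symM (m y)} ->
  \int[mu]_(y in D) frob (m y) (2^-1 *: (G y + (G y)^T)) = \int[mu]_(y in D) frob (m y) (G y).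
Proof. by move=> sm; apply: ae_eq_Rintegral_nonmeas; apply: aeS sm => y h; exact: frob_sym. Qed.

(** The constant strain is annihilated by the zero mean of [m], the periodic one by its zero
    divergence and symmetry. Both directions of the equivalence use it. *)
Lemma frob_ortho_affine (A : 'M[R]_3) (phi : E -> 'cV[R]_3) (m e G : E -> 'M[R]_3) :
  H1per g phi -> is_weak_grad phi G -> stress g 0 m ->
  {ae mu, forall y : E, e y = A + 2^-1 *: (G y + (G y)^T)} ->
  \int[mu]_(y in Y) frob (e y) (m y) = 0.
Proof.
move=> Hphi wG [Lm dm m0] eE; have [Lm2 _ sm] := Lm; have [LG _] := wG.
have LG2 : L2locM (fun y => 2^-1 *: (G y + (G y)^T)).
  apply: L2locM_entry => i j.
  have -> : (fun y => (2^-1 *: (G y + (G y)^T)) i j) = (fun y => 2^-1 * (G y i j + G y j i)).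
    by apply/funext => y; rewrite !mxE.
  by apply: L2l_scale; apply: L2l_add; exact: L2l_entry.
have LA : L2locM (fun=> A) by move=> *; apply: L2locM_entry => i j; exact: L2l_cst.
have I1 := integrable_cell g_free (loc_int_frob LA Lm2).
have I2 := integrable_cell g_free (loc_int_frob Lm2 LG2).
transitivity (\int[mu]_(y in Y) (frob A (m y) + frob (m y) (2^-1 *: (G y + (G y)^T)))).
  apply: ae_eq_Rintegral_nonmeas; apply: aeS eE => y ->.
  by rewrite frobDl [X in _ + X]frobC.
rewrite RintegralD // frob_sum_cst // Rintegral_frob_sym // add0r.
exact: stress_orthogonal wG.
Qed.

Variables (C : E -> tensor4 R) (S : 'M[R]_3).
Hypothesis C_rigid : rigidity g C.

Lemma problem_a_b (w : E -> 'cV[R]_3) : problem_a g C S w ->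
  problem_b g C S (fun y => tapp (C y) (grads w y)).
Proof.
move=> [[[A [phi [sA Hphi wE]]] w0] mS orth].
have [[Lphi [G wG]] pphi] := Hphi.
have [|Lw wW gE Le] := affine_grads (c := 0) (w := w) sA Hphi wG.
  by move=> y; rewrite wE /aff addr0.
have [_ mC _ sC [alpha a0 cC]] := C_rigid; have [_ _ se] := Le.
have Ls := L2pers_tapp mC C_rigid Le; have [_ _ ss] := Ls.
split; first split => //.
(* Problem (a) tests with strains; since the stress is symmetric, full gradients give the same
   integrals. *)
- apply: (div_free_pgrad g_free Ls) => v Hv H wH.
  transitivity (\int[mu]_(y in Y) frob (tapp (C y) (grads w y)) (grads v y)); last exact: orth.
  rewrite -(Rintegral_frob_sym H Y ss); apply: ae_eq_Rintegral_nonmeas.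
  by have [[[Lv _] _] _] := Hv; apply: aeS (grads_ae Lv wH) => y ->.
- move=> m hm; rewrite -[RHS](frob_ortho_affine Hphi wG hm gE).
  apply: ae_eq_Rintegral_nonmeas; have good := aeS2 (fun y (a : elastic_sym (C y))
    (b : forall xi, symM xi -> alpha * frob xi xi <= frob (tapp (C y) xi) xi) => conj a b) sC cC.
  move: good se; apply: aeS2 => y [h1 h2] h3.
  by rewrite (compliance_tapp a0 h2).
Qed.

Lemma problem_b_a (sigma : E -> 'M[R]_3) : problem_b g C S sigma ->
  exists w : E -> 'cV[R]_3, [/\ LP0 g w,
    {ae mu, forall y : E, sigma y = tapp (C y) (grads w y)} & problem_a g C S w].
Proof.
move=> [[Ls ds mS] orth]; have [Ls2 _ ss] := Ls; have [_ mC _ _ _] := C_rigid.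
have [e Le eE] := compliance_field mC C_rigid Ls; have [Le2 _ _] := Le.
have [phi [G [tau [Hphi wG mG stau decE]]]] := helmholtz g_free Le.
set A := meanM g e in decE; have sA : symM A by exact: meanM_sym.
have [Ltau dtau mtau] := stau; have [Lt2 pt _] := Ltau.
have tau0 : {ae mu, forall y : E, tau y = 0}.
  have z : \int[mu]_(y in Y) frob (tau y) (tau y) = 0.
    have h1 : \int[mu]_(y in Y) frob (e y) (tau y) = 0.
      rewrite -[RHS](orth tau stau); apply: ae_eq_Rintegral_nonmeas.
      by apply: aeS eE => y [-> _].
    have I1 := integrable_cell g_free (loc_int_frob Le2 Lt2).
    have I2 := integrable_cell g_free (loc_int_frob Lt2 Lt2).
    have : \int[mu]_(y in Y) (frob (e y) (tau y) - frob (tau y) (tau y)) = 0.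
      transitivity (\int[mu]_(y in Y) frob (A + 2^-1 *: (G y + (G y)^T)) (tau y)).
        by apply: eq_Rintegral => y _; rewrite {1}decE frobDl addrK.
      by apply: (frob_ortho_affine Hphi wG stau (A := A)); exact: aeW.
    by rewrite RintegralB // h1 sub0r => /eqP; rewrite oppr_eq0 => /eqP.
  have sq0 i j : 0 <= \int[mu]_(y in Y) (tau y i j * tau y i j).
    by apply: Rintegral_ge0 => y _; rewrite -expr2 sqr_ge0.
  (* The integral of a sum of squares is zero, so each entry vanishes on the cell and, by
     periodicity, everywhere. *)
  have tij i j : {ae mu, forall y : E, tau y i j = 0}.
    apply: (periodic_ae0 g_free); [exact: (L2l_entry Lt2)|exact: periodic_entry|].
    move: z; rewrite Rintegral_frob // => /eqP; rewrite psumr_eq0; last first.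
      by move=> k _; exact: sumr_ge0.
    move=> /allP /(_ i); rewrite mem_index_enum /= => /(_ isT); rewrite psumr_eq0 //.
    by move=> /allP /(_ j); rewrite mem_index_enum /= => /(_ isT) /eqP.
  have := ae_forall (fun ij : 'I_3 * 'I_3 => tij ij.1 ij.2).
  by apply: aeS => y h; apply/matrixP => i j; rewrite mxE; exact: (h (i, j)).
(* Minus the mean of the field on the cell: this translation makes the mean of [w] zero and changes
   no strain. *)
pose c : 'cV[R]_3 := - ((fine (mu Y))^-1 *: intM Y (fun y => A *m colv y + phi y)).
pose w y := aff A c y + phi y.
have [//|Lw wW gE _] := affine_grads (c := c) (w := w) sA Hphi wG.
have sE : {ae mu, forall y : E, sigma y = tapp (C y) (grads w y)}.
  have h := aeS2 (fun y (a : grads w y = A + 2^-1 *: (G y + (G y)^T)) (b : tau y = 0) => conj a b) gE tau0.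
  move: h eE; apply: aeS2 => y [-> t0] [_ <-].
  by rewrite decE t0 addr0.
have wLP0 : LP0 g w.
  split.
    (* [LP] has no separate translation, so [c] is absorbed in the periodic part, as an affine map
       with zero matrix. *)
    exists A, (fun y => aff 0 c y + phi y); split; first exact: sA; last first.
      by move=> y; rewrite /w /aff mul0mx add0r addrA.
    have s0 : symM (0 : 'M[R]_3) by rewrite /symM /= trmx0.
    have [//|Lw' wW' _ _] := affine_grads (c := c) (w := fun y => aff 0 c y + phi y) s0 Hphi wG.
    split; first by split => //; exists (fun y => 0 + G y).
    by have [_ pphi] := Hphi; move=> t lt; apply: aeS (pphi t lt) => y ->; rewrite /aff !mul0mx.
  apply/matrixP => i j; rewrite [RHS]mxE mxE.
  have Ic := L2l_cst (c i j); have Lu := L2l_sub (L2l_entry Lw i j) Ic.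
  have I1 := integrable_cell g_free (L2l_loc_int Lu).
  have I2 := integrable_cell g_free (L2l_loc_int Ic).
  have uE : \int[mu]_(y in Y) (w y i j - c i j) = \int[mu]_(y in Y) (A *m colv y + phi y) i j.
    apply: eq_Rintegral => y _; rewrite /w /aff; move: (A *m colv y) => B.
    by rewrite !mxE; ring.
  transitivity (\int[mu]_(y in Y) ((w y i j - c i j) + c i j)).
    by apply: eq_Rintegral => y _; rewrite subrK.
  rewrite RintegralD // uE (Rintegral_cst _ mY) /c !mxE mulNr mulrAC mulVf ?mul1r ?subrr //.
  by rewrite gt_eqF // leb3_cell_gt0.
exists w; split => //; split => //.
- rewrite -mS; apply/matrixP => i j; rewrite !mxE; congr (_ * _).
  by apply: ae_eq_Rintegral_nonmeas; apply: aeS sE => y ->.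
- move=> v [Hv _]; rewrite -(stress_orthogonal g_free Ls ds Hv (grad_weak Hv.1)).
  rewrite -(Rintegral_frob_sym (grad v) Y ss); apply: ae_eq_Rintegral_nonmeas.
  by apply: aeS sE => y ->.
Qed.

End equivalence.

Theorem proposition20 (R : realType) (g : 'I_3 -> (R * R * R)%type)
    (g_free : free [seq g i | i : 'I_3])
    (C : R * R * R -> tensor4 R) (C_rigid : rigidity g C)
    (S : 'M[R]_3) (S_sym : symM S) :
  (forall w : R * R * R -> 'cV[R]_3, problem_a g C S w ->
     problem_b g C S (fun y => tapp (C y) (grads w y))) /\
  (forall sigma : R * R * R -> 'M[R]_3, problem_b g C S sigma ->
     exists w : R * R * R -> 'cV[R]_3,
       [/\ LP0 g w,
           {ae @leb3 R, forall y : R * R * R,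
              sigma y = tapp (C y) (grads w y)} &
           problem_a g C S w]).
Proof.
by split; [move=> w; exact: problem_a_b|move=> sigma; exact: problem_b_a].
Qed.
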